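(* Let $\lambda^0\in\Delta_d$, $I=\mathcal I(\lambda^0)$ and $\kappa_0=\kappa(\lambda^0)$. Let $\mathcal H$ be a compact subset of $\mathbb R^d$ and let $k_t:\mathcal H\to\mathbb N^d$ ($t>0$) be Borel maps with $$\sup_{h\in\mathcal H}|k_t(h)-t\lambda^0-\sqrt t\,h|_1=o(\sqrt t)\qquad(t\to\infty).$$ Let $g$ be a transition reward with $\mathbb E_{\mathfrak a}\big[L_1^2+|Y_1|_1^2+(R_1^*(g))^2\big]<\infty$, and put $a_g=\mathbb E_{\mathfrak a}[R_1(g)]$, $\bar g=a_g/\ell$. Let $W=(W_Y,W_L,W_R)$ be a centered Brownian motion in $\mathbb R^{d+2}$ whose covariance matrix at time $1$ is the covariance matrix of $(Y_1,L_1,R_1(g))$ under $\mathbb P_{\mathfrak a}$, and put $$\zeta_{\lambda^0}(h)=\min_{r\in I}\left\{\frac{h_r-W_{Y,r}(\kappa_0)}{m_r}\right\},\qquad h\in\mathcal H.$$ Then, under $\mathbb P_{\mathfrak a}$, the following convergences in distribution hold in $\ell^\infty(\mathcal H)$ as $t\to\infty$: $$\left(\frac{\mathfrak N(k_t(h))-t\kappa_0}{\sqrt t}\right)_{h\in\mathcal H}\xrightarrow{d}\big(\zeta_{\lambda^0}(h)\big)_{h\in\mathcal H},$$ $$\left(\frac{N(k_t(h))-t\ell\kappa_0}{\sqrt t}\right)_{h\in\mathcal H}\xrightarrow{d}\big(W_L(\kappa_0)+\ell\zeta_{\lambda^0}(h)\big)_{h\in\mathcal H},$$ $$\left(\frac{\mathcal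 R_g(k_t(h))-t a_g\kappa_0}{\sqrt t}\right)_{h\in\mathcal H}\xrightarrow{d}\big(W_R(\kappa_0)+a_g\zeta_{\lambda^0}(h)\big)_{h\in\mathcal H},$$ $$\left(\frac{\mathcal R_g(k_t(h))-\bar gN(k_t(h))}{\sqrt t}\right)_{h\in\mathcal H}\xrightarrow{d}\big(W_R(\kappa_0)-\bar gW_L(\kappa_0)\big)_{h\in\mathcal H}.$$
   Context: Notation: $\mathbb N=\{0,1,2,\dots\}$, $d\ge1$; $r\leq_d k$ means $r_j\le k_j$ for all $j$; $0_d$ is the zero vector; $|k|_1=\sum_j|k_j|$. Markov renewal chain. $(\mathsf X,\mathcal X)$ is a standard Borel space and $q=(q_k)_{k\in\mathbb N^d}$ is a family of non-negative kernels on $\mathsf X$ with $\sum_{k}q_k(x,\mathsf X)=1$ for all $x$, assumed strict: $q_{0_d}=0$. The chain $(J_n,S_n)_{n\ge0}$ in $\mathsf X\times\mathbb N^d$ has $S_0=0_d$ and, with $X_{n+1}=S_{n+1}-S_n$, $\mathbb P(J_{n+1}\in A,X_{n+1}=k\mid J_0,S_0,\dots,J_n,S_n)=q_k(J_n,A)$. Put $P(x,A)=\sum_kq_k(x,A)$, $Q(x,A\times B)=\sum_{k\in B}q_k(x,A)$, and $N(k)=\sup\{n\ge0:S_n\leq_dk\}$. Standing assumptions. (i) $P$ is positive Harris recurrent with invariant probability $\pi$, and $0<\mu_r=\int_{\mathsf X}\sum_kk_rq_k(x,\mathsf X)\,\pi(dx)<\infty$ for $r=1,\dots,d$. (ii)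 There are $C\in\mathcal X$ with $\pi(C)>0$, $\varepsilon\in(0,1]$ and a probability measure $\vartheta$ on $\mathsf X\times\mathbb N^d$ with $Q(x,\cdot)\ge\varepsilon\vartheta(\cdot)$ for $x\in C$. Split chain. $\widehat J_n=(J_n,\chi_n)$ lives in $\widehat{\mathsf X}=(\mathsf X\times\{0\})\cup(C\times\{1\})$. Given $\widehat J_n=(x,1)$, $(J_{n+1},X_{n+1})$ has law $\vartheta$; given $(x,0)$ with $x\in C$ it has law $(Q(x,\cdot)-\varepsilon\vartheta)/(1-\varepsilon)$ (not used when $\varepsilon=1$); given $(x,0)$ with $x\notin C$ it has law $Q(x,\cdot)$. Then, given $J_{n+1}=y$, independently of the past, $\chi_{n+1}=1$ with probability $\varepsilon$ and $0$ otherwise if $y\in C$, and $\chi_{n+1}=0$ if $y\notin C$. The set $\mathfrak a=C\times\{1\}$ is an atom. $\mathbb P_{\mathfrak a}$ is the law of the split chain started from the normalized restriction to $\mathfrak a$ of its invariant probability (so $J_0\sim\pi(\cdot\cap C)/\pi(C)$, $\chi_0=1$, $S_0=0_d$); equivalently $\mathfrak a$ is identified with a single state. Cycles. $T_0=0$, $T_{j+1}=\inf\{n>T_j:\widehat J_n\in\mathfrak a\}$; $L_j=T_j-T_{j-1}$, $Y_j=S_{T_j}-S_{T_{j-1}}$, $j\ge1$; $C_n=Y_1+\cdots+Y_n$ ($C_0=0_d$); $\mathfrak N(k)=\sup\{n\ge0:C_n\leq_dk\}$; $m=\mathbb E_{\mathfrak a}[Y_1]$, $\ell=\mathbb E_{\mathfrak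 a}[L_1]$ (finite, $m\in(0,\infty)^d$). Rewards. A transition reward is a measurable real function $g(x,y,k)$ of current state $x$, next state $y$ and increment $k\in\mathbb N^d$. By the atom convention ($\mathfrak a$ is a single state), at a transition leaving $\mathfrak a$ the value of $g$ does not depend on the representative point of $C$; that is, the first argument of $g$ is read in the collapsed space $(\mathsf X\times\{0\})\cup\{\mathfrak a\}$. With this reading, $R_j(g)=\sum_{n=T_{j-1}}^{T_j-1}g(J_n,J_{n+1},X_{n+1})$, $R_j^*(g)=\sum_{n=T_{j-1}}^{T_j-1}|g(J_n,J_{n+1},X_{n+1})|$, and $\mathcal R_g(k)=\sum_{n=0}^{N(k)-1}g(J_n,J_{n+1},X_{n+1})$. Directions. $\Delta_d=\{\lambda\in(0,1)^d:\lambda_1+\cdots+\lambda_d=1\}$, $\kappa(\lambda)=\min_{1\le r\le d}\lambda_r/m_r$, $\mathcal I(\lambda)=\{r:\lambda_r/m_r=\kappa(\lambda)\}$. *)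

(* Defs.v *)
From HB Require Import structures.
From mathcomp Require Import all_boot all_order all_algebra.
From mathcomp Require Import all_classical all_reals all_analysis.

Set Implicit Arguments.
Unset Strict Implicit.
Unset Printing Implicit Defensive.
Import Order.TTheory GRing.Theory Num.Theory.
Import numFieldTopology.Exports numFieldNormedType.Exports.

Local Open Scope classical_set_scope.
Local Open Scope ring_scope.

Definition standard_borel (R : realType) {dX} (X : measurableType dX) : Prop :=
  exists E : completePseudoMetricType R,
    [/\ hausdorff_space E,
        (exists2 D : set E, countable D & dense D)
      & exists2 f : X -> E, bijective f &
          forall A : set X, measurable A <-> <<s @open E >> (f @` A)].

(* Both default to 0 when they are not finite, which for the random times below
   only happens on a null event. *)
Definition nat_sup (A : set nat) : nat :=
  xget 0%N [set n | A n /\ forall p, A p -> (p <= n)%N].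
Definition nat_inf (A : set nat) : nat :=
  xget 0%N [set n | A n /\ forall p, A p -> (n <= p)%N].

Section NatVectors.
Context (d : nat).
Implicit Types j k : d.-tuple nat.

Definition vec0 : d.-tuple nat := [tuple 0%N | i < d].
Definition vadd j k : d.-tuple nat := [tuple (tnth j i + tnth k i)%N | i < d].
(* Truncated; only applied below when k <= j componentwise almost surely. *)
Definition vsub j k : d.-tuple nat := [tuple (tnth j i - tnth k i)%N | i < d].
Definition vle j k : bool := [forall i, tnth j i <= tnth k i]%N.
Definition vnorm1 k : nat := (\sum_(i < d) tnth k i)%N.

End NatVectors.

Section MarkovChain.
Context {R : realType} {dO} {Om : measurableType dO}.
Context {dE} {E : measurableType dE}.

Definition history (Z : nat -> Om -> E) (n : nat) : set (set Om) :=
  <<s [set B | exists i A, [/\ (i <= n)%N, measurable A & B = Z i @^-1` A]] >>.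

Definition markov_chain (P : probability Om R) (Z : nat -> Om -> E)
    (init : set E -> \bar R) (K : E -> set E -> \bar R) : Prop :=
  [/\ forall n, measurable_fun setT (Z n),
      forall A, measurable A -> P (Z 0%N @^-1` A) = init A
    & forall n A B, measurable A -> history Z n B ->
        P (B `&` Z n.+1 @^-1` A) = (\int[P]_(w in B) K (Z n w) A)%E].

End MarkovChain.

Section Harris.
Context {R : realType} {dX} {X : measurableType dX}.
Variables (K : X -> set X -> \bar R) (pi : probability X R).

(* On a standard Borel space the chain started at x exists and its law P_x is
   unique, so that P_x can be read off any realization of this chain. *)
Definition visits_io (x : X) (A : set X) : Prop :=
  exists dO (Om : measurableType dO) (P : probability Om R) (Z : nat -> Om -> X),
    markov_chain P Z (fun B => \d_x B) K /\
    P [set w | forall n, exists2 p, (n <= p)%N & A (Z p w)] = 1%E.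

Definition harris_recurrent : Prop :=
  exists phi : {sigma_finite_measure set X -> \bar R},
    (0 < phi setT)%E /\
    forall A, measurable A -> (0 < phi A)%E -> forall x, visits_io x A.

Definition invariant : Prop :=
  forall A, measurable A -> (\int[pi]_x K x A)%E = pi A.

Definition positive_harris : Prop := harris_recurrent /\ invariant.

End Harris.

Section Kernels.
Context {R : realType} {dX} {X : measurableType dX} {d : nat}.
Variable (q : d.-tuple nat -> R.-ker X ~> X).
Local Open Scope ereal_scope.

Definition kerP (x : X) (A : set X) : \bar R := \esum_(k in setT) q k x A.

Definition kerQ (x : X) (D : set (X * d.-tuple nat)) : \bar R :=
  \esum_(k in setT) q k x [set y | D (y, k)].

Definition mean_incr (pi : probability X R) (r : 'I_d) : \bar R :=
  \int[pi]_x \esum_(k in setT) ((tnth k r)%:R%:E * q k x setT).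

Definition strict_semi_markov : Prop :=
  (forall x, \esum_(k in setT) q k x setT = 1) /\
  (forall x A, measurable A -> q (vec0 d) x A = 0).

Variables (C : set X) (eps : R) (theta : probability (X * d.-tuple nat)%type R).

Definition minorized : Prop :=
  forall x D, C x -> measurable D -> eps%:E * theta D <= kerQ x D.

(* Law of (J_{n+1}, X_{n+1}) given (J_n, chi_n) = xb. *)
Definition split_law (xb : X * bool) (D : set (X * d.-tuple nat)) : \bar R :=
  if xb.2 then theta D
  else if xb.1 \in C then
    ((1 - eps)^-1)%:E * (kerQ xb.1 D - eps%:E * theta D)
  else kerQ xb.1 D.

(* Transition kernel of ((J_n, chi_n), S_n): the pair (J_{n+1}, X_{n+1}) = (y, k)
   is drawn from split_law, chi_{n+1} is then Bernoulli(eps) if y is in C and 0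
   otherwise, and S_{n+1} = S_n + k. *)
Definition split_kernel (z : X * bool * d.-tuple nat)
    (D : set (X * bool * d.-tuple nat)) : \bar R :=
  let D_ b := [set yk : X * d.-tuple nat | D (yk.1, b, vadd z.2 yk.2)] in
  let CN := [set yk : X * d.-tuple nat | C yk.1] in
  eps%:E * split_law z.1 (D_ true `&` CN)
  + (1 - eps)%:E * split_law z.1 (D_ false `&` CN)
  + split_law z.1 (D_ false `\` CN).

Definition atom_init (pi : probability X R)
    (D : set (X * bool * d.-tuple nat)) : \bar R :=
  ((fine (pi C))^-1)%:E * pi ([set x | D (x, true, vec0 d)] `&` C).

End Kernels.

Section Cycles.
Context {R : realType} {dX} {X : measurableType dX} {d : nat}.
Context {dO} {Om : measurableType dO}.
Variables (C : set X) (Z : nat -> Om -> X * bool * d.-tuple nat).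

Definition J_ n w : X := (Z n w).1.1.
Definition chi n w : bool := (Z n w).1.2.
Definition S_ n w : d.-tuple nat := (Z n w).2.
Definition incr n w : d.-tuple nat := vsub (S_ n w) (S_ n.-1 w).

Definition Ncount (k : d.-tuple nat) w : nat := nat_sup [set n | vle (S_ n w) k].

Definition in_atom n w : Prop := C (J_ n w) /\ chi n w.

Fixpoint T_ (j : nat) (w : Om) : nat :=
  if j is i.+1 then nat_inf [set n | (T_ i w < n)%N /\ in_atom n w] else 0%N.

Definition L_ j w : nat := (T_ j w - T_ j.-1 w)%N.
Definition Y_ j w : d.-tuple nat := vsub (S_ (T_ j w) w) (S_ (T_ j.-1 w) w).
Definition Csum n w : d.-tuple nat :=
  [tuple (\sum_(1 <= j < n.+1) tnth (Y_ j w) i)%N | i < d].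
Definition Ncycle (k : d.-tuple nat) w : nat :=
  nat_sup [set n | vle (Csum n w) k].

(* The first argument of a reward ranges over the collapsed space
   (X x {0}) u {a}: Some x stands for (x, 0) and None for the atom a. *)
Definition collapse (x : X) (b : bool) : option X := if b then None else Some x.

Variable (g : option X -> X -> d.-tuple nat -> R).

Definition measurable_reward : Prop :=
  measurable_fun setT
    (fun z : X * X * d.-tuple nat => g (Some z.1.1) z.1.2 z.2) /\
  measurable_fun setT (fun z : X * d.-tuple nat => g None z.1 z.2).

Definition reward n w : R :=
  g (collapse (J_ n w) (chi n w)) (J_ n.+1 w) (incr n.+1 w).

Definition Rcycle j w : R := \sum_(T_ j.-1 w <= n < T_ j w) reward n w.
Definition Rcycle_abs j w : R := \sum_(T_ j.-1 w <= n < T_ j w) `|reward n w|.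
Definition Rtotal (k : d.-tuple nat) w : R := \sum_(0 <= n < Ncount k w) reward n w.

Variable (P : probability Om R).

Definition mean_Y : 'rV[R]_d :=
  \row_r fine ('E_P[fun w => (tnth (Y_ 1 w) r)%:R])%E.
Definition mean_L : R := fine ('E_P[fun w => (L_ 1 w)%:R])%E.
Definition mean_R : R := fine ('E_P[Rcycle 1])%E.

Definition cycle_vector w : 'rV[R]_(d + 2) :=
  row_mx (\row_r (tnth (Y_ 1 w) r)%:R)
         (\row_(i < 2) if i == ord0 then (L_ 1 w)%:R else Rcycle 1 w).

End Cycles.

Section Brownian.
Context {R : realType} {dO} {Om : measurableType dO} (P : probability Om R).

Definition cov_mx n (V : Om -> 'rV[R]_n) : 'M[R]_n :=
  \matrix_(i, j) fine (covariance P (fun w => V w ord0 i) (fun w => V w ord0 j)).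

(* normal_prob is not the Dirac mass when the standard deviation is 0. *)
Definition centered_normal (V : Om -> R) (var : R) : Prop :=
  if var == 0 then P [set w | V w = 0] = 1%E
  else forall B, measurable B ->
    P (V @^-1` B) = normal_prob 0 (Num.sqrt var) B.

Definition centered_gaussian n (V : Om -> 'rV[R]_n) (Sigma : 'M[R]_n) : Prop :=
  forall u : 'rV[R]_n, centered_normal (fun w => (u *m (V w)^T) ord0 ord0)
                                       ((u *m Sigma *m u^T) ord0 ord0).

Definition independent_increments n (W : R -> Om -> 'rV[R]_n) : Prop :=
  forall (p : nat) (t : nat -> R) (B : nat -> set 'rV[R]_n),
    0 <= t 0%N -> (forall i, t i <= t i.+1) ->
    (forall i, <<s @open 'rV[R]_n >> (B i)) ->
    fine (P [set w | forall i, (i < p)%N -> B i (W (t i.+1) w - W (t i) w)]) =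
    \prod_(i < p) fine (P [set w | B i (W (t i.+1) w - W (t i) w)]).

(* Centered Brownian motion (W_t)_{t >= 0} with covariance Sigma at time 1;
   Sigma may be degenerate. *)
Definition brownian_motion n (W : R -> Om -> 'rV[R]_n) (Sigma : 'M[R]_n) : Prop :=
  [/\ forall t i, 0 <= t -> measurable_fun setT (fun w => W t w ord0 i),
      {ae P, forall w, W 0 w = 0},
      forall s t, 0 <= s -> s <= t ->
        centered_gaussian (fun w => W t w - W s w) ((t - s) *: Sigma),
      independent_increments W
    & {ae P, forall w, {within [set t | 0 <= t], continuous (W ^~ w)}}].

End Brownian.

Section WeakConvergence.
Context {R : realType} {V : choiceType} (H : set V).

Definition linfty : set {uniform` H -> R} :=
  [set z | exists M : R, forall h, H h -> `|z h| <= M].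

Definition outer_expectation {dO} {Om : measurableType dO}
    (P : probability Om R) (f : Om -> R) : \bar R :=
  ereal_inf [set ('E_P[U])%E | U in
    [set U : Om -> R | P.-integrable setT (EFin \o U) /\ forall w, f w <= U w]].

(* Convergence in the sense of Hoffmann-Jorgensen: since l^oo(H) is not
   separable, the prelimit is not assumed to be Borel. An element of l^oo(H) is
   represented by a function on V whose values outside of H are irrelevant (the
   topology of {uniform` H -> R} does not see them). *)
Definition weak_cvg_linfty
    {dO} {Om : measurableType dO} (P : probability Om R) (Zt : R -> Om -> V -> R)
    {dO'} {Om' : measurableType dO'} (P' : probability Om' R) (Z : Om' -> V -> R)
    : Prop :=
  [/\ \forall t \near +oo, forall w, linfty (Zt t w),
      forall w, linfty (Z w),
      forall G : set {uniform` H -> R}, open G -> measurable [set w | G (Z w)]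
    & forall F : {uniform` H -> R} -> R,
        {within linfty, continuous F} ->
        (exists M : R, forall z, linfty z -> `|F z| <= M) ->
        outer_expectation P (fun w => F (Zt t w)) @[t --> +oo]
          --> ('E_P'[fun w => F (Z w)])%E].

End WeakConvergence.

Section Directions.
Context {R : realType} {d : nat}.

Definition simplex (lam : 'rV[R]_d) : Prop :=
  (forall r, 0 < lam ord0 r < 1) /\ \sum_r lam ord0 r = 1.

(* Only used for nonempty A, where the infimum is a minimum. *)
Definition min_over (A : {set 'I_d}) (f : 'I_d -> R) : R :=
  inf [set f r | r in [set` A]].

Definition kappa (m lam : 'rV[R]_d) : R :=
  min_over [set: 'I_d] (fun r => lam ord0 r / m ord0 r).

Definition argmin_set (m lam : 'rV[R]_d) : {set 'I_d} :=
  [set r | lam ord0 r / m ord0 r == kappa m lam]%SET.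

(* w_Y is the value of W_Y at time kappa_0. *)
Definition zeta (m lam : 'rV[R]_d) (w_Y : 'I_d -> R) (h : 'rV[R]_d) : R :=
  min_over (argmin_set m lam) (fun r => (h ord0 r - w_Y r) / m ord0 r).

(* The supremum is taken in the extended reals: the real-valued sup would be 0
   for an unbounded set. *)
Definition uniform_approx (H : set 'rV[R]_d) (lam : 'rV[R]_d)
    (k : R -> 'rV[R]_d -> d.-tuple nat) : Prop :=
  forall e : R, 0 < e -> \forall t \near +oo,
    (ereal_sup [set (\sum_r `|(tnth (k t h) r)%:R - t * lam ord0 r
                               - Num.sqrt t * h ord0 r|)%:E | h in H]
      <= (e * Num.sqrt t)%:E)%E.

(* Borel on the (Borel) subset H of R^d; N^d is discrete. *)
Definition borel_on (H : set 'rV[R]_d) (f : 'rV[R]_d -> d.-tuple nat) : Prop :=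
  forall v, <<s @open 'rV[R]_d >> (H `&` f @^-1` [set v]).

End Directions.

(* Main.v *)
Require Import Defs.
From HB Require Import structures.
From mathcomp Require Import all_boot all_order all_algebra.
From mathcomp Require Import all_classical all_reals all_analysis.
From mathcomp Require Import measurable_realfun ring lra.

Set Implicit Arguments.
Unset Strict Implicit.
Unset Printing Implicit Defensive.
Import Order.TTheory GRing.Theory Num.Theory.
Import numFieldTopology.Exports numFieldNormedType.Exports.

Local Open Scope classical_set_scope.
Local Open Scope ring_scope.

(** At the atom the split chain regenerates, so that the cycle variables
    [(Y_j, L_j, R_j)] are the values of one square-integrable functional of the
    path along the iterates of a measure preserving map (the shift to the first
    return), and the value on the first cycle is independent of the shifted path.
    Let [n = floor (t kappa0)] and let [V_t] be [t^(-1/2)] times the centered sum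
    of the first [n] cycle vectors.  By characteristic functions [V_t] tends in
    law to [W kappa0], and by Chebyshev's inequality on a grid all cycle sums are
    linear up to [o (sqrt t)] on windows of length [O (sqrt t)] around [n].
    Inverting the cycle sums, the largest number of cycles that fits under
    [k_t h] is [t kappa0 + sqrt t zeta (V_t, h) + o (sqrt t)] uniformly in [h]:
    coordinates outside of [I] leave room of order [t] and do not matter.  [N] and
    the total reward differ from their values at the last complete cycle by at
    most the contribution of one cycle.  Hence all four processes are uniformly
    close to [Phi V_t] for a fixed continuous [Phi] with values in [l^oo(H)], and
    the continuous mapping theorem applies. *)

(** * Approximation by trigonometric polynomials *)

(** Since the windows have length of order [sqrt t] around [t kappa0], only the value of the
    limiting Brownian motion at the one time [kappa0] enters, and a central limit theorem in finite
    dimension together with local linearity replaces a functional one. The obstacle on the side of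
    [l^oo(H)] is that the prelimit processes carry no measurability, so weak convergence is phrased
    with outer expectations; it is reached by squeezing [F (Z t)] between measurable functions of
    [V_t]. Three facts about the split chain are not among the hypotheses and have to be derived.
    Return to the atom is almost sure because the laws of the chain killed at the atom add up to at
    most a multiple of [pi]. The means [m_r] are positive because a coordinate that never grew would
    make the states from which it cannot grow contain an absorbing set of full measure. Regeneration
    itself is proved for the paths from time 1 on, whose law does not depend on the random starting
    point in [C]. Signed rewards are split as [(g + |g|) - |g|], because linearity on windows rests
    on monotone sums. *)

Section TrigBounds.
Context {R : realType}.
Implicit Types x y : R.

Lemma sin_lip0 x : `|sin x| <= `|x|.
Proof.
wlog x0 : x / 0 <= x.
  move=> H; case: (leP 0 x) => [|/ltW] x0; first exact: H.
  by rewrite -(normrN x) -(normrN (sin x)) -sinN; apply: H; rewrite oppr_ge0.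
have [c _] := @MVT_segment R sin cos 0 x x0
  (fun y _ => is_derive_sin y) (continuous_subspaceT (@continuous_sin R)).
by rewrite sin0 !subr0 => ->; rewrite normrM ler_piMl// cos_max.
Qed.

Lemma one_sub_cos_ge0 x : 0 <= 1 - cos x.
Proof. by rewrite subr_ge0 cos_le1. Qed.

Lemma one_sub_cosE x : 1 - cos x = sin (x / 2) ^+ 2 *+ 2.
Proof.
rewrite {1}(_ : x = (x / 2) *+ 2); last by rewrite -mulr_natr mulfVK.
by rewrite cos_mulr2n sin2cos2 !mulr2n; ring.
Qed.

Lemma one_sub_cos_le x : 1 - cos x <= x ^+ 2 / 2.
Proof.
rewrite one_sub_cosE.
have : sin (x / 2) ^+ 2 <= (x / 2) ^+ 2.
  by rewrite -(real_normK (num_real (sin _))) -(real_normK (num_real (x / 2)))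
    lerXn2r ?nnegrE// sin_lip0.
have -> : (x / 2) ^+ 2 = x ^+ 2 / 4 by field.
by rewrite (mulr2n (sin _ ^+ 2)); lra.
Qed.

Lemma sin_sub_id_le x : `|sin x - x| <= x ^+ 2.
Proof.
wlog x0 : x / 0 <= x.
  move=> H; case: (leP 0 x) => [|/ltW] x0; first exact: H.
  by rewrite -(sqrrN x) -normrN opprD -sinN; apply: H; rewrite oppr_ge0.
have df y : is_derive y 1 (fun y => sin y - y) (cos y - 1).
  exact: is_deriveB.
have cf : {within `[0, x], continuous (fun y => sin y - y)}.
  apply: continuous_subspaceT => y; apply: cvgB; last exact: cvg_id.
  exact: continuous_sin.
have [c cx] := @MVT_segment R _ (fun y => cos y - 1) 0 x x0 (fun y _ => df y) cf.
rewrite sin0 !subr0 => ->; rewrite normrM (ger0_norm x0) expr2.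
apply: ler_wpM2r => //.
move: cx; rewrite in_itv/= => /andP[c0 cx].
rewrite -normrN opprB ger0_norm ?one_sub_cos_ge0//.
(* In [1 - cos c = 2 sin^2 (c/2)] one factor is bounded by 1 and the other by [c/2], which gives the
   bound [c <= x]. *)
have s1 : `|sin (c/2)| <= 1 by rewrite sin_max.
have s2 : `|sin (c/2)| <= c/2.
  by rewrite (le_trans (sin_lip0 _))// ger0_norm// divr_ge0.
rewrite one_sub_cosE -(real_normK (num_real (sin _))) (mulr2n (`|_| ^+ 2)).
have : `|sin (c/2)| ^+ 2 <= 1 * (c/2).
  by rewrite expr2; apply: ler_pM.
lra.
Qed.

End TrigBounds.

Definition dotmx {R : realType} {n} (u x : 'rV[R]_n) : R := (u *m x^T) ord0 ord0.

Lemma dotmxE {R : realType} {n} (u x : 'rV[R]_n) :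
  dotmx u x = \sum_i u ord0 i * x ord0 i.
Proof. by rewrite /dotmx mxE; apply: eq_bigr => i _; rewrite mxE. Qed.

Section TrigPoly.
Context {R : realType} {n : nat}.
Implicit Types (p : 'rV[R]_n -> R) (u x : 'rV[R]_n).

(** An entry [(c, u, b)] stands for [c cos (u . x + b)]. The phase [b] covers sines as well, so that
    everything stays real. *)
Definition trig_eval (s : seq (R * 'rV[R]_n * R)) x : R :=
  \sum_(e <- s) e.1.1 * cos (dotmx e.1.2 x + e.2).

Definition trigpoly p := exists s, p = trig_eval s.

Lemma trigpoly_cst (c : R) : trigpoly (fun=> c).
Proof.
exists [:: (c, 0, 0)]; apply/funext => x.
by rewrite /trig_eval big_seq1/= /dotmx mul0mx mxE addr0 cos0 mulr1.
Qed.

Lemma trigpolyD p1 p2 : trigpoly p1 -> trigpoly p2 ->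
  trigpoly (fun x => p1 x + p2 x).
Proof.
move=> [s1 ->] [s2 ->]; exists (s1 ++ s2); apply/funext => x.
by rewrite /trig_eval big_cat.
Qed.

Lemma trigpolyZ (c : R) p : trigpoly p -> trigpoly (fun x => c * p x).
Proof.
move=> [s ->]; exists [seq (c * e.1.1, e.1.2, e.2) | e <- s].
apply/funext => x; rewrite /trig_eval big_map mulr_sumr.
by apply: eq_bigr => e _/=; rewrite mulrA.
Qed.

(** The product formula for cosines replaces an entry of frequency [v] by two entries of frequencies
    [v + u] and [v - u], with half of the amplitude. *)
Lemma trigpoly_cosM u (b : R) p : trigpoly p ->
  trigpoly (fun x => cos (dotmx u x + b) * p x).
Proof.
move=> [s ->]; elim: s => [|e s [s' IH]].
  rewrite (_ : (fun x => _) = fun=> 0); first exact: trigpoly_cst.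
  by apply/funext => x; rewrite /trig_eval big_nil mulr0.
exists ((e.1.1 / 2, e.1.2 + u, e.2 + b) :: (e.1.1 / 2, e.1.2 - u, e.2 - b) :: s').
apply/funext => x; move/(congr1 (fun f => f x)): IH.
rewrite /trig_eval !big_cons/= => <-; rewrite mulrDr addrA; congr (_ + _).
have -> : dotmx (e.1.2 + u) x + (e.2 + b) = (dotmx e.1.2 x + e.2) + (dotmx u x + b).
  by rewrite /dotmx mulmxDl mxE; ring.
have -> : dotmx (e.1.2 - u) x + (e.2 - b) = (dotmx e.1.2 x + e.2) - (dotmx u x + b).
  by rewrite /dotmx mulmxBl [in LHS]mxE [in X in _ + X + _ = _]mxE; ring.
by move: (dotmx e.1.2 x + e.2) (dotmx u x + b) => y z; rewrite cosD cosB; field.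
Qed.

End TrigPoly.

Section WalkAverage.
Context {R : realType} {n : nat}.
Implicit Types (f g : 'rV[R]_n -> R) (a x : 'rV[R]_n) (l : seq 'I_n).

(* A Bernstein operator: the mean of [f] at the end of a random walk.  For
   [sg i = sin (x_i / L)] it is a trigonometric polynomial in [x], close to [f x]
   because a walk from 0 with many small steps ends near [x]. *)
Fixpoint walk_avg (dl : R) (sg : 'I_n -> R) l f a : R :=
  if l is i :: l' then
    (1 + sg i) / 2 * walk_avg dl sg l' f (a + dl *: delta_mx ord0 i) +
    (1 - sg i) / 2 * walk_avg dl sg l' f (a - dl *: delta_mx ord0 i)
  else f a.

Section fixed_drift.
Variables (dl : R) (sg : 'I_n -> R).
Hypothesis sg1 : forall i, `|sg i| <= 1.

Lemma le_walk_avg l f g a : (forall y, f y <= g y) ->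
  walk_avg dl sg l f a <= walk_avg dl sg l g a.
Proof.
move=> fg; elim: l a => //= i l IH a.
have := sg1 i; rewrite ler_norml => /andP[s1 s2].
by apply: lerD; apply: ler_wpM2l => //; rewrite divr_ge0//; lra.
Qed.

Lemma walk_avg_affine l f (b c : R) a :
  walk_avg dl sg l (fun y => b + c * f y) a = b + c * walk_avg dl sg l f a.
Proof.
elim: l a => //= i l IH a; rewrite !IH.
by move: (walk_avg _ _ _ _ _) (walk_avg _ _ _ _ _) (sg i) => A B s; field.
Qed.

Definition sqdist a (c : 'I_n -> R) : R := \sum_i (a ord0 i - c i) ^+ 2.

(** A step in direction [j] moves the coordinate by [dl] or [- dl], with mean [dl * sg j] and
    variance at most [dl ^+ 2]. The drift is absorbed into the target [c], and the variances of the
    steps add up. *)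
Lemma walk_avg_sqdist l a (c : 'I_n -> R) :
  walk_avg dl sg l (sqdist ^~ c) a <=
  sqdist a (fun i => c i - (count_mem i l)%:R * (dl * sg i)) + (size l)%:R * dl ^+ 2.
Proof.
elim: l a => [|j l IH] a /=.
  rewrite mul0r addr0 le_eqVlt; apply/orP; left; apply/eqP.
  by apply: eq_bigr => i _; rewrite mul0r subr0.
have := sg1 j; rewrite ler_norml => /andP[s1 s2].
have [] := (IH (a + dl *: delta_mx ord0 j), IH (a - dl *: delta_mx ord0 j)).
set P := sqdist _ _; set Q := sqdist (_ - _) _; set N := (size l)%:R * _ => I1 I2.
have -> : (size l).+1%:R * dl ^+ 2 = N + dl ^+ 2 by rewrite -natr1 mulrDl mul1r.
apply: (@le_trans _ _ ((1 + sg j) / 2 * (P + N) + (1 - sg j) / 2 * (Q + N))).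
  by apply: lerD; apply: ler_wpM2l => //; rewrite divr_ge0//; lra.
have {I1 I2}-> : (1 + sg j) / 2 * (P + N) + (1 - sg j) / 2 * (Q + N) =
  ((1 + sg j) / 2 * P + (1 - sg j) / 2 * Q) + N by field.
suff : (1 + sg j) / 2 * P + (1 - sg j) / 2 * Q <=
   sqdist a (fun i => c i - ((j == i) + count_mem i l)%:R * (dl * sg i)) + dl ^+ 2.
  lra.
rewrite /P /Q /sqdist (bigD1 j)//= [X in _ + _ / 2 * X <= _](bigD1 j)//= [leRHS](addrC).
rewrite [X in _ <= _ + X](bigD1 j)//= !mxE !eqxx/= !mulr1.
set e := count_mem j l.
have E (s : R) : \sum_(i < n | i != j)
   ((a + s *: delta_mx ord0 j) ord0 i - (c i - (count_mem i l)%:R * (dl * sg i))) ^+ 2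
   = \sum_(i < n | i != j)
     (a ord0 i - (c i - ((j == i) + count_mem i l)%:R * (dl * sg i))) ^+ 2.
  apply: eq_bigr => i ij.
  by rewrite !mxE (eq_sym j) (negbTE ij) andbF mulr0 addr0 add0n.
have := E (- dl); rewrite scaleNr => ->; rewrite E; set Sm := \sum_(i < n | _) _.
rewrite natrD/= -/e.
have : 0 <= dl ^+ 2 * (sg j ^+ 2) by rewrite mulr_ge0// sqr_ge0.
move: (a ord0 j) (c j) (sg j) (dl) (e%:R) => A B C D F G. nra.
Qed.

End fixed_drift.

(** The weights [(1 +- sin (x_i / L)) / 2] are a constant plus a cosine of shifted phase, so each
    step of the walk stays within trigonometric polynomials. *)
Lemma walk_avg_trigpoly dl (L : R) l f a :
  trigpoly (fun x => walk_avg dl (fun i => sin (x ord0 i / L)) l f a).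
Proof.
elim: l a => [|i l IH] a /=; first exact: trigpoly_cst.
have E (x : 'rV[R]_n) : sin (x ord0 i / L) =
    cos (dotmx (L^-1 *: delta_mx ord0 i) x + (- (pi / 2))).
  rewrite cosBpihalf dotmxE (bigD1 i)//= big1 ?addr0.
    by rewrite !mxE !eqxx mulr1 mulrC.
  by move=> j ji; rewrite !mxE (negbTE ji) andbF mulr0 mul0r.
have T (c : R) b : trigpoly (fun x : 'rV[R]_n => (1 + c * sin (x ord0 i / L)) / 2 *
    walk_avg dl (fun i => sin (x ord0 i / L)) l f b).
  rewrite (_ : (fun x => _) = (fun x => 2^-1 * walk_avg dl (fun i => sin (x ord0 i / L)) l f b
     + (c / 2) * (cos (dotmx (L^-1 *: delta_mx ord0 i) x + (- (pi / 2))) *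
       walk_avg dl (fun i => sin (x ord0 i / L)) l f b))); last first.
    by apply/funext => x; rewrite -E; field.
  apply: trigpolyD; first exact/trigpolyZ/IH.
  exact/trigpolyZ/trigpoly_cosM/IH.
have := trigpolyD (T 1 (a + dl *: delta_mx ord0 i)) (T (-1) (a - dl *: delta_mx ord0 i)).
by congr trigpoly; apply/funext => x; rewrite mul1r mulN1r.
Qed.

End WalkAverage.

(** The property is local at each diagonal point; the covering form of compactness, with the radius
    as a parameter tending to 0 from the right, makes the radius uniform on [K]. *)
Lemma near_unif_compact {R : realType} (T : pseudoMetricType R) (K : set T)
    (P : T -> T -> Prop) : compact K ->
  (forall x, K x -> \forall z \near (x, x), P z.1 z.2) ->
  exists2 e : R, 0 < e & forall x y, K x -> ball x e y -> P x y.
Proof.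
move=> cK Px.
have /compact_near_coveringP/(_ R (0^'+) (fun e x => forall y, ball x e y -> P x y)) := cK.
case.
  move=> x /Px [[A B]/= [/nbhs_ballP[a a0 Aa] /nbhs_ballP[b b0 Bb]] AB].
  near=> z e => y zy.
  apply: (AB (z, y)); split => /=.
    by apply: Aa; near: z; exact: nbhsx_ballx.
  apply: Bb; apply: (@le_ball _ _ _ (b / 2 + b / 2)); first by rewrite -splitr.
  apply: (@ball_triangle _ _ z).
    by near: z; apply: nbhsx_ballx; exact: divr_gt0.
  apply: (le_ball _ zy) => /=; near: e; apply: nbhs_right_le; exact: divr_gt0.
move=> e/= e0 He; exists (e / 2); first exact: divr_gt0.
move=> x y Kx; apply: (He (e / 2)) => //=; last exact: divr_gt0.
by rewrite sub0r normrN gtr0_norm ?divr_gt0// ltr_pdivrMr// ltr_pMr// ltr1n.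
Unshelve. all: by end_near. Qed.

(** An average with nonnegative weights inherits the bound [M] on the whole space, and this is what
    makes the approximation usable when only a box carries most of the mass. On the box, [f y]
    differs from [f x] by at most [eps / 2] plus a multiple of the squared distance, whose mean over
    the walk has a bias part and a variance part. *)
Lemma trigpoly_approx {R : realType} {n} (f : 'rV[R]_n -> R) (M K eps : R) :
  continuous f -> (forall x, `|f x| <= M) -> 0 < K -> 0 < eps ->
  exists p : 'rV[R]_n -> R, [/\ trigpoly p, (forall x, `|p x| <= M)
    & forall x : 'rV[R]_n, (forall i, `|x ord0 i| <= K) -> `|p x - f x| <= eps].
Proof.
move=> cf fM K0 e0.
have M0 : 0 <= M by apply: le_trans (fM 0).
pose B : set 'rV[R]_n := [set x | forall i, `[- K, K]%classic (x ord0 i)].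
have cB : compact B by apply: (@rV_compact R n (fun=> `[- K, K]%classic)) => i; exact: segment_compact.
have [eta eta0 Heta] : exists2 e : R, 0 < e &
    forall x y, B x -> ball x e y -> `|f y - f x| <= eps / 2.
  apply: (near_unif_compact (P := fun x y => `|f y - f x| <= eps / 2) cB) => x _.
  have /cvgrPdist_le/(_ (eps / 4)) Hf := cf x.
  have {}Hf : \forall y \near x, `|f x - f y| <= eps / 4 by apply: Hf; rewrite divr_gt0.
  pose S : set 'rV[R]_n := [set y | `|f x - f y| <= eps / 4].
  exists (S, S) => //.
  move=> [y z]; rewrite /S/= => -[Hy Hz].
  have -> : f z - f y = (f x - f y) - (f x - f z) by ring.
  by rewrite (le_trans (ler_normB _ _))//; lra.
(* Beyond distance [eta] the difference of two values of [f] is at most [2 * M <= C * sqdist]. *)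
pose C := 2 * M / eta ^+ 2.
have C0 : 0 <= C by rewrite divr_ge0 ?sqr_ge0// mulr_ge0.
have key x y : B x -> `|f y - f x| <= eps / 2 + C * sqdist y (x ord0).
  move=> Bx.
  have sq0 : 0 <= sqdist y (x ord0) by apply: sumr_ge0 => i _; exact: sqr_ge0.
  have [le|] := pselect (forall i, `|x ord0 i - y ord0 i| < eta).
    rewrite (le_trans (Heta _ _ Bx _))//; last by rewrite lerDl mulr_ge0.
    by rewrite /ball/=; split=> // i j; rewrite (ord1 i); exact: le.
  move=> /existsNP[i /negP]; rewrite -leNgt => xy.
  rewrite (le_trans (ler_normB _ _))//.
  have : 2 * M <= C * sqdist y (x ord0).
    rewrite /C -mulrA ler_peMr ?mulr_ge0// ler_pdivlMl ?exprn_gt0// mulr1.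
    rewrite /sqdist (bigD1 i)//=; apply: ler_wpDr.
      by apply: sumr_ge0 => k _; exact: sqr_ge0.
    rewrite -[leRHS](real_normK (num_real _)) distrC lerXn2r ?nnegrE//.
    exact: ltW.
  by have := fM x; have := fM y; lra.
clearbody C.
(* The walk ends on average at [L sin (x_i / L)], which misses [x_i] by at most [K ^+ 2 / L]; a
   large [L] makes the squared bias small. *)
have [L L0 HL] : exists2 L : R, 0 < L & C * (n%:R * (K ^+ 4 / L ^+ 2)) <= eps / 4.
  have : 0 <= C * n%:R * K ^+ 4 by rewrite mulr_ge0 ?mulr_ge0 ?exprn_ge0 ?(ltW K0).
  set A := C * n%:R * K ^+ 4 => A0.
  have A1 : 0 < 1 + A * 4 / eps by rewrite ltr_pwDl// divr_ge0 ?(ltW e0)// mulr_ge0.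
  exists (Num.sqrt (1 + A * 4 / eps)); first by rewrite sqrtr_gt0.
  rewrite sqr_sqrtr ?(ltW A1)// 2!mulrA -/A; clearbody A.
  rewrite ler_pdivrMr// mulrDr mulr1.
  have -> : eps / 4 * (A * 4 / eps) = A by field; rewrite gt_eqF.
  by rewrite lerDr divr_ge0// ltW.
(* With [N] steps of size [L / N] in each coordinate the variances add up to at most [n L^2 / N]. *)
have [N N0 HN] : exists2 N, (0 < N)%N & C * (n%:R * L ^+ 2 / N%:R) <= eps / 4.
  exists (Num.truncn (C * (n%:R * L ^+ 2) * 4 / eps)).+1 => //.
  have : 0 <= C * (n%:R * L ^+ 2) by rewrite mulr_ge0 ?mulr_ge0 ?exprn_ge0 ?(ltW L0).
  set A := C * (n%:R * L ^+ 2) => A0.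
  rewrite mulrA -/A; clearbody A; rewrite ler_pdivrMr ?ltr0n//.
  have := truncnS_gt (A * 4 / eps).
  move: ((Num.truncn _).+1%:R) => m Am.
  have /ltW : A * 4 / eps * eps < m * eps by rewrite ltr_pM2r.
  by rewrite mulfVK ?gt_eqF//; lra.
pose dl := L / N%:R.
pose l : seq 'I_n := flatten (nseq N (enum 'I_n)).
have cl i : count_mem i l = N.
  rewrite /l; elim: N {N0 HN dl l} => //= N IH; rewrite count_cat IH.
  by rewrite (count_uniq_mem _ (enum_uniq _)) mem_enum.
have sl : size l = (N * n)%N.
  by rewrite size_flatten /shape map_nseq sumn_nseq size_enum_ord mulnC.
pose sg (x : 'rV[R]_n) i := sin (x ord0 i / L).
have sg1 x i : `|sg x i| <= 1 by exact: sin_max.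
exists (fun x => walk_avg dl (sg x) l f 0); split.
- exact: walk_avg_trigpoly.
- move=> x; rewrite ler_norml; apply/andP; split.
    (* A constant is its own average, as the affine case of slope 0. *)
    rewrite -[leLHS](_ : walk_avg dl (sg x) l (fun y => - M + 0 * f y) 0 = _).
      apply: le_walk_avg => // y; rewrite mul0r addr0.
      by have := fM y; rewrite ler_norml => /andP[].
    by rewrite walk_avg_affine mul0r addr0.
  rewrite -[leRHS](_ : walk_avg dl (sg x) l (fun y => M + 0 * f y) 0 = _).
    apply: le_walk_avg => // y; rewrite mul0r addr0.
    by have := fM y; rewrite ler_norml => /andP[].
  by rewrite walk_avg_affine mul0r addr0.
- move=> x xK.
  have Bx : B x by move=> i /=; rewrite in_itv/= -ler_norml.
  pose q y := sqdist y (x ord0).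
  have qle : C * walk_avg dl (sg x) l q 0 <= eps / 2.
    have := walk_avg_sqdist dl (sg1 x) l 0 (x ord0).
    rewrite sl => H.
    apply: (@le_trans _ _ (C * (n%:R * (K ^+ 4 / L ^+ 2) + n%:R * L ^+ 2 / N%:R))).
      apply: ler_wpM2l => //; apply: le_trans H _; apply: lerD; last first.
        rewrite le_eqVlt; apply/orP; left; apply/eqP.
        rewrite /dl natrM expr_div_n; field.
        by rewrite pnatr_eq0 -lt0n.
      rewrite /sqdist.
      apply: (@le_trans _ _ (\sum_(i < n) K ^+ 4 / L ^+ 2)); last first.
        by rewrite sumr_const card_ord mulr_natl.
      apply: ler_sum => i _; rewrite mxE cl add0r.
      have -> : x ord0 i - N%:R * (dl * sg x i) =
          - (L * (sin (x ord0 i / L) - x ord0 i / L)).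
        by rewrite /dl /sg; field; rewrite gt_eqF//= pnatr_eq0 -lt0n.
      rewrite opprK.
      have := sin_sub_id_le (x ord0 i / L); set w := sin _ - _ => wle.
      rewrite -(real_normK (num_real (L * w))) normrM (gtr0_norm L0).
      have -> : K ^+ 4 / L ^+ 2 = (L * (K / L) ^+ 2) ^+ 2.
        by field; rewrite gt_eqF.
      have KL : 0 <= K / L by rewrite divr_ge0 ?ltW.
      have Lw : 0 <= L * `|w| by rewrite mulr_ge0 ?(ltW L0).
      rewrite lerXn2r ?nnegrE ?(mulr_ge0 (ltW L0) (sqr_ge0 _))//.
      rewrite ler_pM2l// (le_trans wle)//.
      rewrite -(real_normK (num_real (x ord0 i / L))) lerXn2r ?nnegrE//.
      by rewrite normrM normfV (gtr0_norm L0) ler_pM2r ?invr_gt0.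
    by rewrite mulrDr; lra.
  rewrite ler_norml; apply/andP; split.
    rewrite lerBrDr.
    have H y : (f x - eps / 2) + (- C) * q y <= f y.
      by have := key x y Bx; rewrite ler_norml -/(q y) => /andP[]; lra.
    by apply: le_trans (le_walk_avg dl (sg1 x) l 0 H); rewrite walk_avg_affine; lra.
  have H y : f y <= (f x + eps / 2) + C * q y.
    by have := key x y Bx; rewrite ler_norml -/(q y) => /andP[]; lra.
  rewrite lerBlDr.
  by apply: le_trans (le_walk_avg dl (sg1 x) l 0 H) _; rewrite walk_avg_affine; lra.
Qed.

(** * Sums along a measure preserving map *)

Section RealIntegrable.
Context {d} {T : measurableType d} {R : realType} (P : probability T R).
Implicit Types f g : T -> R.

Definition rint f := P.-integrable setT (EFin \o f).

Lemma rint_measurable f : rint f -> measurable_fun setT f.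
Proof. by move=> /measurable_int/measurable_EFinP. Qed.

Lemma rint_le f g : measurable_fun setT f -> (forall x, `|f x| <= g x) ->
  rint g -> rint f.
Proof.
move=> mf fg; apply: le_integrable => //; first exact/measurable_EFinP.
by move=> x _ /=; rewrite lee_fin (le_trans (fg x))// ler_norm.
Qed.

Lemma rint_cst (c : R) : rint (fun=> c).
Proof.
exact: (finite_measure_integrable_cst P c measurableT).
Qed.

Lemma rint_bounded f (M : R) : measurable_fun setT f -> (forall x, `|f x| <= M) ->
  rint f.
Proof. by move=> mf fM; apply: (rint_le mf fM); exact: rint_cst. Qed.

Lemma rintD f g : rint f -> rint g -> rint (fun x => f x + g x).
Proof. by move=> f1 g1; apply: eq_integrable (integrableD measurableT f1 g1). Qed.

Lemma rintB f g : rint f -> rint g -> rint (fun x => f x - g x).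
Proof. by move=> f1 g1; apply: eq_integrable (integrableB measurableT f1 g1). Qed.

Lemma rintZ (c : R) f : rint f -> rint (fun x => c * f x).
Proof. by move=> f1; apply: eq_integrable (integrableZl measurableT c f1). Qed.

Lemma rint_sum I (s : seq I) (f : I -> T -> R) : (forall i, rint (f i)) ->
  rint (fun x => \sum_(i <- s) f i x).
Proof.
move=> fi; elim: s => [|i s IH].
  under eq_fun do rewrite big_nil; exact: rint_cst.
by under eq_fun do rewrite big_cons; exact: rintD.
Qed.

Lemma rint_norm f : rint f -> rint (fun x => `|f x|).
Proof. exact: integrable_norm. Qed.

Lemma ExpD f g : rint f -> rint g ->
  \int[P]_x (f x + g x) = \int[P]_x f x + \int[P]_x g x.
Proof. by move=> f1 g1; rewrite RintegralD. Qed.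

Lemma ExpB f g : rint f -> rint g ->
  \int[P]_x (f x - g x) = \int[P]_x f x - \int[P]_x g x.
Proof. by move=> f1 g1; rewrite RintegralB. Qed.

Lemma ExpZ (c : R) f : rint f -> \int[P]_x (c * f x) = c * \int[P]_x f x.
Proof. by move=> f1; rewrite RintegralZl. Qed.

Lemma Exp_cst (c : R) : \int[P]_x c = c.
Proof. by rewrite Rintegral_cst//= probability_setT/= mulr1. Qed.

Lemma Exp_sum I (s : seq I) (f : I -> T -> R) : (forall i, rint (f i)) ->
  \int[P]_x (\sum_(i <- s) f i x) = \sum_(i <- s) \int[P]_x f i x.
Proof.
move=> fi; elim: s => [|i s IH].
  by under eq_Rintegral do rewrite big_nil; rewrite big_nil Exp_cst.
under eq_Rintegral do rewrite big_cons.
by rewrite big_cons ExpD// ?IH//; exact: rint_sum.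
Qed.

Lemma le_Exp f g : rint f -> rint g -> (forall x, f x <= g x) ->
  \int[P]_x f x <= \int[P]_x g x.
Proof. by move=> f1 g1 fg; apply: le_Rintegral. Qed.

Lemma ler_norm_Exp f : rint f -> `|\int[P]_x f x| <= \int[P]_x `|f x|.
Proof. by move=> f1; apply: le_normr_Rintegral. Qed.

Lemma Exp_EFin f : rint f -> (\int[P]_x (f x)%:E)%E = (\int[P]_x f x)%:E.
Proof. by move=> f1; rewrite /Rintegral fineK//; exact: integrable_fin_num. Qed.

Lemma rint_ge0_fin f : measurable_fun setT f -> (forall x, 0 <= f x) ->
  (\int[P]_x (f x)%:E < +oo)%E -> rint f.
Proof.
move=> mf f0 foo; apply/integrableP; split; first exact/measurable_EFinP.
by under eq_integral do rewrite /= ger0_norm//.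
Qed.

Lemma rint_sqr f : measurable_fun setT f -> rint (fun x => f x ^+ 2) -> rint f.
Proof.
move=> mf f2; apply: (rint_le mf _ (rintD (rint_cst 1) f2)) => x.
rewrite -(real_normK (num_real (f x))).
have : 0 <= (`|f x| - 1) ^+ 2 by exact: sqr_ge0.
by move: (normr_ge0 (f x)); nra.
Qed.

Lemma rintM_sqr f g : measurable_fun setT f -> measurable_fun setT g ->
  rint (fun x => f x ^+ 2) -> rint (fun x => g x ^+ 2) -> rint (fun x => f x * g x).
Proof.
move=> mf mg f2 g2; apply: (rint_le _ _ (rintD f2 g2)) => [|x].
  exact: measurable_funM.
rewrite normrM -(real_normK (num_real (f x))) -(real_normK (num_real (g x))).
have : 0 <= (`|f x| - `|g x|) ^+ 2 by exact: sqr_ge0.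
by have := normr_ge0 (f x); have := normr_ge0 (g x); nra.
Qed.

Lemma measurable_preimageT d' (T' : measurableType d') (f : T -> T') (B : set T') :
  measurable_fun setT f -> measurable B -> measurable (f @^-1` B).
Proof. by move=> mf mB; rewrite -[X in measurable X]setTI; exact: mf. Qed.

Lemma markov_sqr f (a : R) : 0 < a -> rint (fun x => f x ^+ 2) ->
  measurable_fun setT f ->
  fine (P [set x | a <= `|f x|]) <= (\int[P]_x (f x ^+ 2)) / a ^+ 2.
Proof.
move=> a0 f2 mf.
have mA : measurable [set x | a <= `|f x|].
  have -> : [set x | a <= `|f x|] = (fun x => `|f x|) @^-1` `[a, +oo[%classic.
    by apply/seteqP; split => x /=; rewrite in_itv/= andbT.
  apply: measurable_preimageT => //; exact: measurableT_comp.
have i1 : rint (\1_[set x | a <= `|f x|]).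
  apply: (@rint_bounded _ 1) => // x; rewrite indicE.
  by case: (_ \in _); rewrite ?normr1 ?normr0.
have -> : fine (P [set x | a <= `|f x|]) = \int[P]_x (\1_[set x | a <= `|f x|] x).
  by rewrite /Rintegral integral_indic// setIT.
rewrite ler_pdivlMr ?exprn_gt0// mulrC -ExpZ//; apply: le_Exp => //; first exact: rintZ.
move=> x; rewrite indicE; case: (boolP (_ \in _)); last by rewrite mulr0 sqr_ge0.
rewrite inE/= mulr1 => af; rewrite -(real_normK (num_real (f x))).
by rewrite lerXn2r ?nnegrE// ltW.
Qed.

End RealIntegrable.

(** * Independence and expectations of products *)

Section Independence.
Context {d} {T : measurableType d} {R : realType} (P : probability T R).

Definition indep_maps d1 d2 (T1 : measurableType d1) (T2 : measurableType d2)
    (X : T -> T1) (Y : T -> T2) : Prop :=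
  forall A B, measurable A -> measurable B ->
    P (X @^-1` A `&` Y @^-1` B) = (P (X @^-1` A) * P (Y @^-1` B))%E.

Lemma indep_maps_comp d1 d2 d3 d4 (T1 : measurableType d1) (T2 : measurableType d2)
    (T3 : measurableType d3) (T4 : measurableType d4)
    (X : T -> T1) (Y : T -> T2) (f : T1 -> T3) (g : T2 -> T4) :
  measurable_fun setT f -> measurable_fun setT g ->
  indep_maps X Y -> indep_maps (f \o X) (g \o Y).
Proof.
move=> mf mg XY A B mA mB.
by apply: (XY (f @^-1` A) (g @^-1` B)); exact: measurable_preimageT.
Qed.

Section product.
Variables X Y : T -> R.
Hypotheses (mX : measurable_fun setT X) (mY : measurable_fun setT Y).
Hypothesis XY : indep_maps X Y.

Let mX_mixin := isMeasurableFun.Build _ _ _ _ X mX.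
Let mY_mixin := isMeasurableFun.Build _ _ _ _ Y mY.
Let X' : {mfun T >-> R} := HB.pack X mX_mixin.
Let Y' : {mfun T >-> R} := HB.pack Y mY_mixin.
Let Z x := (X x, Y x).
Let mZ : measurable_fun setT Z. Proof. exact: measurable_fun_pair. Qed.
Let mZ_mixin := isMeasurableFun.Build _ _ _ _ Z mZ.
Let Z' : {mfun T >-> (R * R)%type} := HB.pack Z mZ_mixin.

(** Independence identifies the joint law with the product of the marginals on rectangles, which
    determine it; the two lemmas on products below are then Fubini's theorem. *)
Let prodE (A : set (R * R)) : measurable A ->
  (distribution P X' \x distribution P Y')%E A = distribution P Z' A.
Proof.
apply: product_measure_unique => B C mB mC.
by rewrite /= /pushforward/= -XY//; congr (P _).
Qed.

Let int_prodE (f : R * R -> \bar R) : measurable_fun setT f -> (forall z, 0 <= f z)%E ->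
  (\int[P]_x f (X x, Y x) = \int[P]_x \int[P]_y f (X x, Y y))%E.
Proof.
move=> mf f0.
transitivity (\int[distribution P Z']_z f z)%E.
  rewrite [RHS]ge0_integral_pushforward//.
transitivity (\int[(distribution P X' \x distribution P Y')%E]_z f z)%E.
  by apply: eq_measure_integral => A mA _; exact/esym/prodE.
rewrite fubini_tonelli1//= [LHS]ge0_integral_pushforward//; last 2 first.
  exact: measurable_fun_fubini_tonelli_F.
  by move=> x _; exact: integral_ge0.
apply: eq_integral => x _ /=.
rewrite [LHS]ge0_integral_pushforward//.
exact: measurableT_comp.
Qed.

Lemma indep_rintM : rint P X -> rint P Y -> rint P (fun x => X x * Y x).
Proof.
move=> iX iY; apply/integrableP; split.
  by apply/measurable_EFinP; exact: measurable_funM.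
pose f (z : R * R) := (`|z.1 * z.2|)%:E.
have mf : measurable_fun setT f.
  by apply/measurable_EFinP; apply: measurableT_comp => //; exact: measurable_funM.
have := int_prodE mf; rewrite /f/= => -> //.
have -> : (\int[P]_x \int[P]_y (`|X x * Y y|)%:E =
   \int[P]_x ((\int[P]_y `|Y y|) * `|X x|)%:E)%E.
  apply: eq_integral => x _.
  rewrite EFinM -Exp_EFin; last exact: rint_norm.
  rewrite muleC -ge0_integralZl//; last first.
    by apply/measurable_EFinP; exact: measurableT_comp.
  by apply: eq_integral => y _; rewrite -EFinM normrM.
rewrite Exp_EFin ?ltry//; apply: rintZ; exact: rint_norm.
Qed.

Lemma indep_ExpM : rint P X -> rint P Y ->
  \int[P]_x (X x * Y x) = (\int[P]_x X x) * (\int[P]_x Y x).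
Proof.
move=> iX iY; have iXY := indep_rintM iX iY.
pose f (z : R * R) := (z.1 * z.2)%:E.
have mf : measurable_fun setT f.
  by apply/measurable_EFinP; exact: measurable_funM.
have iZ : (distribution P Z').-integrable setT f.
  by apply: integrable_pushforward => //; exact: iXY.
have iXYd : ((distribution P X' \x distribution P Y')%E).-integrable setT f.
  apply/integrableP; split => //; case/integrableP : iZ => _; apply: le_lt_trans.
  by rewrite le_eqVlt; apply/orP; left; apply/eqP; apply: eq_measure_integral => A mA _;
    exact: prodE.
have mI (Z0 : T -> R) : rint P Z0 -> measurable_fun setT Z0 by exact: rint_measurable.
apply: EFin_inj; rewrite -Exp_EFin// EFinM.
transitivity (\int[distribution P Z']_z f z)%E.
  by rewrite [RHS]integral_pushforward//; exact: iXY.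
transitivity (\int[(distribution P X' \x distribution P Y')%E]_z f z)%E.
  by apply: eq_measure_integral => A mA _; exact/esym/prodE.
rewrite -integral12_prod_meas1//=.
transitivity (\int[distribution P X']_x (x%:E * (\int[P]_y (Y y))%:E))%E.
  apply: eq_integral => x _ /=.
  transitivity (\int[P]_y (x * Y y)%:E)%E.
    rewrite [LHS]integral_pushforward//.
      by rewrite /f/=; apply/measurable_EFinP; exact: measurable_funM.
    exact: rintZ.
  by rewrite Exp_EFin ?ExpZ//; exact: rintZ.
rewrite integralZr//; last first.
  by apply: integrable_pushforward => //; exact/measurable_EFinP.
congr (_ * _)%E; rewrite -Exp_EFin//.
rewrite [LHS]integral_pushforward//; exact/measurable_EFinP.
Qed.

End product.
End Independence.

Lemma Exp_preserved {d} {T : measurableType d} {R : realType} (P : probability T R)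
    (th : T -> T) (f : T -> R) : measurable_fun setT th ->
  (forall A, measurable A -> P (th @^-1` A) = P A) -> rint P f ->
  rint P (f \o th) /\ \int[P]_x f (th x) = \int[P]_x f x.
Proof.
move=> mth pth fi.
have mth_mixin := isMeasurableFun.Build _ _ _ _ th mth.
pose th' : {mfun T >-> T} := HB.pack th mth_mixin.
have mf : measurable_fun setT (EFin \o f) by exact: measurable_int fi.
have fi' : rint P (f \o th).
  apply/integrableP; split; first by apply/measurable_EFinP; apply: measurableT_comp => //; exact: rint_measurable fi.
  case/integrableP : (fi) => _; apply: le_lt_trans.
  have -> : (\int[P]_x `|(EFin \o f) x| = \int[distribution P th']_x `|(EFin \o f) x|)%E.
    by apply: eq_measure_integral => A mA _; exact/esym/pth.
  rewrite [leRHS]ge0_integral_pushforward//.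
  exact: measurableT_comp.
split => //; congr fine.
have -> : (\int[P]_x (f x)%:E = \int[distribution P th']_x (f x)%:E)%E.
  by apply: eq_measure_integral => A mA _; exact/esym/pth.
by rewrite [RHS]integral_pushforward.
Qed.

Section RenewalSums.
Context {d} {T : measurableType d} {R : realType} (P : probability T R).
Variables (th : T -> T) (xi : T -> R).
Hypotheses (mth : measurable_fun setT th) (mxi : measurable_fun setT xi).
Hypothesis ind : indep_maps P xi th.

(** The recursion peels off the first term, because [ind] separates exactly [xi x] from [th x], and
    the remaining sum is a function of [th x]. *)
Fixpoint rsum n x : R := if n is m.+1 then xi x + rsum m (th x) else 0.

Lemma rsumE n x : rsum n x = \sum_(0 <= j < n) xi (iter j th x).
Proof.
elim: n x => [|n IH] x /=; first by rewrite big_nil.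
by rewrite big_nat_recl//= IH; congr (_ + _); apply: eq_bigr => j _; rewrite -iterSr.
Qed.

Lemma rsum_addn m n x : rsum (m + n) x = rsum m x + rsum n (iter m th x).
Proof.
elim: m x => [|m IH] x /=; first by rewrite add0r.
by rewrite IH addrA; congr (_ + rsum _ _); rewrite -iterSr.
Qed.

Lemma measurable_iter m : measurable_fun setT (iter m th).
Proof.
elim: m => [|m IH]; first exact: measurable_id.
by rewrite (_ : iter m.+1 th = th \o iter m th)//; exact: measurableT_comp.
Qed.

Lemma measurable_rsum n : measurable_fun setT (rsum n).
Proof.
elim: n => [|n IH] /=; first exact: measurable_cst.
by apply: measurable_funD => //; exact: measurableT_comp.
Qed.

Hypothesis pres : forall A, measurable A -> P (th @^-1` A) = P A.

Lemma iter_preserves m A : measurable A -> P (iter m th @^-1` A) = P A.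
Proof.
elim: m A => // m IH A mA.
rewrite (_ : iter m.+1 th @^-1` A = iter m th @^-1` (th @^-1` A))//.
by rewrite IH ?pres//; exact: measurable_preimageT.
Qed.

Lemma rsum_indep n (f g : R -> R) : measurable_fun setT f -> measurable_fun setT g ->
  indep_maps P (fun x => f (xi x)) (fun x => g (rsum n (th x))).
Proof.
move=> mf mg.
have mg' : measurable_fun setT (g \o rsum n).
  by apply: measurableT_comp => //; exact: measurable_rsum.
exact: (indep_maps_comp mf mg' ind).
Qed.

Section second_moment.
Hypothesis xi2 : rint P (fun x => xi x ^+ 2).
Hypothesis xi0 : \int[P]_x xi x = 0.

(** The first term is centered and independent of the remaining sum, which is [rsum n] along [th]
    and has the same moments as [rsum n]; so the cross terms vanish and the second moments add
    up. *)
Lemma rsum_moments n : [/\ rint P (fun x => rsum n x ^+ 2),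
  \int[P]_x rsum n x = 0 &
  \int[P]_x (rsum n x ^+ 2) = n%:R * \int[P]_x (xi x ^+ 2)].
Proof.
have xi1 := rint_sqr mxi xi2.
elim: n => [|n [i2 E1 E2]] /=.
  split; last by rewrite mul0r -[RHS](Exp_cst P); apply: eq_Rintegral => x _; rewrite expr0n.
    by apply: eq_integrable (rint_cst P 0) => // x _ /=; rewrite expr0n.
  exact: Exp_cst.
have i1 := rint_sqr (measurable_rsum n) i2.
have [i1' E1'] := Exp_preserved mth pres i1.
have [i2' E2'] := Exp_preserved mth pres i2.
have mr' : measurable_fun setT (rsum n \o th).
  by apply: measurableT_comp => //; exact: measurable_rsum.
have ind' : indep_maps P xi (rsum n \o th).
  exact: (@rsum_indep n id id (@measurable_id _ _ _) (@measurable_id _ _ _)).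
have iM := indep_rintM mxi mr' ind' xi1 i1'.
have EM := indep_ExpM mxi mr' ind' xi1 i1'.
have Ef x : (xi x + rsum n (th x)) ^+ 2 =
    xi x ^+ 2 + (2 * (xi x * rsum n (th x)) + rsum n (th x) ^+ 2) by ring.
split.
- apply: eq_integrable (rintD xi2 (rintD (rintZ 2 iM) i2')) => // x _ /=.
  by rewrite Ef.
- by rewrite ExpD// xi0 E1' E1 addr0.
- under eq_Rintegral do rewrite Ef.
  rewrite ExpD//; last by apply: rintD => //; exact: rintZ.
  rewrite ExpD//; last exact: rintZ.
  rewrite ExpZ// EM xi0 mul0r mulr0 add0r E2' E2 -natr1; ring.
Qed.

End second_moment.

Definition Ecos (u : R) n := \int[P]_x cos (u * rsum n x).
Definition Esin (u : R) n := \int[P]_x sin (u * rsum n x).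

Let mcos (u : R) : measurable_fun setT (fun y : R => cos (u * y)).
Proof. by apply: measurableT_comp => //; exact: (continuous_measurable_fun (@continuous_cos R)). Qed.

Let msin (u : R) : measurable_fun setT (fun y : R => sin (u * y)).
Proof. by apply: measurableT_comp => //; exact: (continuous_measurable_fun (@continuous_sin R)). Qed.

Lemma rint_cos (u : R) (f : T -> R) : measurable_fun setT f -> rint P (fun x => cos (u * f x)).
Proof.
move=> mf; apply: (@rint_bounded _ _ _ _ _ 1); last by move=> x; exact: cos_max.
exact: (measurableT_comp (mcos u) mf).
Qed.

Lemma rint_sin (u : R) (f : T -> R) : measurable_fun setT f -> rint P (fun x => sin (u * f x)).
Proof.
move=> mf; apply: (@rint_bounded _ _ _ _ _ 1); last by move=> x; exact: sin_max.
exact: (measurableT_comp (msin u) mf).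
Qed.

(** The characteristic function of a sum of independent terms is a product; the addition formulas
    express this through real and imaginary part. *)
Lemma Ecos_Esin_rec u n :
  Ecos u n.+1 = Ecos u 1 * Ecos u n - Esin u 1 * Esin u n /\
  Esin u n.+1 = Esin u 1 * Ecos u n + Ecos u 1 * Esin u n.
Proof.
have mr := measurable_rsum n.
have mr' : measurable_fun setT (rsum n \o th) by exact: measurableT_comp.
have [ic' Ec'] := Exp_preserved mth pres (rint_cos u mr).
have [is' Es'] := Exp_preserved mth pres (rint_sin u mr).
have E1 : forall (f : R -> R), \int[P]_x f (u * rsum 1 x) = \int[P]_x f (u * xi x).
  by move=> f; apply: eq_Rintegral => x _ /=; rewrite addr0.
have m1 (h : R -> R) : measurable_fun setT h -> measurable_fun setT (fun x => h (xi x)).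
  by move=> mh; exact: measurableT_comp.
have m2 (h : R -> R) : measurable_fun setT h -> measurable_fun setT (fun x => h (rsum n (th x))).
  by move=> mh; exact: (measurableT_comp mh mr').
have M (h k : R -> R) : measurable_fun setT h -> measurable_fun setT k ->
    rint P (fun x => h (xi x)) -> rint P (fun x => k (rsum n (th x))) ->
    rint P (fun x => h (xi x) * k (rsum n (th x))) /\
    \int[P]_x (h (xi x) * k (rsum n (th x))) =
     (\int[P]_x h (xi x)) * (\int[P]_x k (rsum n (th x))).
  move=> mh mk ih ik; split.
    exact: (indep_rintM (m1 _ mh) (m2 _ mk) (rsum_indep n mh mk)).
  exact: (indep_ExpM (m1 _ mh) (m2 _ mk) (rsum_indep n mh mk)).
have [icc Ecc] := M _ _ (mcos u) (mcos u) (rint_cos u mxi) ic'.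
have [iss Ess] := M _ _ (msin u) (msin u) (rint_sin u mxi) is'.
have [ics Ecs] := M _ _ (mcos u) (msin u) (rint_cos u mxi) is'.
have [isc Esc] := M _ _ (msin u) (mcos u) (rint_sin u mxi) ic'.
rewrite /Ecos /Esin !(E1 cos) !(E1 sin) -Ec' -Es' -Ecc -Ess -Ecs -Esc; split.
- by rewrite -ExpB//; apply: eq_Rintegral => x _ /=; rewrite mulrDr cosD.
- by rewrite -ExpD//; apply: eq_Rintegral => x _ /=; rewrite mulrDr sinD.
Qed.

Lemma Ecos_norm u n : `|Ecos u n| <= 1.
Proof.
have mr := measurable_rsum n.
rewrite (le_trans (ler_norm_Exp (rint_cos u mr)))//.
rewrite -[leRHS](Exp_cst P); apply: le_Exp; last by move=> x; exact: cos_max.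
  exact/rint_norm/rint_cos.
exact: rint_cst.
Qed.

Lemma Esin_norm u n : `|Esin u n| <= 1.
Proof.
have mr := measurable_rsum n.
rewrite (le_trans (ler_norm_Exp (rint_sin u mr)))//.
rewrite -[leRHS](Exp_cst P); apply: le_Exp; last by move=> x; exact: sin_max.
  exact/rint_norm/rint_sin.
exact: rint_cst.
Qed.

(* The characteristic function of a sum is a power; two numbers of modulus at
   most 1 have n-th powers within n times their distance. *)
Lemma char_power u n (e : R) : 0 <= e <= 1 ->
  `|Ecos u n - e ^+ n| + `|Esin u n| <=
  (2 * n%:R) * (`|Ecos u 1 - e| + `|Esin u 1|).
Proof.
move=> /andP[e0 e1]; elim: n => [|n IH].
  rewrite /Ecos /Esin/=.
  under eq_Rintegral do rewrite mulr0 cos0.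
  under [X in _ + `|X|]eq_Rintegral do rewrite mulr0 sin0.
  by rewrite !Exp_cst expr0 subrr normr0 mulr0 mul0r addr0.
have [-> ->] := Ecos_Esin_rec u n.
have Cn := Ecos_norm u n; have Sn := Esin_norm u n.
set c1 := Ecos u 1; set s1 := Esin u 1; set c := Ecos u n; set s := Esin u n.
have -> : c1 * c - s1 * s - e ^+ n.+1 = (c1 - e) * c + e * (c - e ^+ n) - s1 * s.
  by rewrite exprS; ring.
have -> : s1 * c + c1 * s = s1 * c + (c1 - e) * s + e * s by ring.
have P1 (a b : R) : `|b| <= 1 -> `|a * b| <= `|a|.
  by move=> b1; rewrite normrM ler_piMr.
have P2 (b : R) : `|e * b| <= `|b| by rewrite normrM (ger0_norm e0) ler_piMl.
have B1 := P1 (c1 - e) c Cn; have B2 := P2 (c - e ^+ n); have B3 := P1 s1 s Sn.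
have B4 := P1 s1 c Cn; have B5 := P1 (c1 - e) s Sn; have B6 := P2 s.
have T1 : `|(c1 - e) * c + e * (c - e ^+ n) - s1 * s| <=
   `|(c1 - e) * c| + `|e * (c - e ^+ n)| + `|s1 * s|.
  by rewrite (le_trans (ler_normB _ _))// lerD2r ler_normD.
have T2 : `|s1 * c + (c1 - e) * s + e * s| <= `|s1 * c| + `|(c1 - e) * s| + `|e * s|.
  by rewrite (le_trans (ler_normD _ _))// lerD2r ler_normD.
have -> : 2 * n.+1%:R * (`|c1 - e| + `|s1|) =
   2 * n%:R * (`|c1 - e| + `|s1|) + 2 * `|c1 - e| + 2 * `|s1|.
  by rewrite -natr1; ring.
move: IH; rewrite -/c1 -/s1 -/c -/s.
lra.
Qed.

End RenewalSums.

(** * Gaussian characteristic function *)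

Section GaussianCosine.
Context {R : realType} (K a be : R) (K0 : 0 < K) (a0 : 0 < a).
Local Notation mu := (@lebesgue_measure R).

Lemma integrable_gauss (b : R) : 0 < b ->
  mu.-integrable setT (EFin \o (fun x => expR (- (b * x ^+ 2)))).
Proof.
(* The normal density of variance [(2 b)^-1] is a multiple of [expR (- (b * x ^+ 2))]. *)
move=> b0; pose s := Num.sqrt (2 * b)^-1.
have s20 : 0 < (2 * b)^-1 by rewrite invr_gt0 mulr_gt0.
have s0 : s != 0 by rewrite gt_eqF// sqrtr_gt0.
have pk : 0 < normal_peak s by exact: normal_peak_gt0.
have := integrableZl measurableT (normal_peak s)^-1 (integrable_normal_pdf 0 s).
apply: eq_integrable => // x _ /=.
rewrite /normal_pdf (negbTE s0) /normal_fun subr0 -EFinM.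
rewrite mulrA mulVf ?gt_eqF// mul1r; congr (expR _)%:E.
rewrite sqr_sqrtr ?(ltW s20)// -(mulr_natr _ 2); field.
by rewrite gt_eqF.
Qed.

Let p x := K * expR (- (a * x ^+ 2)).

Let p_ge0 x : 0 <= p x. Proof. by rewrite mulr_ge0 ?expR_ge0 ?(ltW K0). Qed.

Let is_derive_p (x : R) : is_derive x 1 p (- (2 * a * x) * p x).
Proof.
have h : is_derive x 1 (fun y : R => - (a * y ^+ 2)) (- (2 * a * x)).
  by apply: is_derive_eq; rewrite /GRing.scale/=; ring.
have h2 : is_derive x 1 (fun y : R => expR (- (a * y ^+ 2)))
   (- (2 * a * x) * expR (- (a * x ^+ 2))).
  by apply: is_derive_eq; rewrite /GRing.scale/=; ring.
by rewrite /p; apply: is_derive_eq; rewrite /GRing.scale/=; ring.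
Qed.

Let mp : measurable_fun setT p.
Proof.
apply: continuous_measurable_fun => x.
by apply/differentiable_continuous/derivable1_diffP; have [] := is_derive_p x.
Qed.

Let ip : mu.-integrable setT (EFin \o p).
Proof. by apply: eq_integrable (integrableZl measurableT K (integrable_gauss a0)). Qed.

(** Dominates the derivative in [w] of the integrand of [phi]. With [v = a x^2 / 2], one of the two
    factors [expR (- v)] absorbs [|x|], since [|x| <= (1 + a^-1) (1 + v)]. *)
Let ixp : mu.-integrable setT (EFin \o (fun x => `|x| * p x)).
Proof.
have a20 : 0 < a / 2 by rewrite divr_gt0.
pose c := K * (1 + a^-1).
have : mu.-integrable setT (EFin \o (fun x => c * expR (- (a / 2 * x ^+ 2)))).
  by apply: eq_integrable (integrableZl measurableT c (integrable_gauss a20)).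
apply: le_integrable => //.
  apply/measurable_EFinP; apply: measurable_funM; last exact: mp.
  exact: normr_measurable.
move=> x _ /=; rewrite lee_fin.
have c0 : 0 < c by rewrite mulr_gt0// addr_gt0// invr_gt0.
rewrite (@ger0_norm _ (`|x| * p x)) ?(mulr_ge0 (normr_ge0 _) (p_ge0 x))//.
rewrite (@ger0_norm _ (c * _)) ?(mulr_ge0 (ltW c0) (expR_ge0 _))// /p.
rewrite mulrCA /c -mulrA ler_pM2l//.
set v := a / 2 * x ^+ 2.
have v0 : 0 <= v by rewrite mulr_ge0 ?sqr_ge0 ?(ltW a20).
have -> : - (a * x ^+ 2) = - v + - v by rewrite /v; field.
rewrite expRD mulrA ler_wpM2r ?expR_ge0//.
rewrite expRN ler_pdivrMr ?expR_gt0//.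
have b0 : 0 < a^-1 by rewrite invr_gt0.
apply: (@le_trans _ _ ((1 + a^-1) * (1 + v))); last first.
  by rewrite ler_pM2l ?expR_ge1Dx// addr_gt0.
have xx : `|x| ^+ 2 = 2 * a^-1 * v.
  by rewrite real_normK ?num_real// /v; field; rewrite gt_eqF.
rewrite -(@ler_pXn2r _ 2) ?nnegrE//; last by rewrite mulr_ge0 ?addr_ge0// ltW.
rewrite xx; move: (a^-1) b0 => b b0.
have : 0 <= (b + v) ^+ 2 by exact: sqr_ge0.
have : 0 <= b * v by rewrite mulr_ge0 ?(ltW b0).
by nra.
Qed.

Let phi (w : R) := \int[mu]_x (cos (w * x + be) * p x).

Let mcosM (w : R) : measurable_fun setT (fun x : R => cos (w * x + be)).
Proof.
apply: (measurableT_comp (continuous_measurable_fun (@continuous_cos R))).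
by apply: measurable_funD => //; exact: measurable_funM.
Qed.

Let msinM (w : R) : measurable_fun setT (fun x : R => sin (w * x + be)).
Proof.
apply: (measurableT_comp (continuous_measurable_fun (@continuous_sin R))).
by apply: measurable_funD => //; exact: measurable_funM.
Qed.

Let icos (w : R) : mu.-integrable setT (EFin \o (fun x => cos (w * x + be) * p x)).
Proof.
apply: le_integrable ip => //.
  by apply/measurable_EFinP; apply: measurable_funM; [exact: mcosM|exact: mp].
move=> x _ /=; rewrite lee_fin normrM (ger0_norm (p_ge0 x)).
by rewrite ler_piMl// cos_max.
Qed.

Let isin (w : R) : mu.-integrable setT (EFin \o (fun x => x * sin (w * x + be) * p x)).
Proof.
apply: le_integrable ixp => //.
  apply/measurable_EFinP; apply: measurable_funM; last exact: mp.
  by apply: measurable_funM; last exact: msinM.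
move=> x _ /=; rewrite lee_fin (normrM _ (p x)) (normrM x) (normrM _ (p x)) (ger0_norm (p_ge0 x)) normr_id.
by rewrite ler_wpM2r// ler_piMr// sin_max.
Qed.

Let is_derive_phi (w : R) : is_derive w 1 phi (- \int[mu]_x (x * sin (w * x + be) * p x)).
Proof.
pose f (w x : R) := cos (w * x + be) * p x.
have df (v x : R) : is_derive v 1 (f ^~ x) (- x * sin (v * x + be) * p x).
  have h : is_derive v 1 (fun v => cos (v * x + be)) (- x * sin (v * x + be)).
    by apply: is_derive_eq; rewrite /GRing.scale/=; ring.
  by rewrite /f; move: (p x) => px; apply: is_derive_eq; rewrite /GRing.scale/=; ring.
have Iw : `](w - 1), (w + 1)[%classic w by rewrite /= in_itv/= ltrBlDr ltrDl ltr01.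
have d1E (v x : R) : partial1of2 f v x = - x * sin (v * x + be) * p x.
  by rewrite partial1of2E; have [_ ->] := df v x.
have G_ub (v x : R) : `](w - 1), (w + 1)[%classic v -> setT x ->
    `|partial1of2 f v x| <= `|x| * p x.
  move=> _ _; rewrite d1E (normrM _ (p x)) (normrM (- x)) normrN (ger0_norm (p_ge0 x)).
  by rewrite ler_wpM2r// ler_piMr// sin_max.
have G0 (x : R) : 0 <= `|x| * p x by rewrite mulr_ge0.
have intf (v : R) : `](w - 1), (w + 1)[%classic v -> mu.-integrable setT (EFin \o f v).
  by move=> _; exact: icos.
have derf1 (v x : R) : `](w - 1), (w + 1)[%classic v -> setT x -> derivable (f ^~ x) v 1.
  by move=> _ _; have [] := df v x.
have D := derivable_under_integral measurableT Iw intf derf1 G0 ixp G_ub.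
have E := differentiation_under_integral measurableT Iw intf derf1 G0 ixp G_ub.
have -> : - (\int[mu]_x (x * sin (w * x + be) * p x)) = derive1 phi w.
  rewrite -[RHS]/(derive1 (fun x' => \int[mu]_y f x' y) w) E.
  rewrite -mulN1r -(RintegralZl (-1) measurableT (isin w)).
  by apply: eq_Rintegral => x _; rewrite d1E; ring.
by rewrite derive1E; apply: derivableP; exact: D.
Qed.

(** [Fw w] vanishes at both ends and has derivative [fw w]. That [fw w] integrates to 0 is thus the
    integration by parts that gives [phi' = - w / (2 a) phi]. *)
Let Fw (w x : R) := sin (w * x + be) * p x.
Let fw (w x : R) := w * (cos (w * x + be) * p x) - 2 * a * (x * sin (w * x + be) * p x).

Let is_derive_Fw (w x : R) : is_derive x 1 (Fw w) (fw w x).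
Proof.
have h : is_derive x 1 (fun x => sin (w * x + be)) (w * cos (w * x + be)).
  by apply: is_derive_eq; rewrite /GRing.scale/=; ring.
have h2 := is_derive_p x.
rewrite /Fw /fw; apply: is_derive_eq; rewrite /GRing.scale/=.
by move: (p x) (sin _) (cos _) => P S C; ring.
Qed.

Let continuous_fw (w : R) : continuous (fw w).
Proof.
move=> x; have dp y : {for y, continuous p}.
  by apply/differentiable_continuous/derivable1_diffP; have [] := is_derive_p y.
have cl : {for x, continuous (fun x : R => w * x + be)}.
  apply: cvgD; last exact: cvg_cst.
  by apply: cvgM; [exact: cvg_cst|exact: cvg_id].
apply: cvgB; apply: cvgM.
- exact: cvg_cst.
- apply: cvgM; last exact: dp.
  by apply: (continuous_comp cl); exact: continuous_cos.
- exact: cvg_cst.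
- apply: cvgM; last exact: dp.
  apply: cvgM; first exact: cvg_id.
  by apply: (continuous_comp cl); exact: continuous_sin.
Qed.

Let ifw (w : R) : mu.-integrable setT (EFin \o fw w).
Proof.
have := integrableB measurableT (integrableZl measurableT w (icos w))
  (integrableZl measurableT (2 * a) (isin w)).
exact: eq_integrable.
Qed.

Let pn0 : (fun n : nat => p n%:R) @ \oo --> 0.
Proof.
apply/cvgrPdist_le => e e0.
near=> n.
have n1 : 1 <= n%:R :> R by rewrite ler1n; near: n; exact: nbhs_infty_gt.
rewrite sub0r normrN ger0_norm// /p.
have : K / (a * e) <= n%:R by near: n; exact: nbhs_infty_ger.
rewrite ler_pdivrMr ?mulr_gt0// => cn.
rewrite expRN ler_pdivrMr ?expR_gt0//.
apply: (@le_trans _ _ (e * (1 + a * n%:R ^+ 2))); last by rewrite ler_pM2l// expR_ge1Dx.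
have ae : 0 <= a * e by rewrite mulr_ge0// ltW.
move: (ltW e0) (ltW K0) => *; nra.
Unshelve. all: by end_near. Qed.

Let int_fw (w : R) : \int[mu]_x (fw w x) = 0.
Proof.
(* Indexing by [n.+1] keeps the interval of positive length. *)
pose I n : set R := `[- n.+1%:R, n.+1%:R]%classic.
have FTC n : (\int[mu]_(x in I n) (fw w x)%:E = (Fw w n.+1%:R - Fw w (- n.+1%:R))%:E)%E.
  rewrite (@continuous_FTC2 _ (fw w) (Fw w))//.
  - by rewrite -subr_gt0 opprK addr_gt0.
  - exact/continuous_subspaceT/continuous_fw.
  - have cF : continuous (Fw w).
      move=> x; apply/differentiable_continuous/derivable1_diffP.
      by have [] := is_derive_Fw w x.
    split=> [x _||].
    + by have [] := is_derive_Fw w x.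
    + exact/cvg_at_right_filter/cF.
    + exact/cvg_at_left_filter/cF.
  - by move=> x _; rewrite derive1E; have [_ ->] := is_derive_Fw w x.
have cv1 : (\int[mu]_x ((EFin \o fw w) \_ (I n)) x)%E @[n --> \oo] -->
    (\int[mu]_x (fw w x)%:E)%E.
  apply: (@dominated_cvg _ _ _ mu setT measurableT _ _ (fun x => (`|fw w x|)%:E)) => //.
  - move=> n; apply/measurable_restrict => //; first exact: measurable_itv.
    by apply: measurable_funTS; exact: measurable_int (ifw w).
  - move=> x _; apply: cvg_near_cst; near=> n.
    rewrite patchE mem_set// /I/= in_itv/= -ler_norml ltW//.
    rewrite (@lt_le_trans _ _ n%:R)// ?ler_nat//.
    near: n; exact: nbhs_infty_gtr.
  - exact: integrable_norm (ifw w).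
  - by move=> n x _; rewrite patchE; case: ifP => //= _; rewrite ?normr0 ?lee_fin.
have cv2 : (\int[mu]_x ((EFin \o fw w) \_ (I n)) x)%E @[n --> \oo] --> 0%:E.
  have -> : (fun n => \int[mu]_x ((EFin \o fw w) \_ (I n)) x)%E =
     (fun n => (Fw w n.+1%:R - Fw w (- n.+1%:R))%:E).
    by apply/funext => n; rewrite -integral_mkcond FTC.
  apply: cvg_EFin; first exact: nearW.
  rewrite /comp/=.
  have pS : (fun n : nat => p n.+1%:R) @ \oo --> 0 by rewrite (cvg_shiftS (fun n => p n%:R)).
  have pS2 : (fun n : nat => 2 * p n.+1%:R) @ \oo --> 0.
    by rewrite -(mulr0 2); apply: cvgM => //; exact: cvg_cst.
  apply/norm_cvg0P; apply: (squeeze_cvgr _ (cvg_cst 0) pS2).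
  apply: nearW => n; rewrite normr_ge0/= /Fw.
  have -> : p (- n.+1%:R) = p n.+1%:R by rewrite /p sqrrN.
  have sP (c : R) : `|sin c * p n.+1%:R| <= p n.+1%:R.
    by rewrite (normrM _ (p _)) (ger0_norm (p_ge0 _)) ler_piMl// sin_max.
  by rewrite (le_trans (ler_normB _ _))// mulr2n mulrDl mul1r lerD.
have := cvg_unique _ cv1 cv2.
by rewrite /Rintegral => ->.
Unshelve. all: by end_near. Qed.

(** The function [phi] solves the linear equation [phi' = - w / (2 a) phi], so that [phi w] times
    [expR (w ^+ 2 / (4 a))] is constant; its value at 0 is [cos be] because the density has mass 1.
    The phase [be] spares a separate treatment of the sine. *)
Lemma integral_cos_gauss (w : R) : \int[mu]_x (K * expR (- (a * x ^+ 2))) = 1 ->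
  \int[mu]_x (cos (w * x + be) * (K * expR (- (a * x ^+ 2)))) =
  cos be * expR (- (w ^+ 2 / (4 * a))).
Proof.
move=> p1.
have dphi (v : R) : is_derive v 1 phi (- (v / (2 * a) * phi v)).
  have := int_fw v; rewrite /fw RintegralB//; last 2 first.
    by apply: eq_integrable (integrableZl measurableT v (icos v)).
    by apply: eq_integrable (integrableZl measurableT (2 * a) (isin v)).
  rewrite (RintegralZl v measurableT (icos v)).
  rewrite (RintegralZl (2 * a) measurableT (isin v)).
  move/eqP; rewrite subr_eq0 -/(phi v) => /eqP E.
  have -> : v / (2 * a) * phi v = \int[mu]_x (x * sin (v * x + be) * p x).
    by rewrite mulrAC E; field; rewrite gt_eqF.
  exact: is_derive_phi.
pose psi (v : R) := phi v * expR (v ^+ 2 / (4 * a)).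
have dpsi (v : R) : is_derive v 1 psi 0.
  have h : is_derive v 1 (fun v : R => v ^+ 2 / (4 * a)) (v / (2 * a)).
    by apply: is_derive_eq; rewrite /GRing.scale/=; field; rewrite gt_eqF.
  have h2 : is_derive v 1 (fun v : R => expR (v ^+ 2 / (4 * a)))
      (v / (2 * a) * expR (v ^+ 2 / (4 * a))).
    by apply: is_derive_eq; rewrite /GRing.scale/=; ring.
  by rewrite /psi; apply: is_derive_eq; rewrite /GRing.scale/=; ring.
have := is_derive_0_is_cst w 0 dpsi.
rewrite /psi expr0n/= mul0r expR0 mulr1.
have -> : phi 0 = cos be.
  rewrite /phi; under eq_Rintegral do rewrite mul0r add0r.
  by rewrite RintegralZl// p1 mulr1.
move=> H; rewrite -[LHS]/(phi w) expRN -H mulfK//.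
by rewrite gt_eqF// expR_gt0.
Qed.

End GaussianCosine.

Lemma Exp_cos_normal {R : realType} {d} {T : measurableType d} (P : probability T R)
    (V : T -> R) (s w be : R) : 0 < s -> measurable_fun setT V ->
  (forall B, measurable B -> P (V @^-1` B) = normal_prob 0 s B) ->
  \int[P]_x cos (w * V x + be) = cos be * expR (- (s ^+ 2 * w ^+ 2 / 2)).
Proof.
move=> s0 mV lawV.
have sN0 : s != 0 by rewrite gt_eqF.
have mcos : measurable_fun setT (fun x : R => cos (w * x + be)).
  apply: (measurableT_comp (continuous_measurable_fun (@continuous_cos R))).
  by apply: measurable_funD => //; exact: measurable_funM.
pose V0 : T -> measurableTypeR R := V.
have mV0 : measurable_fun setT V0 by exact: mV.
have mV_mixin := isMeasurableFun.Build _ _ _ _ V0 mV0.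
pose V' : {mfun T >-> measurableTypeR R} := HB.pack V0 mV_mixin.
have ic : rint P (fun x => cos (w * V x + be)) by apply: (@rint_bounded _ _ _ _ _ 1) => [|x]; [exact: (measurableT_comp mcos mV)|exact: cos_max].
have icn : rint (normal_prob 0 s) (fun x => cos (w * x + be)).
  by apply: (@rint_bounded _ _ _ _ _ 1) => // x; exact: cos_max.
have pE x : normal_pdf 0 s x = normal_peak s * expR (- ((2 * s ^+ 2)^-1 * x ^+ 2)).
  rewrite /normal_pdf (negbTE sN0) /normal_fun subr0; congr (_ * expR _).
  by rewrite mulNr -(mulr_natr _ 2) mulrC (mulrC 2).
have pk : 0 < normal_peak s by exact: normal_peak_gt0.
have a0 : 0 < (2 * s ^+ 2)^-1 by rewrite invr_gt0 mulr_gt0// exprn_gt0.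
have := integral_cos_gauss be pk a0 w.
have -> : w ^+ 2 / (4 / (2 * s ^+ 2)) = s ^+ 2 * w ^+ 2 / 2 by field; exact: sN0.
move=> <-; last first.
  rewrite -[RHS]/(fine 1%E) -(integral_normal_pdf 0 s); congr fine.
  by apply: eq_integral => x _; rewrite pE.
pose mu := @lebesgue_measure R.
congr fine.
transitivity (\int[distribution P V']_x (cos (w * x + be))%:E)%E.
  rewrite [RHS]integral_pushforward//; exact/measurable_EFinP.
transitivity (\int[normal_prob 0 s]_x (cos (w * x + be))%:E)%E.
  by apply: eq_measure_integral => A mA _; exact: lawV.
(* The law is defined by integrating [normal_pdf], so its Radon-Nikodym derivative agrees with this
   density almost everywhere. *)
rewrite -(Radon_Nikodym_change_of_variables (@normal_prob_dominates R 0 s))//=.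
apply: ae_eq_integral => //.
- apply: emeasurable_funM => //; first exact/measurable_EFinP.
  apply: (measurable_int mu); apply: Radon_Nikodym_integrable.
  exact: normal_prob_dominates.
- apply/measurable_EFinP; apply: measurable_funM => //.
  by under eq_fun do rewrite -pE; exact: measurable_normal_pdf.
- under [X in ae_eq _ _ _ X]eq_fun do rewrite EFinM -pE.
  apply: ae_eqe_mul2l => /=.
  rewrite Radon_NikodymE//=; first exact: normal_prob_dominates.
  move=> abmu; case: cid => /= h [h1 h2 h3].
  apply: integral_ae_eq => //=.
    by apply/measurable_EFinP; exact: measurable_normal_pdf.
  by move=> E _ mE; rewrite -h3.
Qed.

(** * Central limit theorem *)

Section CosineTaylor.
Context {R : realType}.

(** The quadratic bound serves for domination by an integrable function, the cubic one for pointwise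
    convergence after division by the square. *)
Lemma one_sub_cos_taylor (y : R) :
  `|1 - cos y - y ^+ 2 / 2| <= y ^+ 2 /\ `|1 - cos y - y ^+ 2 / 2| <= `|y| ^+ 3.
Proof.
have c1 := one_sub_cos_le y; have c2 := one_sub_cos_ge0 y.
have y2 : `|y| ^+ 2 = y ^+ 2 by rewrite real_normK ?num_real.
split; first by rewrite ler_norml; apply/andP; split; lra.
have s1 := sin_sub_id_le (y / 2); have s2 := sin_lip0 (y / 2).
rewrite one_sub_cosE.
set s := sin (y / 2) in s1 s2 *; set z := y / 2 in s1 s2 *.
have -> : s ^+ 2 *+ 2 - y ^+ 2 / 2 = 2 * ((s - z) * (s + z)).
  by rewrite -mulr_natl /z; field.
rewrite normrM ger0_norm// normrM.
have : `|s + z| <= 2 * `|z| by rewrite (le_trans (ler_normD _ _))//; lra.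
have zy : `|z| = `|y| / 2 by rewrite /z normrM normfV (@ger0_norm _ 2).
have zz : z ^+ 2 = `|z| ^+ 2 by rewrite real_normK ?num_real.
move: s1; rewrite zz => s1 sz.
have : `|s - z| * `|s + z| <= `|z| ^+ 2 * (2 * `|z|) by apply: ler_pM.
rewrite zy.
have := normr_ge0 y; move: (`|s - z| * `|s + z|) => A y0.
have : 0 <= `|y| ^+ 3 by rewrite exprn_ge0.
nra.
Qed.

Lemma sin_taylor (y : R) : `|sin y - y| <= `|y| ^+ 3.
Proof.
wlog y0 : y / 0 <= y.
  move=> H; case: (leP 0 y) => [|/ltW] y0; first exact: H.
  have -> : sin y - y = - (sin (- y) - - y) by rewrite sinN; ring.
  by rewrite normrN -(normrN y); apply: H; rewrite oppr_ge0.
have df (z : R) : is_derive z 1 (fun y : R => sin y - y) (cos z - 1) by exact: is_deriveB.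
have cf : {within `[0, y], continuous (fun y : R => sin y - y)}.
  apply: continuous_subspaceT => z; apply: cvgB; last exact: cvg_id.
  exact: continuous_sin.
have [c cy] := @MVT_segment R _ (fun z => cos z - 1) 0 y y0 (fun z _ => df z) cf.
rewrite sin0 !subr0 => ->; rewrite normrM (ger0_norm y0) exprSr.
apply: ler_wpM2r => //.
move: cy; rewrite in_itv/= => /andP[c0 cy].
rewrite -normrN opprB ger0_norm ?one_sub_cos_ge0//.
rewrite (le_trans (one_sub_cos_le c))//.
have : c ^+ 2 <= y ^+ 2 by rewrite lerXn2r ?nnegrE.
by have := sqr_ge0 y; lra.
Qed.

Lemma expRN_taylor (v : R) : 0 <= v -> `|expR (- v) - (1 - v)| <= v ^+ 2.
Proof.
move=> v0; have e1 : 1 - v <= expR (- v) by rewrite expR_ge1Dx.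
rewrite ger0_norm ?subr_ge0// lerBlDr expRN.
have v1 : 0 < 1 + v by rewrite ltr_pwDl.
have : (expR v)^-1 <= (1 + v)^-1 by rewrite lef_pV2 ?posrE ?expR_gt0// expR_ge1Dx.
move=> /le_trans; apply; rewrite -[leLHS]mul1r ler_pdivrMr//.
have : 0 <= v ^+ 3 by rewrite exprn_ge0.
nra.
Qed.

End CosineTaylor.

Section CenteredCosine.
Context {d} {T : measurableType d} {R : realType} (P : probability T R).
Variables (th : T -> T) (xi : T -> R).
Hypotheses (mth : measurable_fun setT th) (mxi : measurable_fun setT xi).
Hypothesis ind : indep_maps P xi th.
Hypothesis pres : forall A, measurable A -> P (th @^-1` A) = P A.
Hypothesis xi2 : rint P (fun x => xi x ^+ 2).
Hypothesis xi0 : \int[P]_x xi x = 0.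

Let sig2 : R := \int[P]_x (xi x ^+ 2).
(** Error of the second order expansion of [exp (i y)], real and imaginary part together. *)
Let psi (y : R) : R := `|1 - cos y - y ^+ 2 / 2| + `|sin y - y|.

Let psi_ge0 y : 0 <= psi y. Proof. by rewrite addr_ge0. Qed.

Let psi_le2 y : psi y <= 2 * y ^+ 2.
Proof.
have [h _] := one_sub_cos_taylor y; have := sin_sub_id_le y.
by rewrite /psi; lra.
Qed.

Let psi_le3 y : psi y <= 2 * `|y| ^+ 3.
Proof.
have [_ h] := one_sub_cos_taylor y; have := sin_taylor y.
by rewrite /psi; lra.
Qed.

Let mpsi : measurable_fun setT psi.
Proof.
have mc : measurable_fun setT (@cos R) by exact: continuous_measurable_fun (@continuous_cos R).
have ms : measurable_fun setT (@sin R) by exact: continuous_measurable_fun (@continuous_sin R).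
apply: measurable_funD.
  apply: measurableT_comp => //; apply: measurable_funB; first exact: measurable_funB.
  by apply: measurable_funM => //; exact: measurable_funX.
by apply: measurableT_comp => //; exact: measurable_funB.
Qed.

Let ipsi (u : R) : rint P (fun x => psi (u * xi x)).
Proof.
apply: (@rint_le _ _ _ _ _ (fun x => 2 * u ^+ 2 * xi x ^+ 2)).
- by apply: (measurableT_comp mpsi); exact: measurable_funM.
- by move=> x; rewrite ger0_norm// -mulrA -exprMn.
- exact: rintZ.
Qed.

(** Otherwise there are [u_k] tending to 0 that violate the bound. The quotients
    [psi (u_k xi) / u_k^2] tend to 0 pointwise by the cubic bound and are dominated by [2 xi^2], so
    their integrals tend to 0. *)
Let psi_small (e : R) : 0 < e ->
  exists2 dl : R, 0 < dl & forall u, `|u| < dl -> \int[P]_x psi (u * xi x) <= e * u ^+ 2.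
Proof.
move=> e0; apply: contrapT => H.
have {}H k : {u : R | `|u| < k.+1%:R^-1 /\ e * u ^+ 2 < \int[P]_x psi (u * xi x)}.
  apply: cid; apply: contrapT => H2; apply: H.
  exists k.+1%:R^-1 => // u uk; rewrite leNgt; apply/negP => H3.
  by apply: H2; exists u.
pose u k := sval (H k).
have uk k : `|u k| < k.+1%:R^-1 by rewrite /u; case: (H k) => /= ? [].
have uI k : e * u k ^+ 2 < \int[P]_x psi (u k * xi x) by rewrite /u; case: (H k) => /= ? [].
have uN0 k : u k != 0.
  apply: contraTneq (uI k) => ->.
  rewrite -leNgt expr0n/= mulr0; under eq_Rintegral do rewrite mul0r.
  by rewrite Exp_cst /psi cos0 sin0 expr0n/= mul0r !subr0 subrr normr0 addr0.
have u20 k : 0 < u k ^+ 2 by rewrite exprn_even_gt0//= uN0.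
have cv : (fun k => \int[P]_x ((psi (u k * xi x) / u k ^+ 2)%:E))%E @ \oo --> (\int[P]_x 0%:E)%E.
  apply: (@dominated_cvg _ _ _ P setT measurableT _ _ (fun x => (2 * xi x ^+ 2)%:E)) => //.
  - move=> k; apply/measurable_EFinP; apply: measurable_funM => //.
    by apply: (measurableT_comp mpsi); exact: measurable_funM.
  - move=> x _; apply: cvg_EFin; first exact: nearW.
    apply/norm_cvg0P.
    have c0 : (fun k => 2 * `|xi x| ^+ 3 * k.+1%:R^-1) @ \oo --> 0.
      by rewrite -(mulr0 (2 * `|xi x| ^+ 3)); apply: cvgM; [exact: cvg_cst|exact: cvg_harmonic].
    apply: (squeeze_cvgr _ (cvg_cst 0) c0); apply: nearW => k; rewrite normr_ge0/=.
    rewrite ger0_norm ?divr_ge0 ?(ltW (u20 k))// ler_pdivrMr//.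
    rewrite (le_trans (psi_le3 _))// normrM exprMn.
    have u2E : `|u k| ^+ 2 = u k ^+ 2 by rewrite real_normK ?num_real.
    rewrite -u2E exprS.
    have : `|u k| * (`|u k| ^+ 2 * `|xi x| ^+ 3) <= k.+1%:R^-1 * (`|u k| ^+ 2 * `|xi x| ^+ 3).
      by rewrite ler_wpM2r ?mulr_ge0 ?exprn_ge0// ltW.
    by move: (k.+1%:R^-1) => q; lra.
  - exact: rintZ.
  - move=> k x _; rewrite lee_fin ger0_norm ?divr_ge0 ?(ltW (u20 k))//.
    rewrite ler_pdivrMr// -mulrA -exprMn (mulrC (xi x)); exact: psi_le2.
have ip k : rint P (fun x => psi (u k * xi x) / u k ^+ 2).
  by apply: eq_integrable (rintZ (u k ^+ 2)^-1 (ipsi (u k))) => // x _ /=; rewrite mulrC.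
have {}cv : (fun k => \int[P]_x (psi (u k * xi x) / u k ^+ 2)) @ \oo --> 0.
  by rewrite integral0 in cv; exact: (fine_cvg cv).
have : e <= 0.
  apply: (closed_cvg _ (@closed_ge _ e) _ _ cv) => /=.
  apply: nearW => k; rewrite -(ler_pM2r (u20 k)).
  apply: le_trans (ltW (uI k)) _; rewrite le_eqVlt; apply/orP; left; apply/eqP.
  under [in RHS]eq_Rintegral do rewrite mulrC.
  by rewrite (ExpZ _ (ipsi _)) mulrC mulrA divff ?mul1r// gt_eqF.
by rewrite leNgt e0.
Qed.

Lemma sig2_ge0 : 0 <= sig2.
Proof. by apply: Rintegral_ge0 => x _; exact: sqr_ge0. Qed.

(** Since [xi] is centered, the linear term of the sine disappears, and [Ecos] is [1 - sig2 u^2 / 2]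
    up to the integral of [psi]; exchanging this for the exponential costs the square of its
    exponent. *)
Let char_dist (u : R) :
  `|Ecos P th xi u 1 - expR (- (sig2 * u ^+ 2 / 2))| + `|Esin P th xi u 1| <=
  \int[P]_x psi (u * xi x) + (sig2 * u ^+ 2 / 2) ^+ 2.
Proof.
have xi1 := rint_sqr mxi xi2.
have v0 : 0 <= sig2 * u ^+ 2 / 2 by rewrite divr_ge0// mulr_ge0 ?sig2_ge0 ?sqr_ge0.
have ic := rint_cos P u mxi; have is_ := rint_sin P u mxi.
have i2 : rint P (fun x => u ^+ 2 / 2 * xi x ^+ 2) by exact: rintZ.
have iu : rint P (fun x => u * xi x) by exact: rintZ.
have EC : Ecos P th xi u 1 - (1 - sig2 * u ^+ 2 / 2) =
   - \int[P]_x (1 - cos (u * xi x) - u ^+ 2 / 2 * xi x ^+ 2).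
  rewrite ExpB//; last by apply: rintB => //; exact: rint_cst.
  rewrite ExpB//; last exact: rint_cst.
  rewrite ExpZ// Exp_cst /Ecos -/sig2.
  under eq_Rintegral do rewrite /= addr0.
  ring.
have ES : Esin P th xi u 1 = \int[P]_x (sin (u * xi x) - u * xi x).
  rewrite ExpB// ExpZ// xi0 mulr0 subr0 /Esin.
  by apply: eq_Rintegral => x _ /=; rewrite addr0.
have I1 : rint P (fun x => 1 - cos (u * xi x) - u ^+ 2 / 2 * xi x ^+ 2).
  by apply: rintB => //; apply: rintB => //; exact: rint_cst.
have I2 : rint P (fun x => sin (u * xi x) - u * xi x) by exact: rintB.
have Epsi : \int[P]_x psi (u * xi x) =
    \int[P]_x `|1 - cos (u * xi x) - u ^+ 2 / 2 * xi x ^+ 2| +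
    \int[P]_x `|sin (u * xi x) - u * xi x|.
  rewrite -ExpD; [|exact: rint_norm|exact: rint_norm].
  by apply: eq_Rintegral => x _; rewrite /psi exprMn mulrAC.
have ET := expRN_taylor v0.
have C : `|Ecos P th xi u 1 - (1 - sig2 * u ^+ 2 / 2)| <=
    \int[P]_x `|1 - cos (u * xi x) - u ^+ 2 / 2 * xi x ^+ 2|.
  by rewrite EC normrN; exact: ler_norm_Exp.
have S : `|Esin P th xi u 1| <= \int[P]_x `|sin (u * xi x) - u * xi x|.
  by rewrite ES; exact: ler_norm_Exp.
move: ET C S; rewrite Epsi.
set E := expR _; set A := 1 - _; set c := Ecos _ _ _ _ _.
have -> : c - E = (c - A) - (E - A) by ring.
have := ler_normB (c - A) (E - A).
lra.
Qed.

(** At [u = t^(-1/2)] one factor of the characteristic function differs from the Gaussian one by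
    [o (1 / t)], and there are asymptotically [kap * t] factors. The phase [be] makes the statement
    fit trigonometric polynomials directly. *)
Lemma renewal_cos_cvg (n : R -> nat) (kap be : R) :
  (n t)%:R / t @[t --> +oo] --> kap ->
  \int[P]_x cos ((Num.sqrt t)^-1 * rsum th xi (n t) x + be) @[t --> +oo] -->
    cos be * expR (- (kap * sig2 / 2)).
Proof.
move=> nk.
have split_cos u m : \int[P]_x cos (u * rsum th xi m x + be) =
    cos be * Ecos P th xi u m - sin be * Esin P th xi u m.
  have mr := measurable_rsum mth mxi m.
  have ic := rint_cos P u mr; have is_ := rint_sin P u mr.
  rewrite /Ecos /Esin -ExpZ// -ExpZ// -ExpB; [|exact: rintZ|exact: rintZ].
  by apply: eq_Rintegral => x _; rewrite cosD; ring.
under eq_fun do rewrite split_cos.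
pose v t := sig2 * ((n t)%:R / t) / 2.
have cE : cos be * expR (- v t) @[t --> +oo] --> cos be * expR (- (kap * sig2 / 2)).
  apply: cvgM; first exact: cvg_cst.
  apply: continuous_cvg; first exact: continuous_expR.
  apply: cvgN; apply: cvgM; last exact: cvg_cst.
  by rewrite mulrC; apply: cvgM => //; exact: cvg_cst.
apply/cvgrPdist_le => e e0.
have e20 : 0 < e / 2 by rewrite divr_gt0.
pose K := `|kap| + 1.
have K0 : 0 < K by rewrite ltr_wpDl.
(* The error is at most [2 (n t / t) (e / (8 K) + sig2^2 / (4 t))] with [n t / t <= K]; the lower
   bound [tS] on [t] makes the second term at most [e / (8 K)] too, so that the total is [e / 2]. *)
have d0 : 0 < e / (8 * K) by rewrite divr_gt0// mulr_gt0.
have [dl dl0 Hdl] := psi_small d0.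
have b0 : 0 < dl ^- 2 by rewrite invr_gt0 exprn_gt0.
near=> t.
have t1 : 1 < t by near: t; exact: nbhs_pinfty_gt.
have t0 : 0 < t by rewrite (lt_trans ltr01).
have tdl : dl ^- 2 < t by near: t; apply: nbhs_pinfty_gt; exact: num_real.
have tS : 2 * K * sig2 ^+ 2 / e <= t by near: t; apply: nbhs_pinfty_ge; exact: num_real.
have nK : (n t)%:R / t <= K.
  have : `|kap - (n t)%:R / t| <= 1 by near: t; move/cvgrPdist_le : nk; exact.
  rewrite ler_norml => /andP[h1 h2].
  by have := ler_norm kap; rewrite /K; lra.
have cEt : `|cos be * expR (- (kap * sig2 / 2)) - cos be * expR (- v t)| <= e / 2.
  by near: t; move/cvgrPdist_le : cE; exact.
set u := (Num.sqrt t)^-1.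
have u2 : u ^+ 2 = t^-1 by rewrite /u exprVn sqr_sqrtr// ltW.
have u0 : 0 < u by rewrite invr_gt0 sqrtr_gt0.
have udl : `|u| < dl.
  rewrite gtr0_norm// -(@ltr_pXn2r _ 2) ?nnegrE ?(ltW u0) ?(ltW dl0)//.
  by rewrite u2 invf_plt ?posrE ?exprn_gt0.
have e01 : 0 <= expR (- (sig2 * u ^+ 2 / 2)) <= 1.
  rewrite expR_ge0/= -expR0 ler_expR oppr_le0.
  by rewrite divr_ge0// mulr_ge0 ?sig2_ge0 ?sqr_ge0.
have := char_power mth mxi ind pres u (n t) e01.
have -> : expR (- (sig2 * u ^+ 2 / 2)) ^+ n t = expR (- v t).
  by rewrite -expRM_natl; congr expR; rewrite /v u2 -mulr_natl; ring.
set CN := Ecos _ _ _ _ _; set SN := Esin _ _ _ _ _ => B.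
have {B}B : `|CN - expR (- v t)| + `|SN| <= e / 2.
  apply: le_trans B _.
  have := char_dist u; have := Hdl u udl; rewrite u2.
  set I := \int[P]_x _; set D := _ + _ => h1 h2.
  apply: (@le_trans _ _ (2 * (n t)%:R * (e / (8 * K) / t + (sig2 / t / 2) ^+ 2))).
    by apply: ler_wpM2l; [rewrite mulr_ge0|lra].
  have -> : 2 * (n t)%:R * (e / (8 * K) / t + (sig2 / t / 2) ^+ 2) =
    ((n t)%:R / t) * (2 * (e / (8 * K) + sig2 ^+ 2 / t / 4)).
    by field; rewrite !gt_eqF.
  have tinv : sig2 ^+ 2 / t <= e / (2 * K).
    rewrite ler_pdivrMr// mulrAC ler_pdivlMr ?mulr_gt0//.
    by move: tS; rewrite ler_pdivrMr//; lra.
  have s0 : 0 <= sig2 ^+ 2 / t by rewrite divr_ge0 ?sqr_ge0// ltW.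
  apply: (@le_trans _ _ (K * (2 * (e / (8 * K) + sig2 ^+ 2 / t / 4)))).
    apply: ler_wpM2r => //; apply: mulr_ge0 => //; apply: addr_ge0; first exact: ltW d0.
    exact: divr_ge0.
  apply: (@le_trans _ _ (K * (2 * (e / (8 * K) + e / (2 * K) / 4)))).
    by rewrite ler_pM2l// ler_pM2l// lerD2l ler_pM2r.
  by rewrite le_eqVlt; apply/orP; left; apply/eqP; field; rewrite gt_eqF.
have -> : cos be * expR (- (kap * sig2 / 2)) - (cos be * CN - sin be * SN) =
   (cos be * expR (- (kap * sig2 / 2)) - cos be * expR (- v t)) -
   (cos be * (CN - expR (- v t)) - sin be * SN) by ring.
rewrite (le_trans (ler_normB _ _))//.
have h1 := ler_normB (cos be * (CN - expR (- v t))) (sin be * SN).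
have h2 : `|cos be * (CN - expR (- v t))| <= `|CN - expR (- v t)|.
  by rewrite normrM ler_piMl// cos_max.
have h3 : `|sin be * SN| <= `|SN| by rewrite normrM ler_piMl// sin_max.
lra.
Unshelve. all: by end_near. Qed.

End CenteredCosine.

(** * Weak convergence in l^oo(H) *)

#[local] Instance nbhs_rV_filter {R : realType} n (x : 'rV[R]_n) : ProperFilter (nbhs x).
Proof. exact: (@nbhs_pfilter ('rV[R]_n : topologicalType)). Qed.

Lemma bigcup_countType_measurable {d} {T : measurableType d} (I : countType)
    (D : set I) (F : I -> set T) :
  (forall i, measurable (F i)) -> measurable (\bigcup_(i in D) F i).
Proof.
move=> mF; rewrite bigcup_mkcond; apply: countable_bigcupT_measurable => //.
by move=> i; case: ifP.
Qed.

(** An open set is the union of the rational cubes that it contains, and there are countably many of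
    them. *)
Lemma measurable_open_rV {R : realType} {d} {T : measurableType d} n (V : T -> 'rV[R]_n)
    (O : set 'rV[R]_n) :
  (forall i, measurable_fun setT (fun w => V w ord0 i)) -> open O ->
  measurable (V @^-1` O).
Proof.
move=> mV oO.
pose B (q : 'rV[rat]_n) (r : rat) : set 'rV[R]_n :=
  [set v | forall i, `|v ord0 i - ratr (q ord0 i)| < ratr r].
pose I : set ('rV[rat]_n * rat) := [set qr | B qr.1 qr.2 `<=` O].
have mB q r : measurable (V @^-1` B q r).
  have -> : V @^-1` B q r =
      \bigcap_(i in [set: 'I_n]) ((fun w => V w ord0 i - ratr (q ord0 i)) @^-1`
         [set y | `|y| < ratr r]).
    by apply/seteqP; split => w /= h; [move=> i _; exact: h|move=> i; exact: h].
  apply: fin_bigcap_measurable => // i _.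
  apply: measurable_preimageT; first exact: measurable_funB.
  have -> : [set y : R | `|y| < ratr r] = `]- ratr r, ratr r[%classic.
    by apply/seteqP; split => y /=; rewrite in_itv/= ltr_norml.
  exact: measurable_itv.
have -> : V @^-1` O = \bigcup_(qr in I) (V @^-1` B qr.1 qr.2).
  apply/seteqP; split=> [w /= Ow|w [qr Iqr]]; last exact: Iqr.
  have /nbhs_ballP[e /= e0 eO] : nbhs (V w) O by exact: open_nbhs_nbhs.
  have [r] : exists r : rat, ratr r \in `]0, (e / 2)[%R.
    by have [r rI] := @rat_in_itvoo R 0 (e / 2) (divr_gt0 e0 (ltr0Sn R 1)); exists r.
  rewrite in_itv/= => /andP[r0 re].
  have /choice[q Hq] : forall i, exists q : rat, `|V w ord0 i - ratr q| < ratr r.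
    move=> i.
    have lt : V w ord0 i - ratr r < V w ord0 i + ratr r by lra.
    have [q] := rat_in_itvoo lt; rewrite in_itv/= => /andP[h1 h2].
    by exists q; rewrite ltr_norml; apply/andP; split; lra.
  exists (\row_i q i, r) => /=; last by move=> i; rewrite mxE.
  move=> v /= Bv; apply: eO; rewrite /ball/=; split => // i j; rewrite (ord1 i).
  rewrite /ball/=.
  have := Bv j; have := Hq j; rewrite mxE => h1 h2.
  have -> : V w ord0 j - v ord0 j = (V w ord0 j - ratr (q j)) - (v ord0 j - ratr (q j)) by ring.
  by rewrite (le_lt_trans (ler_normB _ _))//; lra.
by apply: bigcup_countType_measurable => qr; exact: mB.
Qed.

Lemma measurable_comp_rV {R : realType} {d} {T : measurableType d} n (V : T -> 'rV[R]_n)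
    (f : 'rV[R]_n -> R) :
  (forall i, measurable_fun setT (fun w => V w ord0 i)) -> continuous f ->
  measurable_fun setT (fun w => f (V w)).
Proof.
move=> mV cf.
apply: (measurability _ (RGenOInfty.measurableE R)).
move=> _ [_ [x ->] <-]; rewrite setTI.
rewrite -[X in measurable X]/(V @^-1` (f @^-1` `]x, +oo[%classic)).
apply: measurable_open_rV => //.
by apply: open_comp => [v _|]; [exact: cf|exact: interval_open].
Qed.

Lemma cvg_sumr {R : realType} {T : Type} (F : set_system T) {FF : Filter F} I (s : seq I)
    (f : I -> T -> R) (l : I -> R) :
  (forall i, f i y @[y --> F] --> l i) ->
  \sum_(i <- s) f i y @[y --> F] --> \sum_(i <- s) l i.
Proof.
move=> fx; elim: s => [|i s IH].
  rewrite big_nil (_ : (fun y => _) = fun=> 0); first exact: cvg_cst.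
  by apply/funext => y; rewrite big_nil.
rewrite big_cons (_ : (fun y => _) = fun y => f i y + \sum_(j <- s) f j y).
  exact: cvgD.
by apply/funext => y; rewrite big_cons.
Qed.

Lemma continuous_dotmx {R : realType} n (u : 'rV[R]_n) : continuous (dotmx u).
Proof.
move=> x; rewrite (_ : dotmx u = fun y => \sum_i u ord0 i * y ord0 i); last first.
  by apply/funext => y; rewrite dotmxE.
apply: cvg_sumr => i.
by apply: cvgM; [exact: cvg_cst|exact: coord_continuous].
Qed.

Lemma continuous_trig_eval {R : realType} n (s : seq (R * 'rV[R]_n * R)) :
  continuous (trig_eval s).
Proof.
move=> x; apply: cvg_sumr => e.
apply: cvgM; first exact: cvg_cst.
apply: (continuous_cvg _ (@continuous_cos R _)).
apply: cvgD; last exact: cvg_cst.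
exact: continuous_dotmx.
Qed.

(** * Convergence in law of random vectors *)

Section WeakLimitRV.
Context {R : realType} {n : nat} {d} {T : measurableType d} (P : probability T R)
  {d'} {T' : measurableType d'} (P' : probability T' R).
Variables (V : R -> T -> 'rV[R]_n) (G : T' -> 'rV[R]_n).
Hypothesis mV : forall t i, measurable_fun setT (fun w => V t w ord0 i).
Hypothesis mG : forall i, measurable_fun setT (fun w => G w ord0 i).

Definition box (K : R) : set 'rV[R]_n := [set v | forall i, `|v ord0 i| <= K].

Lemma compact_box K : compact (box K).
Proof.
have := @rV_compact R n (fun=> `[- K, K]%classic) (fun _ => @segment_compact _ _ _).
congr compact; apply/seteqP; split => v /= h i; have := h i; by rewrite /= in_itv/= ler_norml.
Qed.

Hypothesis cosVG : forall u be,
  \int[P]_w cos (dotmx u (V t w) + be) @[t --> +oo] --> \int[P']_w cos (dotmx u (G w) + be).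

Definition tight := forall e, 0 < e -> exists2 K : R, 0 < K &
  \forall t \near +oo, fine (P [set w | ~ box K (V t w)]) <= e.

Hypothesis tightV : tight.

Lemma measurable_box d0 (T0 : measurableType d0) (U : T0 -> 'rV[R]_n) K :
  (forall i, measurable_fun setT (fun w => U w ord0 i)) ->
  measurable [set w | box K (U w)].
Proof.
move=> mU.
have -> : [set w | box K (U w)] =
    \bigcap_(i in [set: 'I_n]) ((fun w => U w ord0 i) @^-1` `[- K, K]%classic).
  apply/seteqP; split => w /= h.
    by move=> i _ /=; rewrite in_itv/= -ler_norml.
  by move=> i; have := h i I; rewrite /= in_itv/= -ler_norml.
by apply: fin_bigcap_measurable => // i _; exact: measurable_preimageT.
Qed.

(** A single random vector is tight by continuity of its law from above. *)
Let tightG e : 0 < e -> exists2 K : R, 0 < K & fine (P' [set w | ~ box K (G w)]) <= e.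
Proof.
move=> e0.
have mA k : measurable [set w | ~ box k.+1%:R (G w)].
  by apply: measurableC; exact: measurable_box.
have : P' \o (fun k => [set w | ~ box k.+1%:R (G w)]) @ \oo -->
    P' (\bigcap_k [set w | ~ box k.+1%:R (G w)]).
  apply: nonincreasing_cvg_mu => //.
  - by rewrite (le_lt_trans (probability_le1 _ _))// ltry.
  - exact: bigcapT_measurable.
  - move=> a b ab; apply/subsetPset => w /= h h2; apply: h => i.
    by rewrite (le_trans (h2 i))// ler_nat.
have -> : \bigcap_k [set w | ~ box k.+1%:R (G w)] = set0.
  rewrite -subset0 => w /= h.
  pose m := \big[maxn/0%N]_i (Num.truncn `|G w ord0 i|).+1.
  apply: (h m I) => i; rewrite (le_trans (ltW (truncnS_gt _)))// ler_nat.
  by apply: leqW; exact: (leq_bigmax i).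
rewrite measure0 => /fine_cvg /cvgrPdist_le /(_ e e0) [N _ HN].
exists N.+1%:R => //; have := HN N (leqnn N).
by rewrite /= sub0r normrN => /(le_trans (ler_norm _)).
Qed.

Lemma rint_comp_rV d0 (T0 : measurableType d0) (Q : probability T0 R) (U : T0 -> 'rV[R]_n)
    (f : 'rV[R]_n -> R) (M : R) :
  (forall i, measurable_fun setT (fun w => U w ord0 i)) -> continuous f ->
  (forall v, `|f v| <= M) -> rint Q (fun w => f (U w)).
Proof.
move=> mU cf fM; apply: (@rint_bounded _ _ _ _ _ M) => //.
exact: measurable_comp_rV.
Qed.

(** On the box the integrands differ by at most [e]; off the box, an event of probability at most
    [e'], by at most [2 * M]. *)
Let Exp_approx d0 (T0 : measurableType d0) (Q : probability T0 R) (U : T0 -> 'rV[R]_n)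
    (f p : 'rV[R]_n -> R) (M K e e' : R) :
  (forall i, measurable_fun setT (fun w => U w ord0 i)) -> continuous f -> continuous p ->
  (forall v, `|f v| <= M) -> (forall v, `|p v| <= M) -> 0 <= e ->
  (forall v, box K v -> `|p v - f v| <= e) ->
  fine (Q [set w | ~ box K (U w)]) <= e' ->
  `|\int[Q]_w p (U w) - \int[Q]_w f (U w)| <= e + 2 * M * e'.
Proof.
move=> mU cf cp fM pM e0 pf Qe.
have M0 : 0 <= M by exact: le_trans (fM 0).
have ip := rint_comp_rV Q mU cp pM; have if_ := rint_comp_rV Q mU cf fM.
have mB : measurable [set w | ~ box K (U w)] by apply: measurableC; exact: measurable_box.
have i1 : rint Q (\1_[set w | ~ box K (U w)]).
  apply: (@rint_bounded _ _ _ _ _ 1) => // x; rewrite indicE.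
  by case: (_ \in _); rewrite ?normr1 ?normr0.
rewrite -ExpB// (le_trans (ler_norm_Exp (rintB ip if_)))//.
apply: (@le_trans _ _ (\int[Q]_w (e + 2 * M * \1_[set w | ~ box K (U w)] w))).
  apply: le_Exp.
  - exact/rint_norm/rintB.
  - by apply: rintD; [exact: rint_cst|exact: rintZ].
  - move=> w; rewrite indicE; case: (boolP (_ \in _)).
      rewrite inE/= mulr1 => _; rewrite (le_trans (ler_normB _ _))//.
      by have := fM (U w); have := pM (U w); lra.
    by rewrite notin_setE/= => /contrapT/pf; rewrite mulr0 addr0.
rewrite ExpD; [|exact: rint_cst|exact: rintZ].
rewrite Exp_cst ExpZ// lerD2l ler_wpM2l ?mulr_ge0//.
by rewrite /Rintegral integral_indic// setIT.
Qed.

(** The hypothesis on cosines extends to trigonometric polynomials by linearity, and one such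
    polynomial is close to [f] on a box that carries most of the mass of both laws. With tightness
    given, no inversion of characteristic functions occurs. *)
Lemma weak_cvg_rV (f : 'rV[R]_n -> R) (M : R) :
  continuous f -> (forall v, `|f v| <= M) ->
  \int[P]_w f (V t w) @[t --> +oo] --> \int[P']_w f (G w).
Proof.
move=> cf fM.
have M0 : 0 <= M by exact: le_trans (fM 0).
apply/cvgrPdist_le => e e0.
(* Mass allowed outside of a box: [2 * M] times it is at most [e / 5], and the [+ 1] keeps the
   quotient meaningful for [M = 0]. *)
have e'0 : 0 < e / (10 * (M + 1)) by rewrite divr_gt0// mulr_gt0// ltr_wpDl.
have [K1 K10 HK1] := tightV e'0; have [K2 K20 HK2] := tightG e'0.
pose K := K1 + K2.
have K0 : 0 < K by rewrite addr_gt0.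
have e10 : 0 < e / 10 by rewrite divr_gt0.
have [p [[s ps] pM pf]] := trigpoly_approx cf fM K0 e10.
have cp : continuous p by rewrite ps; exact: continuous_trig_eval.
have cosI d0 (T0 : measurableType d0) (Q : probability T0 R) (U : T0 -> 'rV[R]_n) u be :
    (forall i, measurable_fun setT (fun w => U w ord0 i)) ->
    rint Q (fun w => cos (dotmx u (U w) + be)).
  move=> mU; apply: (@rint_comp_rV _ _ Q U (fun v => cos (dotmx u v + be)) 1) => //.
    move=> v; apply: (continuous_cvg _ (@continuous_cos R _)).
    by apply: cvgD; [exact: continuous_dotmx|exact: cvg_cst].
  by move=> v; exact: cos_max.
have cvp : \int[P]_w p (V t w) @[t --> +oo] --> \int[P']_w p (G w).
  have pE d0 (T0 : measurableType d0) (Q : probability T0 R) (U : T0 -> 'rV[R]_n) :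
      (forall i, measurable_fun setT (fun w => U w ord0 i)) ->
      \int[Q]_w p (U w) = \sum_(a <- s) a.1.1 * \int[Q]_w cos (dotmx a.1.2 (U w) + a.2).
    move=> mU; rewrite ps /trig_eval Exp_sum; last by move=> a; apply: rintZ; exact: cosI.
    by apply: eq_bigr => a _; rewrite ExpZ//; exact: cosI.
  rewrite pE//; under eq_fun do rewrite pE//.
  by apply: cvg_sumr => a; apply: cvgM => //; exact: cvg_cst.
have boxS (K' : R) v : K' <= K -> ~ box K v -> ~ box K' v.
  by move=> KK h h2; apply: h => i; rewrite (le_trans (h2 i)).
have le_box d0 (T0 : measurableType d0) (Q : probability T0 R) (U : T0 -> 'rV[R]_n) K' :
    (forall i, measurable_fun setT (fun w => U w ord0 i)) -> K' <= K ->
    fine (Q [set w | ~ box K (U w)]) <= fine (Q [set w | ~ box K' (U w)]).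
  move=> mU KK; rewrite fine_le ?fin_num_measure//; try by apply: measurableC; exact: measurable_box.
  apply: le_measure; rewrite ?inE; try by apply: measurableC; exact: measurable_box.
  by move=> w /=; exact: boxS.
have B1 : 2 * M * (e / (10 * (M + 1))) <= e / 5.
  rewrite mulrA ler_pdivrMr ?mulr_gt0 ?ltr_wpDl//.
  by move: (ltW e0); nra.
have HG : `|\int[P']_w p (G w) - \int[P']_w f (G w)| <= e / 10 + e / 5.
  apply: le_trans (Exp_approx mG cf cp fM pM (ltW e10) pf (e' := e / (10 * (M + 1))) _) _.
    by rewrite (le_trans (le_box _ _ P' G K2 mG _))// lerDr ltW.
  by rewrite lerD2l.
near=> t.
have HV : `|\int[P]_w p (V t w) - \int[P]_w f (V t w)| <= e / 10 + e / 5.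
  apply: le_trans (Exp_approx (mV t) cf cp fM pM (ltW e10) pf (e' := e / (10 * (M + 1))) _) _.
    rewrite (le_trans (le_box _ _ P (V t) K1 (mV t) _))//; first by rewrite lerDl ltW.
    by near: t.
  by rewrite lerD2l.
have Hp : `|\int[P']_w p (G w) - \int[P]_w p (V t w)| <= e / 10.
  by near: t; move/cvgrPdist_le : cvp; exact.
move: HV HG Hp; rewrite !ler_norml => /andP[? ?] /andP[? ?] /andP[? ?].
by apply/andP; split; lra.
Unshelve. all: by end_near. Qed.

End WeakLimitRV.

(** * Processes close to a continuous image of random vectors *)

Section HoffmannJorgensen.
Context {R : realType} {n : nat} {X : choiceType} (H : set X).
Local Notation linf := (@linfty R X H).
Variable Phi : 'rV[R]_n -> X -> R.
Hypothesis Phi_linfty : forall v, linf (Phi v).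
Hypothesis Phi_cont : forall v e, 0 < e -> \forall v' \near v,
  forall h, H h -> `|Phi v h - Phi v' h| <= e.

Lemma nbhs_uniform_le (f : {uniform` H -> R}) (A : set {uniform` H -> R}) :
  nbhs f A -> exists2 e : R, 0 < e & forall g, (forall h, H h -> `|f h - g h| <= e) -> A g.
Proof.
move=> /uniform_nbhs[E [entE EA]].
have [e /= e0 eE] := entE.
exists (e / 2); first by rewrite divr_gt0.
move=> g fg; apply: EA => h Hh; apply: eE => /=.
by rewrite /ball/= (le_lt_trans (fg h Hh))// ltr_pdivrMr// ltr_pMr// ltr1n.
Qed.

Lemma continuous_Phi : continuous (Phi : 'rV[R]_n -> {uniform` H -> R}).
Proof.
move=> v A /nbhs_uniform_le[e e0 eA].
have := Phi_cont v e0; apply: filterS => v' h; exact: eA.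
Qed.

Section functional.
Variables (F : {uniform` H -> R} -> R) (M : R).
Hypothesis cF : {within linf, continuous F}.
Hypothesis FM : forall z, linf z -> `|F z| <= M.

Lemma within_linfty_near z (e : R) : linf z -> 0 < e -> exists2 dl : R, 0 < dl &
  forall z', linf z' -> (forall h, H h -> `|z h - z' h| <= dl) -> `|F z - F z'| <= e.
Proof.
move=> lz e0.
have /subspace_continuousP/(_ z lz)/cvgrPdist_le/(_ e e0) := cF.
move=> /nbhs_uniform_le[dl dl0 Hdl]; exists dl => // z' lz' zz'.
exact: Hdl.
Qed.

Lemma continuous_FPhi : continuous (fun v => F (Phi v)).
Proof.
move=> v; apply/cvgrPdist_le => e e0.
have [dl dl0 Hdl] := within_linfty_near (Phi_linfty v) e0.
by have := Phi_cont v dl0; apply: filterS => v' h; exact: Hdl.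
Qed.

(** [F] is merely continuous, and [z] need not lie in the range of [Phi]; a modulus that is uniform
    in [v] comes from the compactness of the box, by comparing [Phi v] and [z] with [Phi v0] for [v]
    near [v0]. *)
Lemma FPhi_unif_near (K e : R) : 0 < e -> exists2 dl : R, 0 < dl &
  forall v z, box K v -> linf z -> (forall h, H h -> `|Phi v h - z h| <= dl) ->
    `|F (Phi v) - F z| <= e.
Proof.
move=> e0.
have /compact_near_coveringP/(_ R (0^'+) (fun dl v => forall z, linf z ->
   (forall h, H h -> `|Phi v h - z h| <= dl) -> `|F (Phi v) - F z| <= e)) := @compact_box R n K.
case.
  move=> v0 _.
  have e20 : 0 < e / 2 by rewrite divr_gt0.
  have [dl dl0 Hdl] := within_linfty_near (Phi_linfty v0) e20.
  have dl20 : 0 < dl / 2 by rewrite divr_gt0.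
  near=> v dl' => z lz vz /=.
  have v0v h : H h -> `|Phi v0 h - Phi v h| <= dl / 2.
    by move: h; near: v; exact: Phi_cont.
  have dl'2 : dl' <= dl / 2 by near: dl'; exact: nbhs_right_le.
  have h1 : `|F (Phi v0) - F (Phi v)| <= e / 2.
    apply: Hdl => // h Hh; rewrite (le_trans (v0v _ Hh))//.
    by rewrite ler_pdivrMr// ler_peMr ?ler1n// ltW.
  have h2 : `|F (Phi v0) - F z| <= e / 2.
    apply: Hdl => // h Hh.
    have -> : Phi v0 h - z h = (Phi v0 h - Phi v h) + (Phi v h - z h) by ring.
    rewrite (le_trans (ler_normD _ _))//.
    by have := v0v _ Hh; have := vz _ Hh => /= ? ?; lra.
  have -> : F (Phi v) - F z = (F (Phi v0) - F z) - (F (Phi v0) - F (Phi v)) by ring.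
  by rewrite (le_trans (ler_normB _ _))//; lra.
move=> r /= r0 Hr; exists (r / 2); first by rewrite divr_gt0.
move=> v z bv lz vz; apply: (Hr (r / 2)) => //=; last by rewrite divr_gt0.
by rewrite sub0r normrN gtr0_norm ?divr_gt0// ltr_pdivrMr// ltr_pMr// ltr1n.
Unshelve. all: by end_near. Qed.

End functional.

(** The composite [F (Z t)] may fail to be measurable. Outside of a small event it is close to the
    measurable [F (Phi (V t))], and everywhere it stays within [D] of it, which bounds its outer
    expectation from both sides. *)
Lemma weak_cvg_linfty_approx {d} {T : measurableType d} (P : probability T R)
    {d'} {T' : measurableType d'} (P' : probability T' R)
    (V : R -> T -> 'rV[R]_n) (G : T' -> 'rV[R]_n) (Z : R -> T -> X -> R) :
  (forall t i, measurable_fun setT (fun w => V t w ord0 i)) ->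
  (forall i, measurable_fun setT (fun w => G w ord0 i)) ->
  (forall u be, \int[P]_w cos (dotmx u (V t w) + be) @[t --> +oo] -->
     \int[P']_w cos (dotmx u (G w) + be)) ->
  tight P V ->
  (\forall t \near +oo, forall w, linf (Z t w)) ->
  (forall dl e, 0 < dl -> 0 < e -> \forall t \near +oo, exists B : set T,
    [/\ measurable B, fine (P B) <= e
      & forall w, ~ B w -> forall h, H h -> `|Phi (V t w) h - Z t w h| <= dl]) ->
  weak_cvg_linfty H P Z P' (fun w => Phi (G w)).
Proof.
move=> mV mG cosVG tightV lZ approxZ; split => //.
  move=> O oO; rewrite -[X in measurable X]/(G @^-1` (Phi @^-1` O)).
  apply: measurable_open_rV => //.
  by have /continuousP := continuous_Phi; apply.
move=> F cF [M FM].
have M0 : 0 <= M by exact: le_trans (FM _ (Phi_linfty 0)).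
have cf := continuous_FPhi cF.
have fM v : `|F (Phi v)| <= M by exact: FM.
have cvf := weak_cvg_rV mV mG cosVG tightV cf fM.
have mfV t : measurable_fun setT (fun w => F (Phi (V t w))).
  exact: (measurable_comp_rV (mV t) cf).
have ifV t : rint P (fun w => F (Phi (V t w))).
  exact: (@rint_bounded _ _ _ _ _ M).
have ifG : rint P' (fun w => F (Phi (G w))).
  by apply: (@rint_bounded _ _ _ _ _ M) => //; exact: (measurable_comp_rV mG cf).
have -> : ('E_P'[fun w => F (Phi (G w))] = (\int[P']_w F (Phi (G w)))%:E)%E.
  by rewrite unlock Exp_EFin.
have key e : 0 < e -> \forall t \near +oo,
    ((\int[P']_w F (Phi (G w)) - e)%:E <= outer_expectation P (fun w => F (Z t w)) <=
     (\int[P']_w F (Phi (G w)) + e)%:E)%E.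
  (* With this [e'] the integral of [D] is at most [e / 10 + 4 e / 10]; together with [Hf] the error
     stays below [e]. *)
  move=> e0; pose e' := e / (10 * (M + 1)).
  have e'0 : 0 < e' by rewrite divr_gt0// mulr_gt0// ltr_wpDl.
  have e100 : 0 < e / 10 by rewrite divr_gt0.
  have [K K0 HK] := tightV _ e'0.
  have [dl dl0 Hdl] := FPhi_unif_near cF K e100.
  near=> t.
  have lZt w : linf (Z t w) by move: w; near: t.
  have [B [mB PB BZ]] : exists B : set T, [/\ measurable B, fine (P B) <= e'
      & forall w, ~ B w -> forall h, H h -> `|Phi (V t w) h - Z t w h| <= dl].
    by near: t; exact: approxZ.
  have PK : fine (P [set w | ~ box K (V t w)]) <= e' by near: t.
  have Hf : `|\int[P']_w F (Phi (G w)) - \int[P]_w F (Phi (V t w))| <= e / 10.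
    by near: t; move/cvgrPdist_le : cvf; exact.
  pose C := [set w | ~ box K (V t w)].
  have mC : measurable C by apply: measurableC; exact: measurable_box.
  have ind (A : set T) : measurable A -> rint P (\1_A) /\ \int[P]_w (\1_A w) = fine (P A).
    move=> mA; split; last by rewrite /Rintegral integral_indic// setIT.
    apply: (@rint_bounded _ _ _ _ _ 1) => // x; rewrite indicE.
    by case: (_ \in _); rewrite ?normr1 ?normr0.
  have [iB EB] := ind _ mB; have [iC EC] := ind _ mC.
  pose D w : R := e / 10 + 2 * M * (\1_B w + \1_C w).
  have iD : rint P D.
    by apply: rintD; [exact: rint_cst|apply: rintZ; exact: rintD].
  have ED : \int[P]_w D w <= e / 10 + 4 * M * e'.
    rewrite ExpD; [|exact: rint_cst|by apply: rintZ; exact: rintD].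
    rewrite Exp_cst ExpZ; last exact: rintD.
    rewrite ExpD// EB EC lerD2l.
    have -> : 4 * M * e' = 2 * M * (e' + e') by ring.
    by apply: ler_wpM2l; [rewrite mulr_ge0|exact: lerD].
  have DM : 4 * M * e' <= 4 * (e / 10).
    rewrite /e' (mulrA (4 * M)) ler_pdivrMr ?mulr_gt0 ?ltr_wpDl//.
    by move: (ltW e0); nra.
  have FD w : `|F (Phi (V t w)) - F (Z t w)| <= D w.
    rewrite /D; have fw := fM (V t w); have zw := FM _ (lZt w).
    have big : `|F (Phi (V t w)) - F (Z t w)| <= 2 * M.
      by rewrite (le_trans (ler_normB _ _))//; lra.
    have i01 (A : set T) : 0 <= \1_A w :> R by rewrite indicE; case: (_ \in _).
    have [Bw|nBw] := pselect (B w).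
      have -> : \1_B w = 1 :> R by rewrite indicE mem_set.
      by rewrite (le_trans big)//; have := i01 C; have := ltW e0; nra.
    have [Cw|nCw] := pselect (C w).
      have -> : \1_C w = 1 :> R by rewrite indicE mem_set.
      by rewrite (le_trans big)//; have := i01 B; have := ltW e0; nra.
    have /Hdl : box K (V t w) by exact: contrapT.
    move=> /(_ _ (lZt w) (BZ w nBw)) /le_trans; apply.
    by rewrite lerDl mulr_ge0 ?mulr_ge0 ?addr_ge0.
  have FD' w : F (Phi (V t w)) - D w <= F (Z t w) <= F (Phi (V t w)) + D w.
    by have := FD w; rewrite ler_norml => /andP[? ?]; apply/andP; split; lra.
  apply/andP; split.
    (* Each integrable majorant [U] of [F (Z t)] also majorizes [F (Phi (V t)) - D]. *)
    apply: le_ereal_inf_tmp => _ [U /= [iU FU] <-].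
    rewrite unlock Exp_EFin// lee_fin.
    apply: (@le_trans _ _ (\int[P]_w (F (Phi (V t w)) - D w))).
      by rewrite ExpB//; move: Hf; rewrite ler_norml => /andP[? ?]; lra.
    apply: le_Exp => //; first exact: rintB.
    by move=> w; have /andP[h _] := FD' w; exact: le_trans h (FU w).
  (* The function [F (Phi (V t)) + D] is itself one of the majorants over which the infimum is
     taken. *)
  apply: (@le_trans _ _ ('E_P[fun w => (F (Phi (V t w)) + D w)%R])%E).
    apply: ereal_inf_lbound => /=; exists (fun w => F (Phi (V t w)) + D w) => //.
    by split; [exact: rintD|move=> w; have /andP[] := FD' w].
  rewrite unlock Exp_EFin; last exact: rintD.
  rewrite lee_fin ExpD//.
  by move: Hf; rewrite ler_norml => /andP[? ?]; lra.
apply/fine_cvgP; split.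
  have := key 1 ltr01; apply: filterS => t /andP[h1 h2].
  rewrite fin_numE -ltNye -ltey.
  by rewrite (lt_le_trans (ltNyr _) h1) (le_lt_trans h2 (ltry _)).
apply/cvgrPdist_le => e e0; have := key e e0; apply: filterS => t /=.
case: (outer_expectation _ _) => [r||] /=.
- rewrite !lee_fin ler_norml => /andP[h1 h2]; apply/andP; split; lra.
- by rewrite leye_eq andbF.
- by [].
Unshelve. all: by end_near. Qed.

End HoffmannJorgensen.

(** * Regeneration at an atom *)

Lemma nat_inf_eq (A : set nat) n : A n -> (forall p, A p -> (n <= p)%N) -> nat_inf A = n.
Proof.
move=> An Ap; rewrite /nat_inf; apply: xget_unique => //= m [Am mp].
by apply/eqP; rewrite eqn_leq (mp _ An) (Ap _ Am).
Qed.

Lemma nat_inf_empty (A : set nat) : (forall n, ~ A n) -> nat_inf A = 0%N.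
Proof. by move=> nA; rewrite /nat_inf xgetPN// => n [/nA]. Qed.

Section PathSpace.
Context {dE} {E : measurableType dE}.

Definition cylinders : set (set (nat -> E)) :=
  [set B | exists i A, measurable A /\ B = [set y | A (y i)]].

Definition past_cylinders n : set (set (nat -> E)) :=
  [set B | exists i A, [/\ (i < n)%N, measurable A & B = [set y | A (y i)]]].

Definition path_space := g_sigma_algebraType cylinders.

Definition past n : set (set (nat -> E)) := <<s past_cylinders n >>.

(** The past as a measurable space of its own, so that closure properties of measurable sets and
    maps hold for events and functions of the past. *)
Definition past_space n := g_sigma_algebraType (past_cylinders n).

Lemma past_measurable n (B : set path_space) : past n B -> measurable B.
Proof.
move: B; apply: smallest_sub; first exact: smallest_sigma_algebra.
by move=> _ [i [A [_ mA ->]]]; apply: sub_sigma_algebra; exists i, A.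
Qed.

Lemma pastS m n : (m <= n)%N -> past m `<=` past n.
Proof.
move=> mn; apply: smallest_sub; first exact: smallest_sigma_algebra.
move=> _ [i [A [im mA ->]]]; apply: sub_sigma_algebra.
by exists i, A; split => //; exact: leq_trans mn.
Qed.

Lemma past_coord n i (A : set E) : (i < n)%N -> measurable A ->
  past n [set y | A (y i)].
Proof. by move=> *; apply: sub_sigma_algebra; exists i, A. Qed.

Lemma past_measurable_coord n i : (i < n)%N ->
  measurable_fun setT (fun y : past_space n => y i).
Proof. by move=> ni _ A mA; rewrite setTI; exact: past_coord. Qed.

Lemma measurable_coord i : measurable_fun setT (fun y : path_space => y i).
Proof. by move=> _ A mA; rewrite setTI; apply: sub_sigma_algebra; exists i, A. Qed.

Lemma pastI n A B : past n A -> past n B -> past n (A `&` B).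
Proof. exact: (@measurableI _ (past_space n)). Qed.

Lemma pastT n : past n setT.
Proof. exact: (@measurableT _ (past_space n)). Qed.

Lemma past_all n p m (Q : nat -> set E) : (m + p <= n)%N -> (forall i, measurable (Q i)) ->
  past n [set y | forall i, (i < p)%N -> Q i (y (m + i)%N)].
Proof.
move=> mpn mQ; elim: p mpn => [|p IH] mpn.
  by rewrite (_ : [set y | _] = setT); [exact: pastT|apply/seteqP; split].
rewrite (_ : [set y | _] = [set y | forall i, (i < p)%N -> Q i (y (m + i)%N)] `&`
   [set y | Q p (y (m + p)%N)]).
  apply: pastI; first by apply: IH; rewrite (leq_trans _ mpn)// leq_add2l.
  by apply: past_coord => //; rewrite (leq_trans _ mpn)// addnS.
apply/seteqP; split => y /=; first by move=> h; split=> [i ip|]; apply: h => //; exact: ltnW.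
by move=> [h1 h2] i; rewrite ltnS leq_eqVlt => /orP[/eqP->//|]; exact: h1.
Qed.

Definition path_shift n (y : path_space) : path_space := fun i => y (n + i)%N.

Lemma measurable_to_path d (T : measurableType d) (f : T -> path_space) :
  (forall i, measurable_fun setT (fun x => f x i)) -> measurable_fun setT f.
Proof.
move=> mf; apply: (@measurability _ _ _ (path_space) setT f cylinders) => //.
move=> _ [_ [i [A [mA ->]]] <-].
by apply: mf.
Qed.

Lemma measurable_path_shift n : measurable_fun setT (path_shift n).
Proof. by apply: measurable_to_path => i; exact: measurable_coord. Qed.

End PathSpace.
Arguments path_space {dE} E.
Arguments past_space {dE} E n.

Section IntegralTransfer.
Context {R : realType} {d} {T : measurableType d} {dE} {E : measurableType dE}.
Variable mu : {measure set T -> \bar R}.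
Local Open Scope ereal_scope.

(** Membership in [C] becomes a coordinate, so that the part of [mu] on [C] is seen as the part of
    one image measure on [true]. *)
Let ind (C : set T) (X : T -> E) (y : T) : bool * E := (y \in C, X y).

Let measurable_ind C X : measurable C -> measurable_fun setT X ->
  measurable_fun setT (ind C X).
Proof.
move=> mC mX; apply: measurable_fun_pair => //.
apply: (measurable_fun_bool true); rewrite setTI.
suff -> : (fun y => y \in C) @^-1` [set true] = C by [].
by apply/seteqP; split => y /=; [exact: set_mem|exact: mem_set].
Qed.

(** The hypothesis makes the images under [X1] and [X2] of the parts of [mu] on [C1] and [C2]
    proportional, and integrals inherit the factor. *)
Lemma ge0_integral_transfer (C1 C2 : set T) (X1 X2 : T -> E) (c : {nonneg R})
    (g : E -> \bar R) :
  measurable C1 -> measurable C2 -> measurable_fun setT X1 -> measurable_fun setT X2 ->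
  (forall A, measurable A ->
     mu (C1 `&` X1 @^-1` A) = c%:num%:E * mu (C2 `&` X2 @^-1` A)) ->
  measurable_fun setT g -> (forall e, 0 <= g e) ->
  \int[mu]_(y in C1) g (X1 y) = c%:num%:E * \int[mu]_(y in C2) g (X2 y).
Proof.
move=> m1 m2 mX1 mX2 H mg g0.
pose D : set (bool * E) := [set true] `*` setT.
have mD : measurable D by exact: measurableX.
have mg2 : measurable_fun D (g \o snd) by apply: measurable_funTS; exact: measurableT_comp.
have push C X (mC : measurable C) (mX : measurable_fun setT X) :
   \int[mu]_(y in C) g (X y) = \int[pushforward mu (ind C X)]_(e in D) (g \o snd) e.
  rewrite [RHS]ge0_integral_pushforward//; do ?[exact: measurable_ind | by move=> z _; exact: g0].
  congr (integral _ _ _); apply/seteqP; split => y.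
    by move=> Cy; split => //; exact: mem_set.
  by move=> [/= h _]; exact: set_mem.
rewrite (push C1 X1)// (push C2 X2)//.
have mi2 := measurable_ind m2 mX2; have mi1 := measurable_ind m1 mX1.
rewrite -(@ge0_integral_mscale _ _ _ (pushforward mu (ind C2 X2)) D mD c (g \o snd))//.
apply: eq_measure_integral => A mA AD.
have E2 C X : ind C X @^-1` A = C `&` X @^-1` [set e | A (true, e)].
  apply/seteqP; split => y /=; rewrite /ind/=.
    move=> Ay; have [/= yC _] := AD _ Ay; split; first exact: set_mem.
    by rewrite -yC.
  by move=> [Cy Ay]; rewrite mem_set.
transitivity (c%:num%:E * pushforward mu (ind C2 X2) A)%E; last by [].
transitivity (pushforward mu (ind C1 X1) A); first by [].
rewrite /pushforward !E2; apply: H.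
rewrite -[X in measurable X]/(pair true @^-1` A) -[X in measurable X]setTI.
  exact: pair1_measurable.
by move=> x _; exact: g0.
Qed.

End IntegralTransfer.

(** * Chains with an atom *)

Section AtomicChain.
Context {R : realType} {dE} {E : measurableType dE}.
Variables (at_ : pred E) (e0 : E) (k : E -> set E -> \bar R) (mu : probability (path_space E) R).
Hypothesis at_e0 : at_ e0.
Hypothesis mat_ : measurable [set e | at_ e].
Hypothesis k_ge0 : forall e A, measurable A -> (0 <= k e A)%E.
Hypothesis mk : forall A, measurable A -> measurable_fun setT (k ^~ A).
Hypothesis k_atom : forall e A, measurable A -> at_ e -> k e A = k e0 A.

(* A path lists the states after time 0, at which the chain sits in [e0]. *)
Definition state_at (y : path_space E) (n : nat) : E := if n is m.+1 then y m else e0.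

Hypothesis chain : forall n A B, measurable A -> past n B ->
  mu (B `&` [set y | A (y n)]) = (\int[mu]_(y in B) k (state_at y n) A)%E.

(** Value 0, the default of [nat_inf], codes that the path never returns. *)
Definition return_time (y : path_space E) : nat :=
  nat_inf [set n | (0 < n)%N /\ at_ (state_at y n)].

(** Entry [n] of the path is the state at time [n.+1], hence the shift; a successor on the left also
    rules out the default value. *)
Lemma return_timeP y n : (return_time y = n.+1) <->
  (at_ (y n) /\ forall i, (i < n)%N -> ~~ at_ (y i)).
Proof.
split=> [tn|[yn yi]]; last first.
  apply: nat_inf_eq => // -[|p] [//= _ yp].
  by rewrite ltnNge; apply/negP => pn; have := yi _ pn; rewrite yp.
have [p [p0 yp]] : exists p, (0 < p)%N /\ at_ (state_at y p).
  apply: contrapT => H; move: tn; rewrite /return_time nat_inf_empty// => p yp.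
  by apply: H; exists p.
have ex : exists q, (0 < q)%N && at_ (state_at y q) by exists p; rewrite p0.
move: tn; case: (ex_minnP ex) => q /andP[q0 yq] qmin.
rewrite /return_time (nat_inf_eq (n := q)) => [qn|//|r [r0 yr]]; last first.
  by apply: qmin; rewrite r0.
subst q; split => // i ni; apply/negP => yi.
by have := qmin i.+1 yi; rewrite ltnS leqNgt ni.
Qed.

Lemma return_time_gt0 y : (0 < return_time y)%N <-> exists n, at_ (y n).
Proof.
split.
  case E1 : (return_time y) => [//|n] _; exists n.
  by have [] := (return_timeP y n).1 E1.
move=> [n yn]; have [m ym mmin] := ex_minnP (ex_intro (fun n => at_ (y n)) n yn).
suff -> : return_time y = m.+1 by [].
apply/return_timeP; split => // i im; apply/negP => /mmin.
by rewrite leqNgt im.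
Qed.

Lemma past_return_time n : past n.+1 [set y | return_time y = n.+1].
Proof.
rewrite (_ : [set y | _] = [set y | [set e | at_ e] (y n)] `&`
   [set y | forall i, (i < n)%N -> (~` [set e | at_ e]) (y (0 + i)%N)]).
  apply: pastI; first exact: past_coord.
  apply: (@past_all _ _ _ n 0 (fun=> ~` [set e | at_ e])) => // i; exact: measurableC.
apply/seteqP; split => y /=; first by move=> /return_timeP[h1 h2]; split => // i /h2/negP.
by move=> [h1 h2]; apply/return_timeP; split => // i /h2/negP.
Qed.

Lemma measurable_return_time_eq n : measurable [set y | return_time y = n].
Proof.
case: n => [|n]; last by apply: (@past_measurable _ _ n.+1); exact: past_return_time.
rewrite (_ : [set y | _] = ~` \bigcup_n [set y | return_time y = n.+1]).
  by apply: measurableC; apply: bigcupT_measurable => n; apply: (@past_measurable _ _ n.+1); exact: past_return_time.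
apply/seteqP; split => y /=; first by move=> yt [m _ /=]; rewrite yt.
by move=> h; case E1 : (return_time y) => [//|m]; exfalso; apply: h; exists m.
Qed.

Definition regen (y : path_space E) : path_space E := path_shift (return_time y) y.

Lemma measurable_by_return_time d (T : measurableType d) (f : path_space E -> T)
    (F : nat -> path_space E -> T) :
  (forall n, measurable_fun setT (F n)) -> (forall y, f y = F (return_time y) y) ->
  measurable_fun setT f.
Proof.
move=> mF fF _ A mA; rewrite setTI.
rewrite (_ : f @^-1` A = \bigcup_n ([set y | return_time y = n] `&` F n @^-1` A)).
  apply: bigcupT_measurable => n; apply: measurableI; first exact: measurable_return_time_eq.
  exact: measurable_preimageT.
apply/seteqP; split => y /=; first by move=> Ay; exists (return_time y) => //; split; rewrite //= -fF.
by move=> [n _ [<-]] /=; rewrite -fF.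
Qed.

Lemma measurable_regen : measurable_fun setT regen.
Proof.
apply: (measurable_by_return_time (F := fun n => path_shift n)) => // n.
exact: measurable_path_shift.
Qed.

Let rect m p (Bs : nat -> set E) : set (path_space E) :=
  [set y | forall i, (i < p)%N -> Bs i (y (m + i)%N)].

Let rectS m p Bs : rect m p.+1 Bs = rect m p Bs `&` [set y | Bs p (y (m + p)%N)].
Proof.
apply/seteqP; split => y /=; first by move=> h; split=> [i ip|]; apply: h => //; exact: ltnW.
by move=> [h1 h2] i; rewrite ltnS leq_eqVlt => /orP[/eqP->//|]; exact: h1.
Qed.

(** Induction on the number of coordinates. The last one is integrated against the kernel, whose
    argument is the preceding state: for the first coordinate this is the atom on [D], and for later
    ones its law on the smaller rectangle is known by induction up to the factor [mu D]. *)
Let regen_rect n D p Bs : past n D -> D `<=` [set y | at_ (state_at y n)] ->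
  (forall i, measurable (Bs i)) ->
  mu (D `&` rect n p Bs) = (mu D * mu (rect 0 p Bs))%E.
Proof.
move=> pD Dat; have mD := past_measurable pD.
elim: p Bs => [|p IH] Bs mB.
  have r0 m : rect m 0 Bs = setT by apply/seteqP; split.
  by rewrite !r0 setIT probability_setT mule1.
have pr m : past (m + p) (rect m p Bs) by exact: past_all.
have pDr : past (n + p) (D `&` rect n p Bs).
  by apply: pastI => //; apply: pastS pD; exact: leq_addr.
rewrite !rectS setIA chain// (@chain (0 + p) (Bs p) (rect 0 p Bs))//.
case: p IH pr pDr => [|q] IH pr pDr.
  have r0 m : rect m 0 Bs = setT by apply/seteqP; split.
  rewrite !r0 setIT.
  rewrite (eq_integral (fun=> k e0 (Bs 0%N))); last first.
    by move=> y; rewrite inE addn0 => Dy; rewrite k_atom//; exact: Dat.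
  rewrite integral_cst// [X in _ = (_ * X)%E](_ : _ = k e0 (Bs 0%N)) 1?muleC//.
  transitivity (\int[mu]_(y in setT) (cst (k e0 (Bs 0%N)) y))%E; first exact: eq_integral.
  transitivity (k e0 (Bs 0%N) * mu setT)%E; first exact: integral_cst.
  have muT : mu setT = 1%E by exact: probability_setT.
  by rewrite muT mule1.
have muD : mu D = (NngNum (fine_ge0 (measure_ge0 mu D)))%:num%:E.
  by rewrite /= fineK// fin_num_measure.
rewrite addnS [in LHS]/= [in RHS]/= {1}muD.
apply: (@ge0_integral_transfer _ _ _ _ _ mu (D `&` rect n q.+1 Bs) (rect 0 q.+1 Bs)
  (fun y => y (n + q)%N) (fun y => y q) _ (fun e => k e (Bs q.+1))).
- exact: past_measurable pDr.
- exact: past_measurable (pr 0%N).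
- exact: measurable_coord.
- exact: measurable_coord.
- move=> A mA; rewrite -muD.
  (* Shrinking the last side of the rectangle by [A] turns the induction hypothesis into a statement
     on the joint law with the last state. *)
  pose Bs' i := if i == q then Bs q `&` A else Bs i.
  have mB' i : measurable (Bs' i) by rewrite /Bs'; case: ifP => // _; exact: measurableI.
  have E1 m : rect m q.+1 Bs' = rect m q.+1 Bs `&` [set y | A (y (m + q)%N)].
    rewrite !rectS; apply/seteqP; split => y /=.
      move=> [h1]; rewrite /Bs' eqxx => -[h2 h3]; split => //; split => // i iq.
      by have := h1 i iq; rewrite /Bs' ltn_eqF.
    move=> [[h1 h2] h3]; split; last by rewrite /Bs' eqxx.
    by move=> i iq; rewrite /Bs' ltn_eqF//; exact: h1.
  by have := IH Bs' mB'; rewrite !E1 setIA.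
- exact: mk.
- by move=> e; exact: k_ge0.
Qed.

(** Both sides are finite measures in [B] that agree on rectangles, which are stable under
    intersection and generate the path space. *)
Lemma regen_past n D B : past n D -> D `<=` [set y | at_ (state_at y n)] ->
  measurable B -> mu (D `&` path_shift n @^-1` B) = (mu D * mu B)%E.
Proof.
move=> pD Dat mB; have mD := past_measurable pD.
pose G : set (set (path_space E)) := [set A | exists p Bs,
  (forall i, measurable (Bs i)) /\ A = rect 0 p Bs].
have GB : <<s G >> B.
  move: B mB; apply: smallest_sub; first exact: smallest_sigma_algebra.
  move=> _ [i [A [mA ->]]]; apply: sub_sigma_algebra.
  exists i.+1, (fun j => if j == i then A else setT); split.
    by move=> j; case: ifP.
  apply/seteqP; split => y /=.
    by move=> Ay j _; case: eqP => // ->.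
  by move=> /(_ i (ltnSn i)); rewrite eqxx.
have muD : mu D = (NngNum (fine_ge0 (measure_ge0 mu D)))%:num%:E.
  by rewrite /= fineK// fin_num_measure.
have -> : mu (D `&` path_shift n @^-1` B) =
    pushforward (mrestr mu mD) (path_shift n) B.
  by rewrite /pushforward/= /mrestr setIC.
have -> : (mu D * mu B)%E = mscale (NngNum (fine_ge0 (measure_ge0 mu D))) mu B.
  by rewrite /mscale/= fineK// fin_num_measure.
apply: (@g_sigma_algebra_measure_unique _ _ (path_space E) G _ (fun=> setT)) => //.
- move=> _ [p [Bs [mBs ->]]]; apply: (@past_measurable _ _ (0 + p)); exact: past_all.
- by move=> _; exists 0%N, (fun=> setT); split => //; apply/seteqP; split.
- by apply/seteqP; split => // y _; exists 0%N.
- exact: measurable_path_shift.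
- move=> _ _ [p [Bs [mBs ->]]] [p' [Bs' [mBs' ->]]].
  exists (maxn p p'), (fun i => (if (i < p)%N then Bs i else setT) `&`
    (if (i < p')%N then Bs' i else setT)); split.
    by move=> i; apply: measurableI; case: ifP.
  apply/seteqP; split => y /=.
    move=> [h1 h2] i _; split; case: ifP => // ip; [exact: h1|exact: h2].
  move=> h; split=> i ip.
    by have [] := h i (leq_trans ip (leq_maxl _ _)); rewrite ip.
  by have [] := h i (leq_trans ip (leq_maxr _ _)); rewrite ip.
- move=> Hm _ [p [Bs [mBs ->]]].
  change (mu (path_shift n @^-1` rect 0 p Bs `&` D) =
    ((fine (mu D))%:E * mu (rect 0 p Bs))%E).
  by rewrite fineK ?fin_num_measure// setIC -(regen_rect p pD Dat mBs).
- move=> Hm _; change (mu (path_shift n @^-1` setT `&` D) < +oo)%E.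
  by rewrite preimage_setT setTI (le_lt_trans (probability_le1 mu mD))// ltry.
Qed.

Hypothesis returns : mu [set y | return_time y = 0%N] = 0%E.

Lemma measure_return_decomp C : measurable C ->
  mu C = (\sum_(n <oo) mu (C `&` [set y | return_time y = n.+1]))%E.
Proof.
move=> mC.
pose S n := [set y | return_time y = n.+1].
have mS n : measurable (S n) by exact: measurable_return_time_eq.
have tS : trivIset setT (fun n => C `&` S n).
  apply/trivIsetP => i j _ _ ij; rewrite -subset0 => y /= [[_ yi] [_ yj]].
  by move: ij; rewrite -eqSS -yi -yj eqxx.
have mCS n : measurable (C `&` S n) by exact: measurableI.
rewrite -(measure_semi_bigcup mu)//; last exact: bigcupT_measurable.
rewrite -setI_bigcupr.
have -> : \bigcup_n S n = ~` [set y | return_time y = 0%N].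
  apply/seteqP; split => y /=; first by move=> [n _]; rewrite /S/= => ->.
  by case Ey : (return_time y) => [//|n] _; exists n.
have m0 := measurable_return_time_eq 0.
rewrite -[in LHS](setIT C) -(setUCl [set y | return_time y = 0%N]) setIUr measureU0//.
- by apply: measurableI => //; exact: measurableC.
- exact: measurableI.
- by apply/eqP; rewrite -measure_le0 -returns measureIr.
Qed.

(** The strong Markov property at the return time: where this time is [n.+1], the event for [X]
    belongs to the past of [n.+1], and regeneration at a fixed time applies. *)
Lemma regen_joint d (T : measurableType d) (X : path_space E -> T) A B :
  (forall n, past n.+1 (X @^-1` A `&` [set y | return_time y = n.+1])) ->
  measurable_fun setT X -> measurable A -> measurable B ->
  mu (X @^-1` A `&` regen @^-1` B) = (mu (X @^-1` A) * mu B)%E.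
Proof.
move=> pX mX mA mB.
have mXA : measurable (X @^-1` A) by exact: measurable_preimageT.
have mrB : measurable (regen @^-1` B).
  by apply: measurable_preimageT => //; exact: measurable_regen.
rewrite measure_return_decomp; last exact: measurableI.
rewrite (measure_return_decomp mXA) muleC -(fineK (fin_num_measure mu _ mB)) -nneseriesZl//.
apply: eq_eseriesr => n _; rewrite fineK ?fin_num_measure// muleC.
rewrite -(regen_past (pX n) _ mB) => [|y [_ /= /return_timeP[]]//].
congr (mu _); apply/seteqP; split => y /=.
  by move=> [[Xy ry] yn]; split => //; move: ry; rewrite /regen yn.
by move=> [[Xy yn] ry]; split => //; split => //; rewrite /regen yn.
Qed.

Lemma regen_preserves B : measurable B -> mu (regen @^-1` B) = mu B.
Proof.
(* Regeneration with a trivial variable for the past. *)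
move=> mB; pose X (y : path_space E) := tt.
have XT : X @^-1` setT = setT by apply/seteqP; split.
have := @regen_joint _ _ X setT B _ (measurable_cst _) measurableT mB.
have muT : mu setT = 1%E by exact: probability_setT.
rewrite XT setTI muT mul1e; apply => n.
by rewrite setTI; exact: past_return_time.
Qed.

Lemma regen_indep d (T : measurableType d) (X : path_space E -> T) :
  (forall n A, measurable A -> past n.+1 (X @^-1` A `&` [set y | return_time y = n.+1])) ->
  measurable_fun setT X -> indep_maps mu X regen.
Proof.
by move=> pX mX A B mA mB; rewrite regen_preserves//; apply: regen_joint => // n; exact: pX.
Qed.

Section additive.
Variable f : E -> E -> R.
Hypothesis mf : measurable_fun setT (fun z : E * E => f z.1 z.2).

Definition path_sum (y : path_space E) n : R :=
  \sum_(0 <= i < n) f (state_at y i) (state_at y i.+1).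

Definition cycle_sum (y : path_space E) : R := path_sum y (return_time y).

Let measurable_state_at n i : (i <= n)%N ->
  measurable_fun setT (fun y : past_space E n => state_at y i).
Proof. by case: i => [|i] ni; [exact: measurable_cst|exact: past_measurable_coord]. Qed.

Lemma past_path_sum n A : measurable A -> past n [set y | A (path_sum y n)].
Proof.
move=> mA; rewrite -[past n]/(@measurable _ (past_space E n)).
rewrite -[X in measurable X]/((fun y : past_space E n => path_sum y n) @^-1` A).
apply: measurable_preimageT => //; rewrite /path_sum.
rewrite (_ : (fun y : past_space E n => _) = (fun y : past_space E n =>
   \sum_(i < n) f (state_at y i) (state_at y i.+1))); last first.
  by apply/funext => y; rewrite big_mkord.
apply: measurable_sum => i.
have mi : measurable_fun setT (fun x : past_space E n => (state_at x i, state_at x i.+1)).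
  by apply: measurable_fun_pair; apply: measurable_state_at => //; exact: ltnW.
exact: (measurableT_comp mf mi).
Qed.

Lemma measurable_path_sum n : measurable_fun setT (fun y => path_sum y n).
Proof.
by move=> _ A mA; rewrite setTI; apply: (@past_measurable _ _ n); exact: past_path_sum.
Qed.

Lemma measurable_cycle_sum : measurable_fun setT cycle_sum.
Proof.
exact: (measurable_by_return_time (F := fun n y => path_sum y n) measurable_path_sum).
Qed.

Lemma cycle_sum_indep : indep_maps mu cycle_sum regen.
Proof.
apply: regen_indep => [n A mA|]; last exact: measurable_cycle_sum.
rewrite (_ : _ `&` _ = [set y | A (path_sum y n.+1)] `&` [set y | return_time y = n.+1]).
  by apply: pastI; [exact: past_path_sum|exact: past_return_time].
by apply/seteqP; split => y /= [h1 h2]; split => //; move: h1; rewrite /cycle_sum h2.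
Qed.

End additive.

Fixpoint hit_time (j : nat) (y : path_space E) : nat :=
  if j is i.+1 then (return_time y + hit_time i (regen y))%N else 0%N.

Definition recurrent_path (y : path_space E) := forall m, exists2 n, (m <= n)%N & at_ (y n).

Lemma recurrent_return y : recurrent_path y -> (0 < return_time y)%N.
Proof. by move=> /(_ 0%N)[n _ yn]; apply/return_time_gt0; exists n. Qed.

Lemma recurrent_regen y : recurrent_path y -> recurrent_path (regen y).
Proof.
move=> ry m; have [n mn yn] := ry (return_time y + m)%N.
exists (n - return_time y)%N; first by rewrite leq_subRL// (leq_trans (leq_addr m _)).
by rewrite /regen /path_shift subnKC// (leq_trans (leq_addr m _)).
Qed.

Lemma state_at_regen y n : recurrent_path y -> at_ (state_at y (return_time y)) /\
  state_at (regen y) n.+1 = state_at y (return_time y + n.+1).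
Proof.
move=> /recurrent_return; case Ey : (return_time y) => [//|m] _.
have [ym _] := (return_timeP y m).1 Ey.
by split => //; rewrite /= /regen /path_shift Ey !addSn addnS.
Qed.

(** [hit_time] unfolds the first cycle and shifts the path, whereas [T_] looks for the next visit
    after the last one; this joins the two recursions. *)
Lemma hit_timeS y j : recurrent_path y ->
  hit_time j.+1 y = nat_inf [set n | (hit_time j y < n)%N /\ at_ (state_at y n)].
Proof.
elim: j y => [|j IH] y ry; first by rewrite /= addn0.
rewrite [LHS]/=; have rr := recurrent_regen ry.
have -> : (return_time (regen y) + hit_time j (regen (regen y)))%N = hit_time j.+1 (regen y) by [].
rewrite IH//; set A := [set n | _].
have [n An Amin] : exists2 n, A n & forall p, A p -> (n <= p)%N.
  have [q hq yq] := rr (hit_time j (regen y)).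
  have ex : exists q, (hit_time j (regen y) < q)%N && at_ (state_at (regen y) q).
    by exists q.+1; rewrite ltnS hq.
  exists (ex_minn ex); case: (ex_minnP ex) => q' /andP[h1 h2] qmin; first by split.
  by move=> p [p1 p2]; apply: qmin; rewrite p1.
rewrite (nat_inf_eq An Amin); symmetry; apply: nat_inf_eq.
- case: An => h1 h2; split; first by rewrite /= ltn_add2l.
  by case: n {Amin} h1 h2 => // n h1 h2; have [_ <-] := state_at_regen n ry.
- move=> p [/= h1 h2].
  have tp : (return_time y <= p)%N by rewrite (leq_trans _ (ltnW h1))// leq_addr.
  rewrite -(subnKC tp) leq_add2l; apply: Amin; split; first by rewrite ltn_subRL.
  move: h1 h2; rewrite -{1 2}(subnKC tp) ltn_add2l.
  case: (p - return_time y)%N => // q _ h2.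
  by have [_ ->] := state_at_regen q ry.
Qed.

Lemma hit_time_lt y j : recurrent_path y -> (hit_time j y < hit_time j.+1 y)%N.
Proof.
elim: j y => [|j IH] y ry; first by rewrite /= addn0; exact: recurrent_return.
by rewrite [X in (X < _)%N]/= [X in (_ < X)%N]/= ltn_add2l; exact: (IH _ (recurrent_regen ry)).
Qed.

Section additive_renewal.
Variable f : E -> E -> R.
Hypothesis f_atom : forall e e', at_ e -> f e e' = f e0 e'.

(** A shifted path starts at [e0], while the original path may be at any point of the atom at that
    time; [f_atom] makes the first summand of each cycle agree. *)
Lemma rsum_cycle_sum n y : recurrent_path y ->
  rsum regen (cycle_sum f) n y = path_sum f y (hit_time n y).
Proof.
elim: n y => [|n IH] y ry; first by rewrite /= /path_sum big_nil.
rewrite /= IH; last exact: recurrent_regen.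
rewrite /cycle_sum /path_sum (@big_cat_nat _ _ _ (return_time y) 0 (_ + _))//= ?leq_addr//.
congr (_ + _).
rewrite -{1}[return_time y]add0n big_addn addKn.
apply: eq_bigr => i _; have [yt si] := state_at_regen i ry.
rewrite /= (_ : y (i + return_time y)%N = regen y i); last first.
  by rewrite /regen /path_shift addnC.
rewrite addnC.
case: i si => [|i] si; last by have [_ <-] := state_at_regen i ry.
by rewrite addn0 (f_atom _ yt).
Qed.

End additive_renewal.

(** The event of no return is null, and so are its preimages under the iterates of [regen], which
    preserves [mu]; outside of these the path comes back again and again. *)
Lemma recurrent_ae : measurable [set y | recurrent_path y] /\
  mu [set y | recurrent_path y] = 1%E.
Proof.
pose N m := iter m regen @^-1` [set y | return_time y = 0%N].
have mit m : measurable_fun setT (iter m regen) by exact: (measurable_iter measurable_regen).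
have mN m : measurable (N m).
  by apply: measurable_preimageT => //; exact: measurable_return_time_eq.
have N0 m : mu (N m) = 0%E.
  rewrite /N (iter_preserves measurable_regen regen_preserves)//.
  exact: measurable_return_time_eq.
have -> : [set y | recurrent_path y] = ~` \bigcup_m N m.
  apply/seteqP; split => y /=.
    move=> ry [m _]; rewrite /N/=.
    have : recurrent_path (iter m regen y).
      by elim: m => //= m; exact: recurrent_regen.
    by move=> /recurrent_return; case: (return_time _).
  move=> nN m.
  have H : forall j z, (forall i, (0 < return_time (iter i regen z))%N) ->
      exists2 n, (j <= n)%N & at_ (z n).
    elim=> [|j IH] z hz.
      by have /return_time_gt0[n zn] := hz 0%N; exists n.
    have hz' i : (0 < return_time (iter i regen (regen z)))%N by rewrite -iterSr; exact: hz.
    have [n jn zn] := IH _ hz'.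
    exists (return_time z + n)%N => //.
    by rewrite (leq_ltn_trans jn)// -[X in (X < _)%N]add0n ltn_add2r; exact: (hz 0%N).
  apply: H => i; rewrite lt0n; apply/negP => /eqP h.
  by apply: nN; exists i.
have mU : measurable (\bigcup_m N m) by exact: bigcupT_measurable.
split; first exact: measurableC.
rewrite probability_setC// (_ : mu (\bigcup_m N m) = 0%E) ?sube0//.
apply/negligibleP => //; apply: negligible_bigcup => m.
by exists (N m); split; [exact: mN|exact: N0|exact: subset_refl].
Qed.

End AtomicChain.

(** * The split chain *)

(** As a series the sum over a countable type is accessible to the measurability of countable
    sums. *)
Lemma esum_pickle {R : realType} {V : countType} (a : V -> \bar R) :
  (forall v, (0 <= a v)%E) ->
  \esum_(v in setT) a v = (\sum_(n <oo) oapp a 0 (@pickle_inv V n))%E.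
Proof.
move=> a0; have b0 n : (0 <= oapp a 0 (@pickle_inv V n))%E by case: pickle_inv => /=.
rewrite nneseries_esumT//.
pose b n : \bar R := oapp a 0%E (@pickle_inv V n).
have bij : set_bij [set: V] (range (@pickle V)) (@pickle V).
  split => [v _|v w _ _|_ [v _ <-]]; [by exists v| |by exists v].
  exact: (pcan_inj (@pickleK_inv V)).
transitivity (\esum_(n in range (@pickle V)) b n).
  rewrite (reindex_esum _ _ _ b bij); apply: eq_esum => v _.
  by rewrite /b pickleK_inv.
rewrite esum_mkcond; apply: eq_esum => n _; case: ifPn => //.
rewrite notin_setE => nr; case E1 : (@pickle_inv V n) => [v|//].
by exfalso; apply: nr; exists v => //; have := @pickle_invK V n; rewrite E1.
Qed.

Section Discrete.
Context {dV} {V : measurableType dV}.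
Hypotheses (cV : countable [set: V]) (mV : forall A : set V, measurable A).

Lemma measurable_fun_discrete d (T : measurableType d) d' (Y : measurableType d')
    (f : T * V -> Y) :
  (forall v, measurable_fun setT (fun x => f (x, v))) -> measurable_fun setT f.
Proof.
move=> mf _ A mA; rewrite setTI.
have -> : f @^-1` A = \bigcup_(v in [set: V]) ((fun x => f (x, v)) @^-1` A `*` [set v]).
  apply/seteqP; split => -[x v] /=; first by move=> Afv; exists v.
  by move=> [v' _ [/= h ->]].
apply: countable_bigcupT_measurable => // v.
by apply: measurableX => //; exact: measurable_preimageT.
Qed.

Lemma measurable_discrete d' (Y : measurableType d') (f : V -> Y) : measurable_fun setT f.
Proof. by move=> _ A mA; rewrite setTI. Qed.

End Discrete.

Lemma measurable_nat_vector d (A : set (d.-tuple nat)) : measurable A.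
Proof.
apply: countable_measurable => [v|]; last exact: countableP.
rewrite (_ : [set v] = \bigcap_(i in [set: 'I_d]) ((@tnth _ nat)^~ i @^-1` [set tnth v i])).
  apply: fin_bigcap_measurable => // i _; apply: measurable_preimageT => //.
  exact: measurable_tnth.
apply/seteqP; split => w /=; first by move=> -> i _.
by move=> h; apply: eq_from_tnth => i; exact: h.
Qed.
Section RestrictedMeasures.
Context {R : realType} {d} {T : measurableType d}.
Local Open Scope ereal_scope.

Lemma ge0_integral_mrestr (m : {measure set T -> \bar R}) (D : set T) (mD : measurable D)
    (f : T -> \bar R) :
  measurable_fun setT f -> (forall x, 0 <= f x) ->
  \int[mrestr m mD]_x f x = \int[m]_(x in D) f x.
Proof.
move=> mf f0; have mDC : measurable (~` D) by exact: measurableC.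
rewrite -(setUv D) ge0_integral_setU//; last 2 first.
  by rewrite setUv.
  by rewrite disj_set2E setICr.
rewrite [X in _ + X](_ : _ = 0) ?adde0.
  apply: eq_measure_integral => A mA AD.
  by rewrite -[LHS]/(m (A `&` D)) setIidl.
apply: null_set_integral => //.
  exact: measurable_funTS.
by rewrite -[LHS]/(m (~` D `&` D)) setICl measure0.
Qed.

End RestrictedMeasures.

Section SemiMarkovKernel.
Context {R : realType} {dX} {X : measurableType dX} {d : nat}.
Variable q : d.-tuple nat -> R.-ker X ~> X.
Local Open Scope ereal_scope.

Let mslice (D : set (X * d.-tuple nat)) k : measurable D -> measurable [set y | D (y, k)].
Proof.
move=> mD; rewrite -[X in measurable X]/((fun y => (y, k)) @^-1` D).
by apply: measurable_preimageT => //; exact: pair2_measurable.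
Qed.

Let kerQ0 x : kerQ q x set0 = 0.
Proof.
rewrite /kerQ esum1// => k _.
by rewrite (_ : [set _ | _] = set0) ?measure0//; apply/seteqP; split.
Qed.

Let kerQ_ge0 x D : 0 <= kerQ q x D.
Proof. by apply: esum_ge0 => k _; exact: measure_ge0. Qed.

Let kerQ_sigma_additive x : semi_sigma_additive (kerQ q x).
Proof.
move=> F mF tF mUF.
suff -> : kerQ q x (\bigcup_n F n) = \sum_(n <oo) kerQ q x (F n).
  by apply: is_cvg_nneseries => n _ _; exact: kerQ_ge0.
rewrite nneseries_esumT//.
rewrite /kerQ.
transitivity (\esum_(k in setT) \esum_(n in setT) q k x [set y | F n (y, k)]).
  apply: eq_esum => k _; rewrite -nneseries_esumT//.
  rewrite -(measure_semi_bigcup (q k x)).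
  - by congr (q k x _); apply/seteqP; split => y [n]; exists n.
  - by move=> n; exact: mslice.
  - apply/trivIsetP => i j _ _ ij; apply/seteqP; split => y //= [Fi Fj].
    have Fij := (trivIsetP.1 tF) i j I I ij.
    by rewrite -[False]/(set0 (y, k)) -Fij.
  - rewrite (_ : \bigcup_n _ = [set y | (\bigcup_n F n) (y, k)]); first exact: mslice.
    by apply/seteqP; split => y [n]; exists n.
rewrite !esum_esum; [|by move=> *; exact: measure_ge0..].
have bij : set_bij ([set: nat] `*`` (fun=> [set: d.-tuple nat]))
    ([set: d.-tuple nat] `*`` (fun=> [set: nat])) (fun z => (z.2, z.1)).
  split => //; first by move=> [? ?] [? ?] _ _ /= [-> ->].
  by move=> [k n] _; exists (n, k).
by rewrite (reindex_esum _ _ _ _ bij).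
Qed.

HB.instance Definition _ x := isMeasure.Build _ _ _ (kerQ q x)
  (kerQ0 x) (@kerQ_ge0 x) (@kerQ_sigma_additive x).

Lemma measurable_kerQ D : measurable D -> measurable_fun setT (kerQ q ^~ D).
Proof.
move=> mD; rewrite /kerQ.
under eq_fun do rewrite esum_pickle//.
apply: ge0_emeasurable_sum => [n x _ _|n _].
  by case: pickle_inv => //= k; exact: measure_ge0.
case: pickle_inv => [k|] /=; last exact: measurable_cst.
by apply: measurable_kernel; exact: mslice.
Qed.

Lemma kerP_kerQ x A : kerP q x A = kerQ q x (A `*` setT).
Proof.
apply: eq_esum => k _; congr (q k x _).
by apply/seteqP; split => y //= [].
Qed.

End SemiMarkovKernel.

Section SplitKernel.
Context {R : realType} {dX} {X : measurableType dX} {d : nat}.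
Variable q : d.-tuple nat -> R.-ker X ~> X.
Hypothesis q_strict : strict_semi_markov q.
Variables (C : set X) (eps : R) (theta : probability (X * d.-tuple nat)%type R).
Hypotheses (mC : measurable C) (eps_01 : 0 < eps <= 1) (Q_minor : minorized q C eps theta).
Local Open Scope ereal_scope.

Lemma kerQ_setT x : kerQ q x setT = 1.
Proof. by have [h _] := q_strict; rewrite -(h x). Qed.

Lemma kerQ_fin x D : measurable D -> kerQ q x D \is a fin_num.
Proof.
move=> mD; rewrite ge0_fin_numE//.
by rewrite (@le_lt_trans _ _ 1)// ?ltry// -(kerQ_setT x) le_measure// inE.
Qed.

Local Notation sl := (split_law q C eps theta).

Lemma split_law_ge0 xb D : measurable D -> 0 <= sl xb D.
Proof.
move=> mD; rewrite /split_law; case: ifP => // _; case: ifP => // xC.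
rewrite mule_ge0//; first by rewrite lee_fin invr_ge0 subr_ge0; case/andP: eps_01.
by rewrite sube_ge0 ?fin_numM ?fin_num_measure//; apply: Q_minor => //; exact: set_mem.
Qed.

Lemma split_law0 xb : sl xb set0 = 0.
Proof.
rewrite /split_law !measure0; case: ifP => // _; case: ifP => // _.
by rewrite mule0 sube0 mule0.
Qed.

(* For [eps = 1] the factor [(1 - eps)^-1] in [split_law] is 0, which is harmless:
   minorization then forces [kerQ q x = theta]. *)
Lemma kerQ_split x D : C x -> measurable D ->
  kerQ q x D = (1 - eps)%:E * sl (x, false) D + eps%:E * theta D.
Proof.
move=> Cx mD; rewrite /split_law/= mem_set//.
have [e1|e1] := eqVneq eps 1%R.
  rewrite {1}e1 subrr mul0e add0e; apply/eqP; rewrite eq_le Q_minor// andbT.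
  have tot : kerQ q x D + kerQ q x (~` D) = 1.
    by rewrite -(kerQ_setT x) -(setUv D) measureU//; [exact: measurableC|exact: setICr].
  have := Q_minor Cx (measurableC mD); move: tot.
  rewrite e1 !mul1e probability_setC//.
  rewrite -(fineK (fin_num_measure theta _ mD)) -(fineK (kerQ_fin x mD)).
  rewrite -(fineK (kerQ_fin x (measurableC mD))).
  move: (fine (theta D)) (fine (kerQ q x D)) (fine (kerQ q x _)) => t a b.
  by move=> -[] h1; rewrite -EFinB !lee_fin => h2; lra.
have ne : (1 - eps)%R != 0%R by rewrite subr_eq0 eq_sym.
rewrite muleA -EFinM divff// mul1e subeK// fin_numM// fin_num_measure//.
Qed.

Lemma measurable_split_law b D : measurable D -> measurable_fun setT (fun x => sl (x, b) D).
Proof.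
move=> mD; rewrite /split_law/=; case: b => //=.
apply: measurable_fun_ifT => //.
- by apply: (measurable_fun_bool true); rewrite setTI (_ : _ @^-1` _ = C)//;
    apply/seteqP; split => x /=; [exact: set_mem|exact: mem_set].
- apply: measurable_funeM; apply: emeasurable_funB => //; exact: measurable_kerQ.
- exact: measurable_kerQ.
Qed.

End SplitKernel.

Section SplitChain.
Context {R : realType} {dX} {X : measurableType dX} {d : nat}.
Variable q : d.-tuple nat -> R.-ker X ~> X.
Hypothesis q_strict : strict_semi_markov q.
Variables (C : set X) (eps : R) (theta : probability (X * d.-tuple nat)%type R).
Hypotheses (mC : measurable C) (eps_01 : 0 < eps <= 1) (Q_minor : minorized q C eps theta).
Local Open Scope ereal_scope.

Local Notation E := (X * bool * d.-tuple nat)%type.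
Local Notation sl := (split_law q C eps theta).

Lemma vadd0l (v : d.-tuple nat) : vadd (vec0 d) v = v.
Proof. by apply: eq_from_tnth => i; rewrite !tnth_mktuple. Qed.

Lemma vadd_subl (v w : d.-tuple nat) : vsub (vadd v w) v = w.
Proof. by apply: eq_from_tnth => i; rewrite !tnth_mktuple addKn. Qed.

Lemma vle_vadd (v w : d.-tuple nat) : vle v (vadd v w).
Proof. by apply/forallP => i; rewrite tnth_mktuple leq_addr. Qed.

(* Kernel of the state, coin and last increment: the total increment is forgotten. *)
Definition step_kernel (e : E) (A : set E) : \bar R :=
  split_kernel q C eps theta (e.1, vec0 d) A.

Let slice (A : set E) b (v : d.-tuple nat) : set (X * d.-tuple nat) :=
  [set yk | A (yk.1, b, vadd v yk.2)].

Let mslice A b v : measurable A -> measurable (slice A b v).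
Proof.
move=> mA; rewrite -[slice A b v]/((fun yk => (yk.1, b, vadd v yk.2)) @^-1` A).
apply: measurable_preimageT => //; apply: measurable_fun_pair.
  by apply: measurable_fun_pair => //; exact: measurable_cst.
apply: (measurableT_comp (f := fun u => vadd v u)) => //.
by apply: measurable_discrete => ?; exact: measurable_nat_vector.
Qed.

Let mCN : measurable [set yk : X * d.-tuple nat | C yk.1].
Proof. by rewrite -[X in measurable X]/(fst @^-1` C); exact: measurable_preimageT. Qed.

Lemma step_kernel_ge0 e A : measurable A -> 0 <= step_kernel e A.
Proof.
move=> mA; have /andP[e0 e1] := eps_01.
have m b := mslice b (vec0 d) mA.
rewrite /step_kernel /split_kernel/=; apply: adde_ge0; first apply: adde_ge0.
- by apply: mule_ge0; [rewrite lee_fin ltW|apply: split_law_ge0 => //; apply: measurableI => //; exact: m].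
- by apply: mule_ge0; [rewrite lee_fin subr_ge0|apply: split_law_ge0 => //; apply: measurableI => //; exact: m].
- by apply: split_law_ge0 => //; apply: measurableD => //; exact: m.
Qed.

Lemma measurable_step_kernel A : measurable A -> measurable_fun setT (step_kernel ^~ A).
Proof.
move=> mA; have m b := mslice b (vec0 d) mA.
have msl D : measurable D -> measurable_fun setT (fun e : E => sl e.1 D).
  move=> mD; apply: (measurableT_comp (f := fun xb => sl xb D)) => //.
  by apply: measurable_fun_discrete => // [|b]; [exact: countableP|exact: measurable_split_law].
rewrite /step_kernel /split_kernel/=.
apply: emeasurable_funD; first apply: emeasurable_funD.
- by apply: measurable_funeM; apply: msl; apply: measurableI => //; exact: m.
- by apply: measurable_funeM; apply: msl; apply: measurableI => //; exact: m.
- by apply: msl; apply: measurableD => //; exact: m.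
Qed.

Lemma step_kernel_atom (e e' : E) A : e.1.2 -> e'.1.2 -> step_kernel e A = step_kernel e' A.
Proof. by rewrite /step_kernel /split_kernel /split_law/= => -> ->. Qed.

(** The kernel is translation invariant in the total increment, hence the last increment together
    with state and coin evolves by [step_kernel]. *)
Lemma split_kernel_incr z A :
  split_kernel q C eps theta z [set e | A (e.1, vsub e.2 z.2)] = step_kernel z A.
Proof.
rewrite /step_kernel /split_kernel/=.
have H b : [set yk : X * d.-tuple nat | A (yk.1, b, vsub (vadd z.2 yk.2) z.2)] =
    [set yk | A (yk.1, b, vadd (vec0 d) yk.2)].
  by apply/seteqP; split => yk /=; rewrite vadd_subl vadd0l.
by rewrite !H.
Qed.

Lemma split_kernel_set0 z (A : set E) :
  (forall y b k, ~ A (y, b, vadd z.2 k)) -> split_kernel q C eps theta z A = 0.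
Proof.
move=> nA; rewrite /split_kernel.
have H b : [set yk : X * d.-tuple nat | A (yk.1, b, vadd z.2 yk.2)] = set0.
  by apply/seteqP; split => // yk /= /nA.
by rewrite !H set0I set0D split_law0 !mule0 !add0e.
Qed.

Lemma split_kernel_atom0 z (A : set E) : (forall y b k, A (y, b, k) -> b /\ ~ C y) ->
  split_kernel q C eps theta z A = 0.
Proof.
move=> nA; rewrite /split_kernel.
have H D : D `<=` set0 -> sl z.1 D = 0 by rewrite subset0 => ->; exact: split_law0.
rewrite H => [|yk /= [/nA[_ //]]]; rewrite H => [|yk /= [/nA[//]]].
by rewrite H => [|yk /= [/nA[//]]]; rewrite !mule0 !add0e.
Qed.

Context {dO} {Om : measurableType dO} (Pa : probability Om R) (pi : probability X R).
Variable Z : nat -> Om -> E.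
Hypothesis C_pos : 0 < pi C.
Hypothesis Z_split : markov_chain Pa Z (atom_init C pi) (split_kernel q C eps theta).
Variable x0 : X.

Definition last_step (n : nat) (w : Om) : E := ((Z n w).1, incr Z n w).

(** Entries start at time 1: the state at time 0 is random within [C], but with coin 1 it acts on
    the next step like any other point of the atom. *)
Definition step_path (w : Om) : path_space E := fun n => last_step n.+1 w.

Definition atom_step : E := (x0, true, vec0 d).

Let mZ n : measurable_fun setT (Z n). Proof. by case: Z_split. Qed.

Let hist n := g_sigma_algebraType [set B | exists i A,
  [/\ (i <= n)%N, measurable A & B = Z i @^-1` A]].

Let measurable_hist n i : (i <= n)%N -> measurable_fun setT (fun w : hist n => Z i w).
Proof. by move=> ni _ A mA; rewrite setTI; apply: sub_sigma_algebra; exists i, A. Qed.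

Let measurable_pair_last_step :
  measurable_fun setT (fun z : E * E => (z.2.1, vsub z.2.2 z.1.2)).
Proof.
apply: measurable_fun_pair; first exact: (measurableT_comp measurable_fst measurable_snd).
apply: (measurableT_comp (f := fun u : (d.-tuple nat) * (d.-tuple nat) => vsub u.1 u.2)
  (g := fun z : E * E => (z.2.2, z.1.2))).
  apply: measurable_fun_discrete => [|?|v]; [exact: countableP|exact: measurable_nat_vector|].
  by apply: measurable_discrete => ?; exact: measurable_nat_vector.
apply: measurable_fun_pair; first exact: (measurableT_comp measurable_snd measurable_snd).
exact: (measurableT_comp measurable_snd measurable_fst).
Qed.

Lemma measurable_last_step n : measurable_fun setT (last_step n).
Proof.
apply: (measurableT_comp (f := fun z : E * E => (z.2.1, vsub z.2.2 z.1.2))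
  (g := fun w => (Z n.-1 w, Z n w))); first exact: measurable_pair_last_step.
exact: measurable_fun_pair.
Qed.

Lemma measurable_step_path : measurable_fun setT step_path.
Proof. by apply: measurable_to_path => i; exact: measurable_last_step. Qed.

Lemma history_step_path n (B : set (nat -> E)) : past n B -> history Z n (step_path @^-1` B).
Proof.
move=> pB; suff m : measurable_fun setT (step_path : hist n -> past_space E n).
  by have := m measurableT B pB; rewrite setTI.
apply: (@measurability _ _ _ (past_space E n) setT _ (past_cylinders n)) => //.
move=> _ [_ [i [A [iltn mA ->]]] <-].
have mi : measurable_fun setT (fun w : hist n => (Z i w, Z i.+1 w)).
  by apply: measurable_fun_pair; apply: measurable_hist => //; exact: ltnW.
exact: (measurableT_comp measurable_pair_last_step mi).
Qed.

Lemma history_measurable n B : history Z n B -> measurable B.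
Proof.
move: B; apply: smallest_sub; first exact: sigma_algebra_measurable.
by move=> _ [i [A [_ mA ->]]]; apply: measurable_preimageT.
Qed.

(** On the event that the total increment at time [n] equals [v], a condition on the last increment
    is one on [Z n.+1]. The countably many values of [v] are enumerated by their codes. *)
Lemma last_step_chain n A B : measurable A -> history Z n B ->
  Pa (B `&` last_step n.+1 @^-1` A) = \int[Pa]_(w in B) step_kernel (Z n w) A.
Proof.
move=> mA hB.
pose Bm m := B `&` [set w | pickle (Z n w).2 = m].
have hBm m : history Z n (Bm m).
  apply: (@measurableI _ (hist n)) => //.
  rewrite -[X in measurable X]/((fun w : hist n => Z n w) @^-1` [set z | pickle z.2 = m]).
  apply: measurable_preimageT; first exact: measurable_hist.
  rewrite -[X in measurable X]/(snd @^-1` [set v | pickle v = m]).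
  by apply: measurable_preimageT => //; exact: measurable_nat_vector.
have BE : B = \bigcup_m Bm m.
  by apply/seteqP; split => [w Bw|w [m _ []]//]; exists (pickle (Z n w).2).
have tB : trivIset setT Bm.
  by apply/trivIsetP => i j _ _ ij; apply/seteqP; split => // w [[_ wi] [_ wj]];
    move: ij; rewrite -wi -wj eqxx.
have mAl : measurable (last_step n.+1 @^-1` A).
  by apply: measurable_preimageT => //; exact: measurable_last_step.
have mBm m : measurable (Bm m) by exact: history_measurable (hBm m).
have mk : measurable_fun setT (fun w => step_kernel (Z n w) A).
  exact: (measurableT_comp (measurable_step_kernel mA) (mZ n)).
rewrite {1}BE setI_bigcupl measure_semi_bigcup; last 3 first.
- by move=> m; exact: measurableI.
- apply/trivIsetP => i j _ _ ij; apply/seteqP; split => // w [[wi _] [wj _]].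
  by rewrite -(trivIsetP.1 tB i j I I ij).
- by apply: bigcupT_measurable => m; exact: measurableI.
rewrite BE ge0_integral_bigcup//; last 2 first.
- exact: measurable_funTS.
- by move=> w _; exact: step_kernel_ge0.
apply: eq_eseriesr => m _.
(* If [m] codes no vector, the event [Bm m] is empty. *)
have [[v vm]|nv] := pselect (exists v : d.-tuple nat, pickle v = m); last first.
  have -> : Bm m = set0.
    by apply/seteqP; split => // w [_ wm]; apply: nv; exists (Z n w).2.
  by rewrite set0I measure0 integral_set0.
have [_ _ Zchain] := Z_split.
pose Av := [set e : E | A (e.1, vsub e.2 v)].
have mAv : measurable Av.
  rewrite -[Av]/((fun e : E => (e.1, vsub e.2 v)) @^-1` A).
  apply: measurable_preimageT => //; apply: measurable_fun_pair => //.
  apply: (measurableT_comp (f := fun u => vsub u v)) => //.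
  by apply: measurable_discrete => ?; exact: measurable_nat_vector.
have Bv w : Bm m w -> (Z n w).2 = v.
  by move=> [_ /= wm]; apply: (pcan_inj (@pickleK _)); rewrite wm vm.
rewrite (_ : Bm m `&` _ = Bm m `&` Z n.+1 @^-1` Av); last first.
  by apply/seteqP; split => w [Bw Aw]; split => //; move: Aw;
    rewrite /= /Av /last_step /incr /S_ /= (Bv w Bw).
transitivity (\int[Pa]_(w in Bm m) split_kernel q C eps theta (Z n w) Av).
  exact: Zchain.
apply: eq_integral => w; rewrite inE => /Bv wv.
by rewrite -split_kernel_incr wv.
Qed.

Lemma start_ae : {ae Pa, forall w, [/\ C (Z 0%N w).1.1, (Z 0%N w).1.2 & (Z 0%N w).2 = vec0 d]}.
Proof.
pose D := [set e : E | [/\ C e.1.1, e.1.2 & e.2 = vec0 d]].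
have mD : measurable D.
  have -> : D = (C `*` [set true]) `*` [set vec0 d].
    by apply/seteqP; split => -[[x b] v]; [move=> [/= ? -> ->]|move=> [[/= ? ->] ->]].
  by apply: measurableX; [exact: measurableX|exact: measurable_nat_vector].
have mDC := measurableC mD.
exists (Z 0%N @^-1` (~` D)); split.
- exact: measurable_preimageT.
- have [_ -> //] := Z_split; rewrite /atom_init (_ : _ `&` _ = set0) ?measure0 ?mule0//.
  by apply/seteqP; split => // x /= [h Cx]; apply: h; split.
- by move=> w h Dw; apply: h.
Qed.

(** Makes the truncated subtraction in [incr] exact. *)
Lemma increasing_ae n : {ae Pa, forall w, vle (Z n w).2 (Z n.+1 w).2}.
Proof.
have [_ _ Zchain] := Z_split.
have msnd (V : set (d.-tuple nat)) : measurable [set e : E | V e.2].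
  rewrite -[X in measurable X]/(snd @^-1` V).
  by apply: measurable_preimageT => //; exact: measurable_nat_vector.
pose Bv v := Z n @^-1` [set e | e.2 = v] `&` Z n.+1 @^-1` [set e | ~ vle v e.2].
apply: (@negligibleS _ _ _ _ (\bigcup_m (if unpickle m is Some v then Bv v else set0))).
  move=> w /= nv; exists (pickle (Z n w).2) => //.
  by rewrite pickleK.
apply: negligible_bigcup => m; case: unpickle => [v|]; last exact: negligible_set0.
have hv : history Z n (Z n @^-1` [set e | e.2 = v]).
  apply: sub_sigma_algebra; exists n, [set e | e.2 = v]; split => //.
  exact: (msnd [set v]).
have mB : measurable (Bv v).
  apply: measurableI; apply: measurable_preimageT => //; first exact: (msnd [set v]).
  exact: (msnd [set u | ~ vle v u]).
exists (Bv v); split => //.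
transitivity (\int[Pa]_(w in Z n @^-1` [set e | e.2 = v])
    split_kernel q C eps theta (Z n w) [set e | ~ vle v e.2]).
  by apply: Zchain => //; exact: (msnd [set u | ~ vle v u]).
apply: integral0_eq => w /= wv.
by apply: split_kernel_set0 => y b k; rewrite wv /=; apply; exact: vle_vadd.
Qed.

(** Lets the coin alone tell the visits to the atom. *)
Lemma coin_ae n : {ae Pa, forall w, (Z n.+1 w).1.2 -> C (Z n.+1 w).1.1}.
Proof.
have [_ _ Zchain] := Z_split.
pose A := [set e : E | e.1.2 /\ ~ C e.1.1].
have mA : measurable A.
  have -> : A = (~` C `*` [set true]) `*` setT.
    by apply/seteqP; split => -[[x b] v] /=; rewrite /A/=; [move=> [-> ?]|move=> [[? ->] _]].
  by apply: measurableX => //; apply: measurableX => //; exact: measurableC.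
exists (Z n.+1 @^-1` A); split; first exact: measurable_preimageT.
- rewrite -[X in Pa X]setTI Zchain//; last exact: (@measurableT _ (hist n)).
  by apply: integral0_eq => w _; apply: split_kernel_atom0 => y b k [].
- by move=> w /= h; apply: contrapT => nA; apply: h => c; apply: contrapT => nC; apply: nA.
Qed.

Definition path_law : probability (path_space E) R :=
  distribution Pa (mfun_Sub (mem_set measurable_step_path)).

Lemma path_lawE A : path_law A = Pa (step_path @^-1` A).
Proof. by []. Qed.

Lemma path_law_chain n A B : measurable A -> past n B ->
  path_law (B `&` [set y | A (y n)]) =
  \int[path_law]_(y in B) step_kernel (state_at atom_step y n) A.
Proof.
move=> mA pB; have mB := past_measurable pB.
have mf : measurable_fun setT (fun y : path_space E => step_kernel (state_at atom_step y n) A).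
  apply: (measurableT_comp (measurable_step_kernel mA)).
  by case: n {pB} => [|n]; [exact: measurable_cst|exact: measurable_coord].
rewrite ge0_integral_pushforward//; last 2 first.
- exact: measurable_funTS.
- by move=> y _; exact: step_kernel_ge0.
rewrite path_lawE preimage_setI -[X in _ `&` X]/(last_step n.+1 @^-1` A).
have hB := history_step_path pB; rewrite last_step_chain//.
have mpB := history_measurable hB.
apply: ge0_ae_eq_integral => //.
- by apply: measurable_funTS; exact: (measurableT_comp (measurable_step_kernel mA) (mZ n)).
- apply: measurable_funTS; exact: (measurableT_comp mf measurable_step_path).
- by move=> w _; exact: step_kernel_ge0.
- by move=> w _; exact: step_kernel_ge0.
(* At time 0 the actual state and [atom_step] may differ as points, but both have coin 1, and from
   there the kernel ignores the point. *)
- apply: filterS start_ae => w [C0 b0 s0] _ /=.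
  by case: n {pB mf hB} => [|n] //=; exact: step_kernel_atom.
Qed.

End SplitChain.

(** * Return to the atom *)

Section RestrictedImage.
Context {R : realType} {d} {T : measurableType d} {d'} {T' : measurableType d'}.
Variables (m : {measure set T -> \bar R}) (D : set T) (mD : measurable D).
Variables (F : T -> T') (mF : measurable_fun setT F).
Local Open Scope ereal_scope.

Definition restricted_image : {measure set T' -> \bar R}.
Proof.
by refine [the measure _ _ of pushforward (mrestr m mD) F].
Defined.

Lemma restricted_imageE A : restricted_image A = m (F @^-1` A `&` D).
Proof. by []. Qed.

Lemma ge0_integral_restricted_image (f : T' -> \bar R) :
  measurable_fun setT f -> (forall x, 0 <= f x) ->
  \int[restricted_image]_x f x = \int[m]_(x in D) f (F x).
Proof.
move=> mf f0; rewrite ge0_integral_pushforward// preimage_setT ge0_integral_mrestr//.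
  exact: measurableT_comp.
by move=> x; exact: f0.
Qed.

End RestrictedImage.

Section Thinning.
Context {R : realType} {dX} {X : measurableType dX} {d : nat}.
Variable q : d.-tuple nat -> R.-ker X ~> X.
Hypothesis q_strict : strict_semi_markov q.
Variables (C : set X) (eps : R) (theta : probability (X * d.-tuple nat)%type R).
Hypotheses (mC : measurable C) (eps_01 : 0 < eps <= 1) (Q_minor : minorized q C eps theta).
Local Open Scope ereal_scope.

Local Notation E := (X * bool * d.-tuple nat)%type.
Local Notation sl := (split_law q C eps theta).

Let eps1 : (0 <= 1 - eps)%R. Proof. by rewrite subr_ge0; case/andP: eps_01. Qed.

(* Part of the mass of [l] that does not go to the atom. *)
Definition thinned (l : {measure set X -> \bar R}) : {measure set X -> \bar R} :=
  measure_add (mscale (NngNum eps1) (mrestr l mC)) (mrestr l (measurableC mC)).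

Lemma thinnedE l A : thinned l A = (1 - eps)%:E * l (A `&` C) + l (A `&` ~` C).
Proof. exact: measure_addE. Qed.

Lemma ge0_integral_thinned l f : measurable_fun setT f -> (forall x, 0 <= f x) ->
  \int[thinned l]_x f x = (1 - eps)%:E * \int[l]_(x in C) f x + \int[l]_(x in ~` C) f x.
Proof.
move=> mf f0; rewrite ge0_integral_measure_add// ge0_integral_mscale//.
by rewrite !ge0_integral_mrestr.
Qed.

(** From a state with law [l] whose coin is tossed, the next pair has law [theta] with mass
    [eps l(C)] and is otherwise drawn from the residual kernel; the splitting is designed so that
    the mixture is [kerQ]. *)
Lemma integral_split_law_thinned (l : {measure set X -> \bar R}) B : measurable B ->
  eps%:E * l C * theta B + \int[thinned l]_x sl (x, false) B = \int[l]_x kerQ q x B.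
Proof.
move=> mB; have s0 x : 0 <= sl (x, false) B by apply: split_law_ge0.
have ms : measurable_fun setT (fun x => sl (x, false) B) by exact: measurable_split_law.
have mCC := measurableC mC.
rewrite ge0_integral_thinned// -[in RHS](setUv C) ge0_integral_setU//; last 2 first.
- by rewrite setUv; exact: measurable_kerQ.
- by rewrite disj_set2E setICr.
rewrite addeA; congr (_ + _); last first.
  apply: eq_integral => x; rewrite inE => nC; rewrite /split_law/=.
  by case: ifP => // /set_mem.
under [RHS]eq_integral => x xC.
  rewrite (kerQ_split q_strict Q_minor (set_mem xC) mB); over.
have e0 : (0 <= eps)%R by case/andP: eps_01 => /ltW.
rewrite ge0_integralD//.
- rewrite ge0_integralZl_EFin//; last exact: measurable_funTS.
  by rewrite integral_cst// addeC muleAC.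
- by move=> x _; apply: mule_ge0 => //; rewrite lee_fin.
- by apply: measurable_funeM; exact: measurable_funTS.
- by move=> x _; apply: mule_ge0 => //; rewrite lee_fin.
Qed.

(** Kernel of the chain killed at the atom: the next state lies in [A] and its coin is 0. *)
Definition step_free (e : E) (A : set X) : \bar R :=
  (1 - eps)%:E * sl e.1 ((A `&` C) `*` setT) + sl e.1 ((A `&` ~` C) `*` setT).

Lemma step_kernel_free e A :
  step_kernel q C eps theta e [set e' | ~~ e'.1.2 /\ A e'.1.1] = step_free e A.
Proof.
rewrite /step_kernel /split_kernel /step_free.
rewrite (_ : _ `&` _ = set0); last by apply/seteqP; split => // yk [[]].
rewrite split_law0 mule0 add0e; congr (_ * sl _ _ + sl _ _); apply/seteqP; split => yk /=.
- by move=> [[_ ?] ?].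
- by move=> [[? ?] _].
- by move=> [[_ ?] ?].
- by move=> [[? ?] _].
Qed.

Lemma step_free_ge0 e A : measurable A -> 0 <= step_free e A.
Proof.
move=> mA; have mCC := measurableC mC.
apply: adde_ge0; first apply: mule_ge0; rewrite ?lee_fin//; apply: split_law_ge0 => //;
  by apply: measurableX => //; exact: measurableI.
Qed.

Lemma measurable_step_free A b v : measurable A ->
  measurable_fun setT (fun x => step_free (x, b, v) A).
Proof.
move=> mA; have mCC := measurableC mC.
apply: emeasurable_funD; first apply: measurable_funeM; apply: measurable_split_law => //;
  by apply: measurableX => //; exact: measurableI.
Qed.

Variables (pi : probability X R) (x0 : X) (mu : probability (path_space E) R).
Hypothesis pi_inv : Defs.invariant (kerP q) pi.
Hypothesis C_pos : 0 < pi C.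
Hypothesis chain : forall n A B, measurable A -> past n B ->
  mu (B `&` [set y | A (y n)]) =
  \int[mu]_(y in B) step_kernel q C eps theta (state_at (atom_step x0) y n) A.

Let atom (e : E) : bool := e.1.2.

Let free n : set (path_space E) := [set y | forall i, (i < n.+1)%N -> [set e | ~~ atom e] (y i)].

Let matom : measurable [set e : E | ~~ atom e].
Proof.
have -> : [set e : E | ~~ atom e] = (fun e => e.1.2) @^-1` [set false].
  by apply/seteqP; split => e /=; rewrite /atom; case: (e.1.2).
by apply: measurable_preimageT => //; exact: (measurableT_comp measurable_snd measurable_fst).
Qed.

Let past_free n : past n.+1 (free n).
Proof. by apply: (@past_all _ _ _ n.+1 0 (fun=> [set e | ~~ atom e])). Qed.

Let J n (y : path_space E) : X := (y n).1.1.

Let mJ n : measurable_fun setT (J n).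
Proof.
apply: (measurableT_comp (f := fun e : E => e.1.1)); last exact: measurable_coord.
exact: (measurableT_comp measurable_fst measurable_fst).
Qed.

Let mfree n : measurable (free n). Proof. by apply: (@past_measurable _ _ n.+1); exact: past_free. Qed.

(** Law of the state at time [n.+1] on the event that the atom has not been visited at the times
    from 1 to [n.+1]; not normalized. *)
Let alpha n := restricted_image mu (mfree n) (mJ n).

Let mfreestep A : measurable A -> measurable [set e : E | ~~ e.1.2 /\ A e.1.1].
Proof.
move=> mA; have -> : [set e : E | ~~ e.1.2 /\ A e.1.1] =
    [set e | ~~ atom e] `&` (fun e => e.1.1) @^-1` A by [].
apply: measurableI => //; apply: measurable_preimageT => //.
exact: (measurableT_comp measurable_fst measurable_fst).
Qed.

Let alpha0 A : measurable A -> alpha 0 A = step_free (atom_step x0) A.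
Proof.
move=> mA; rewrite -step_kernel_free.
transitivity (mu (setT `&` [set y | [set e : E | ~~ e.1.2 /\ A e.1.1] (y 0%N)])).
  congr (mu _); apply/seteqP; split => y /=.
    by move=> [Ay /(_ 0%N isT)].
  by move=> [_ [h Ay]]; split => // -[].
rewrite chain//; [|exact: mfreestep|exact: pastT].
transitivity (\int[mu]_(y in setT) cst (step_kernel q C eps theta (atom_step x0)
   [set e' : E | ~~ e'.1.2 /\ A e'.1.1]) y); first exact: eq_integral.
by rewrite integral_cst// (_ : _ setT = 1) ?mule1//; exact: probability_setT.
Qed.

Let alphaS n A : measurable A ->
  alpha n.+1 A = \int[alpha n]_x step_free (x, false, vec0 d) A.
Proof.
move=> mA.
transitivity (mu (free n `&` [set y | [set e : E | ~~ e.1.2 /\ A e.1.1] (y n.+1)])).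
  congr (mu _); apply/seteqP; split => y /=.
    move=> [Ay h]; split => [i ni|]; first by apply: h; exact: ltnW.
    by split => //; exact: (h n.+1 (ltnSn _)).
  move=> [h [h1 Ay]]; split => // i; rewrite ltnS leq_eqVlt => /orP[/eqP->//|].
  exact: h.
rewrite chain; [|exact: mfreestep|exact: past_free].
rewrite ge0_integral_restricted_image//.
- apply: eq_integral => y; rewrite inE => /(_ n (ltnSn n)) /negbTE yn.
  rewrite step_kernel_free /step_free /= /J; move: yn; rewrite /atom.
  by case: (y n) => -[x b] k /= ->.
- exact: measurable_step_free.
- by move=> x; exact: step_free_ge0.
Qed.

(** The part [thinned pi] of the invariant measure off the atom consists of what starts from the
    atom, [eps pi(C) alpha 0], and of its own image under the killed chain. Iterating this identity
    bounds the partial sums of the killed laws, as in Kac's formula. *)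
Let alpha_le n A : measurable A ->
  eps%:E * pi C * (\sum_(i < n) alpha i A) <= thinned pi A.
Proof.
have e0 : (0 <= eps)%R by case/andP: eps_01 => /ltW.
have c0 : 0 <= eps%:E * pi C by apply: mule_ge0.
have cfin : eps%:E * pi C \is a fin_num by rewrite fin_numM// fin_num_measure.
pose c : {nonneg R} := NngNum (fine_ge0 c0).
have cE : eps%:E * pi C = c%:num%:E by rewrite /= fineK.
elim: n A => [A mA|n IH A mA]; first by rewrite big_ord0 mule0 measure_ge0.
have -> : \sum_(i < n.+1) alpha i A = alpha 0 A + \sum_(i < n) alpha i.+1 A.
  by rewrite big_ord_recl.
rewrite ge0_muleDr//; last by apply: sume_ge0.
have mf : measurable_fun setT (fun x => step_free (x, false, vec0 d) A).
  exact: measurable_step_free.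
have f0 x : 0 <= step_free (x, false, vec0 d) A by exact: step_free_ge0.
have -> : eps%:E * pi C * (\sum_(i < n) alpha i.+1 A) =
    \int[mscale c (msum alpha n)]_x step_free (x, false, vec0 d) A.
  rewrite ge0_integral_mscale// ge0_integral_measure_sum// cE; congr (_ * _).
  by apply: eq_bigr => i _; rewrite alphaS.
apply: (@le_trans _ _ (eps%:E * pi C * alpha 0 A +
    \int[thinned pi]_x step_free (x, false, vec0 d) A)).
  apply: leeD2l; apply: ge0_le_measure_integral => // B mB.
  by rewrite -[leLHS]/(c%:num%:E * msum alpha n B) -cE; exact: IH.
have m1 : measurable ((A `&` C) `*` [set: d.-tuple nat]) by apply: measurableX => //; exact: measurableI.
have m2 : measurable ((A `&` ~` C) `*` [set: d.-tuple nat]).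
  by apply: measurableX => //; apply: measurableI => //; exact: measurableC.
have ms B : measurable B -> measurable_fun setT (fun x => sl (x, false) B).
  by move=> mB; exact: measurable_split_law.
have s0 B x : measurable B -> 0 <= sl (x, false) B by move=> mB; exact: split_law_ge0.
rewrite alpha0// /step_free /= ge0_integralD//.
- rewrite ge0_integralZl_EFin//; [|by move=> x _; exact: s0|exact: ms].
  rewrite ge0_muleDr ?mule_ge0//.
  rewrite (_ : sl (x0, true) = theta :> (set _ -> _))//.
  rewrite addeACA muleCA -ge0_muleDr//; last 2 first.
  - by rewrite mule_ge0.
  - by apply: integral_ge0 => x _; exact: s0.
  rewrite !integral_split_law_thinned// thinnedE.
  have P B : measurable B -> \int[pi]_x kerQ q x (B `*` setT) = pi B.
    by move=> mB; rewrite -pi_inv//; apply: eq_integral => x _; rewrite kerP_kerQ.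
  by rewrite !P//; apply: measurableI => //; exact: measurableC.
- by move=> x _; rewrite mule_ge0//; exact: s0.
- by apply: measurable_funeM; exact: ms.
- by move=> x _; exact: s0.
- exact: ms.
Qed.

(* The mass that has not yet returned is, up to a constant, summable in time. *)
Lemma split_chain_returns : mu [set y | return_time atom (atom_step x0) y = 0%N] = 0.
Proof.
set N := [set y | _].
have mN : measurable N.
  apply: measurable_return_time_eq; rewrite (_ : [set e | _] = ~` [set e | ~~ atom e]).
    exact: measurableC.
  by apply/seteqP; split => e /=; [move=> h /negP|move=> /negP; rewrite negbK].
have le n : mu N <= alpha n setT.
  rewrite restricted_imageE preimage_setT setTI; apply: le_measure; rewrite ?inE//.
  move=> y yN i _ /=; apply/negP => yi.
  by have := (return_time_gt0 atom (atom_step x0) y).2 (ex_intro _ i yi); rewrite yN.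
have cfin : eps%:E * pi C \is a fin_num by rewrite fin_numM// fin_num_measure.
have Nfin : mu N \is a fin_num by rewrite fin_num_measure.
have [e0 e1] := andP eps_01.
have cpos : (0 < fine (eps%:E * pi C))%R.
  by apply: fine_gt0; rewrite -ge0_fin_numE ?cfin ?andbT ?mule_gt0// mule_ge0// lee_fin ltW.
(* Each [alpha i] with [i < n] has at least the mass of the event of no return, so [n] times this
   mass stays bounded in [n]. *)
have bound n : (fine (eps%:E * pi C) * (n%:R * fine (mu N)) <= 1)%R.
  rewrite -lee_fin !EFinM !fineK//.
  have : thinned pi setT <= 1.
    have <- : pi C + pi (~` C) = 1.
      transitivity (pi (C `|` ~` C)); last by rewrite setUv; exact: probability_setT.
      by rewrite measureU ?setICr//; exact: measurableC.
    rewrite thinnedE !setTI.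
    rewrite leeD2r// -[leRHS]mul1e lee_wpmul2r// lee_fin.
    by rewrite lerBlDr lerDl ltW.
  apply: le_trans; apply: le_trans (alpha_le n measurableT).
  apply: lee_wpmul2l; first by rewrite mule_ge0// lee_fin ltW.
  rewrite (_ : n%:R%:E * mu N = \sum_(i < n) mu N); first exact: lee_sum.
  by rewrite -(fineK Nfin) sumEFin sumr_const card_ord -EFinM mulr_natl.
apply/eqP; rewrite eq_le measure_ge0 andbT leNgt; apply/negP => N0.
have fN : (0 < fine (mu N))%R by apply: fine_gt0; rewrite N0 ltey_eq Nfin.
have := bound (Num.truncn (fine (eps%:E * pi C) * fine (mu N))^-1).+1.
have := truncnS_gt (fine (eps%:E * pi C) * fine (mu N))^-1.
have cN : (0 < fine (eps%:E * pi C) * fine (mu N))%R by rewrite mulr_gt0.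
rewrite -(ltr_pM2l cN) mulfV ?gt_eqF//.
move: (_.+1%:R)%R => M h1 h2.
by move: h1; rewrite ltNge => /negP; apply; rewrite -mulrA [(_ * M)%R]mulrC.
Qed.

End Thinning.

(** * Absorbing sets and positivity of the mean increments *)

Section Null.
Context {R : realType} {d} {T : measurableType d}.
Local Open Scope ereal_scope.

Lemma ge0_integral_null (m : {measure set T -> \bar R}) (D : set T) (f : T -> \bar R) :
  measurable D -> measurable_fun setT f -> (forall x, 0 <= f x) ->
  \int[m]_(x in D) f x = 0 <-> m (D `&` [set x | f x != 0]) = 0.
Proof.
move=> mD mf f0; have mfD : measurable_fun D f by exact: measurable_funTS.
have mN : measurable (D `&` [set x | f x != 0]) by exact: emeasurable_neq.
have absE : \int[m]_(x in D) `|f x| = \int[m]_(x in D) f x.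
  by apply: eq_integral => x _; rewrite gee0_abs.
split=> [If|N0].
  have := (ae_eq_integral_abs m mD mfD).1; rewrite absE => /(_ If) [N [mN' N0 sub]].
  apply: (subset_measure0 mN mN' _ N0) => x [Dx /= /eqP fx]; apply: sub => /(_ Dx).
  exact: fx.
rewrite -absE; apply/(ae_eq_integral_abs m mD mfD).
exists (D `&` [set x | f x != 0]); split => // x /= /not_implyP[Dx fx].
by split => //; exact/eqP.
Qed.

Lemma measure_bigcup0 (m : {measure set T -> \bar R}) (F : nat -> set T) :
  (forall n, measurable (F n)) -> (forall n, m (F n) = 0) -> m (\bigcup_n F n) = 0.
Proof.
move=> mF F0; apply/negligibleP; first exact: bigcupT_measurable.
by apply: negligible_bigcup => n; exists (F n); split.
Qed.

End Null.

Section Absorbing.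
Context {R : realType} {dX} {X : measurableType dX} {d : nat}.
Variable q : d.-tuple nat -> R.-ker X ~> X.
Hypothesis q_strict : strict_semi_markov q.
Local Open Scope ereal_scope.

Local Notation K := (kerP q).

Lemma kerP_ge0 x A : 0 <= K x A. Proof. by rewrite kerP_kerQ. Qed.

Lemma measurable_kerP A : measurable A -> measurable_fun setT (K ^~ A).
Proof.
move=> mA; rewrite (_ : K ^~ A = fun x => kerQ q x (A `*` setT)).
  by apply: measurable_kerQ; exact: measurableX.
by apply/funext => x; rewrite kerP_kerQ.
Qed.

Let mXT (A : set X) : measurable A -> measurable (A `*` [set: d.-tuple nat]).
Proof. by move=> mA; exact: measurableX. Qed.

Lemma kerPU x A B : measurable A -> measurable B -> A `&` B = set0 ->
  K x (A `|` B) = K x A + K x B.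
Proof.
move=> mA mB AB0; rewrite !kerP_kerQ -measureU; [|exact: mXT..|].
  by congr (kerQ q x _); apply/seteqP; split => -[y k] /=; tauto.
by apply/seteqP; split => // -[y k] [[/= Ay _] [/= By _]]; rewrite -[False]/(set0 y) -AB0.
Qed.

Lemma kerP_bigcup0 x (F : nat -> set X) : (forall n, measurable (F n)) -> (forall n, K x (F n) = 0) ->
  K x (\bigcup_n F n) = 0.
Proof.
move=> mF F0; rewrite kerP_kerQ.
rewrite (_ : _ `*` _ = \bigcup_n (F n `*` setT)).
  by apply: measure_bigcup0 => n; [exact: mXT|move: (F0 n); rewrite kerP_kerQ].
by apply/seteqP; split => [[y k] [[n _ Fy] _]|[y k] [n _ [Fy _]]]; [exists n|split => //; exists n].
Qed.

Definition absorbing (A : set X) := measurable A /\ forall x, A x -> K x (~` A) = 0.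

(** States from which the current set is left with positive probability are discarded repeatedly;
    what survives all rounds cannot leave itself. *)
Fixpoint core_seq (B : set X) n : set X :=
  if n is m.+1 then core_seq B m `&` [set x | K x (~` core_seq B m) = 0] else B.

Definition core (B : set X) := \bigcap_n core_seq B n.

Lemma measurable_core_seq B n : measurable B -> measurable (core_seq B n).
Proof.
move=> mB; elim: n => //= n IH; apply: measurableI => //.
rewrite -[X in measurable X]/((K ^~ (~` core_seq B n)) @^-1` [set 0]).
by apply: measurable_preimageT => //; apply: measurable_kerP; exact: measurableC.
Qed.

Lemma absorbing_core B : measurable B -> absorbing (core B).
Proof.
move=> mB; split; first by apply: bigcapT_measurable => n; exact: measurable_core_seq.
move=> x Bx; rewrite /core setC_bigcap; apply: kerP_bigcup0 => n.
  by apply: measurableC; exact: measurable_core_seq.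
by have [] := Bx n.+1 I.
Qed.

Lemma absorbing_stays {dO} {Om : measurableType dO} (P : probability Om R) Z x A :
  absorbing A -> A x -> markov_chain P Z (fun B => \d_x B) K ->
  forall n, P (Z n @^-1` (~` A)) = 0.
Proof.
move=> [mA absA] Ax [mZ Z0 chain]; have mAC := measurableC mA.
elim=> [|n IH].
  by rewrite Z0// /dirac/= indicE memNset//= => /(_ Ax).
rewrite -[X in P X]setTI chain//; last first.
  exact: (@measurableT _ (g_sigma_algebraType [set B | exists i A0,
    [/\ (i <= n)%N, measurable A0 & B = Z i @^-1` A0]])).
apply/ge0_integral_null => //.
- by apply: (measurableT_comp (measurable_kerP mAC)).
- by move=> w; exact: kerP_ge0.
apply: (subset_measure0 _ _ _ IH).
- apply: emeasurable_neq => //.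
  by apply: (measurableT_comp (measurable_kerP mAC)).
- exact: measurable_preimageT.
- by move=> w [_ /= /eqP h] /absA.
Qed.

Lemma measurable_infinitely_often {dO} {Om : measurableType dO} (Z : nat -> Om -> X) A :
  (forall n, measurable_fun setT (Z n)) -> measurable A ->
  measurable [set w | forall n, exists2 p, (n <= p)%N & A (Z p w)].
Proof.
move=> mZ mA; have mV n : measurable (Z n @^-1` A) by exact: measurable_preimageT.
rewrite (_ : [set w | _] = \bigcap_n \bigcup_p (if (n <= p)%N then Z p @^-1` A else set0)).
  by apply: bigcapT_measurable => n; apply: bigcupT_measurable => p; case: ifP.
apply/seteqP; split => w /= h n; first by move=> _; have [p np Ap] := h n; exists p; rewrite ?np.
by have [p _] := h n I; case: ifP => // np Ap; exists p.
Qed.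

Lemma absorbing_visits_io x A : absorbing A -> A x -> ~ visits_io K x (~` A).
Proof.
move=> aA Ax [dO [Om [P [Z [mc P1]]]]].
have [mA _] := aA; have [mZ _ _] := mc; have mAC := measurableC mA.
have mV n : measurable (Z n @^-1` (~` A)) by exact: measurable_preimageT.
have U0 := measure_bigcup0 mV (absorbing_stays aA Ax mc).
have : P [set w | forall n, exists2 p, (n <= p)%N & (~` A) (Z p w)] = 0.
  apply: (subset_measure0 _ _ _ U0).
  - exact: measurable_infinitely_often.
  - exact: bigcupT_measurable.
  - by move=> w /(_ 0%N)[p _ h]; exists p.
by rewrite P1 => /eqP; rewrite eqe oner_eq0.
Qed.

Hypothesis harris : harris_recurrent K.

(** If the measure [phi] of Harris recurrence charges the complement of [A], the chain from [x]
    would have to leave [A]. Otherwise it charges [A], and the chain from [y] would have to leave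
    [B] for [A]. *)
Lemma absorbing_disjoint A B x y : absorbing A -> absorbing B -> A `&` B = set0 ->
  A x -> B y -> False.
Proof.
have [phi [phi0 phi_io]] := harris.
move=> aA aB AB0 Ax By; have [mA _] := aA.
have [phiA|] := ltP 0 (phi (~` A)).
  exact: (absorbing_visits_io aA Ax (phi_io _ (measurableC mA) phiA x)).
rewrite measure_le0 => /eqP phiA.
have phiA0 : 0 < phi A.
  by move: phi0; rewrite -(setUv A) measureU ?setICr ?phiA ?adde0//; exact: measurableC.
have [dO [Om [P [Z [mc P1]]]]] := phi_io A mA phiA0 y.
apply: (absorbing_visits_io aB By); exists dO, Om, P, Z; split => //.
have [mB _] := aB; have [mZ _ _] := mc.
have mIA := measurable_infinitely_often mZ mA.
have mIB := measurable_infinitely_often mZ (measurableC mB).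
apply/eqP; rewrite eq_le probability_le1//= -P1; apply: le_measure; rewrite ?inE//.
move=> w h n; have [p np Ap] := h n; exists p => // Bp.
by rewrite -[False]/(set0 (Z p w)) -AB0.
Qed.

Variable pi : probability X R.
Hypothesis pi_inv : Defs.invariant K pi.

(* A nonempty absorbing set has full measure: otherwise its complement
   contains, up to a null set, another absorbing set. *)
Lemma absorbing_full A x : absorbing A -> A x -> pi (~` A) = 0.
Proof.
move=> aA Ax; have [mA absA] := aA; have mAC := measurableC mA.
have K1 y : K y A + K y (~` A) = 1.
  by rewrite -kerPU ?setICr// setUv kerP_kerQ setXTT kerQ_setT.
(* By invariance [pi A] is the mass sent into [A] from [A], which is all of [pi A], plus the mass
   sent from outside; the latter therefore vanishes. *)
have out0 : \int[pi]_(y in ~` A) K y A = 0.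
  have : \int[pi]_y K y A = pi A by exact: pi_inv.
  rewrite -{1}(setUv A) ge0_integral_setU//; last 3 first.
  - by rewrite setUv; exact: measurable_kerP.
  - by move=> y _; exact: kerP_ge0.
  - by rewrite disj_set2E setICr.
  rewrite [X in X + _](_ : _ = pi A).
    move=> h; have := congr1 (fun z => z - pi A) h.
    by rewrite addeAC subee ?fin_num_measure// add0e.
  transitivity (\int[pi]_(y in A) cst 1 y); last by rewrite integral_cst// mul1e.
  by apply: eq_integral => y; rewrite inE => /absA Ky; rewrite -(K1 y) Ky adde0.
have mC n : measurable (core_seq (~` A) n) by exact: measurable_core_seq.
(* Up to null sets nothing is discarded from the complement of [A]: leaving the current set means
   entering [A], which is excluded by [out0], or the part discarded before, which is null by
   induction. *)
have null n : pi (~` A `\` core_seq (~` A) n) = 0.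
  elim: n => [|n IH]; first by rewrite /= setDv measure0.
  set G := core_seq (~` A) n in IH *.
  have mG : measurable G by exact: mC.
  have mD : measurable (~` A `\` G) by exact: measurableD.
  have GA : G `<=` ~` A.
    by rewrite /G; elim: (n) => //= m Hm y [/Hm].
  have H : pi (~` A `&` [set y | K y (~` G) != 0]) = 0.
    apply/ge0_integral_null => //.
    - by apply: measurable_kerP; exact: measurableC.
    - by move=> y; exact: kerP_ge0.
    apply/eqP; rewrite eq_le integral_ge0 ?andbT//; last by move=> y _; exact: kerP_ge0.
    rewrite (_ : ~` G = A `|` (~` A `\` G)); last first.
      apply/seteqP; split => y /=; first by move=> nG; have [|nA] := pselect (A y); [left|right].
      by move=> [Ay /GA//|[]].
    have KU y : K y (A `|` (~` A `\` G)) = K y A + K y (~` A `\` G).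
      by rewrite kerPU//; apply/seteqP; split => // z [? []].
    under eq_integral do rewrite KU.
    rewrite ge0_integralD//; last 4 first.
    - by move=> y _; exact: kerP_ge0.
    - by apply: measurable_funTS; exact: measurable_kerP.
    - by move=> y _; exact: kerP_ge0.
    - by apply: measurable_funTS; exact: measurable_kerP.
    rewrite out0 add0e -IH -(pi_inv mD).
    apply: ge0_subset_integral => //; first exact: measurable_kerP.
    by move=> y _; exact: kerP_ge0.
  rewrite /= -/G.
  have mE : measurable (~` A `&` [set y | K y (~` G) != 0]).
    by apply: emeasurable_neq => //; apply: measurable_funTS; apply: measurable_kerP; exact: measurableC.
  apply: (subset_measure0 _ _ _ (etrans (measureU0 mD mE H) IH)).
  - by apply: measurableD => //; exact: (mC n.+1).
  - exact: measurableU.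
  move=> y [nA /not_andP[nG|/eqP nK]]; [left|right]; split => //.
have aB := absorbing_core mAC.
have [[y By]|nB] := pselect (exists y, core (~` A) y).
  exfalso; apply: (absorbing_disjoint aA aB _ Ax By).
  by apply/seteqP; split => // z [Az /(_ 0%N I)].
have mU n : measurable (~` A `\` core_seq (~` A) n) by exact: measurableD.
rewrite (_ : ~` A = \bigcup_n (~` A `\` core_seq (~` A) n)); first exact: measure_bigcup0.
apply/seteqP; split => y; last by move=> [n _ []].
move=> nA; apply: contrapT => h; apply: nB; exists y => n _.
by apply: contrapT => nc; apply: h; exists n.
Qed.

End Absorbing.

(** * Growth of the coordinates *)

Section Increments.
Context {R : realType} {dX} {X : measurableType dX} {d : nat}.
Variable q : d.-tuple nat -> R.-ker X ~> X.
Hypothesis q_strict : strict_semi_markov q.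
Variables (C : set X) (eps : R) (theta : probability (X * d.-tuple nat)%type R).
Hypotheses (mC : measurable C) (eps_01 : 0 < eps <= 1) (Q_minor : minorized q C eps theta).
Local Open Scope ereal_scope.

Local Notation E := (X * bool * d.-tuple nat)%type.
Local Notation sl := (split_law q C eps theta).

Lemma split_lawU xb A B : measurable A -> measurable B -> A `&` B = set0 ->
  sl xb (A `|` B) = sl xb A + sl xb B.
Proof.
move=> mA mB AB0; rewrite /split_law; case: ifP => _; first by rewrite measureU.
case: ifP => _; last by rewrite measureU.
have -> : kerQ q xb.1 (A `|` B) = kerQ q xb.1 A + kerQ q xb.1 B by rewrite measureU.
have -> : theta (A `|` B) = theta A + theta B by rewrite measureU.
have fQ D : measurable D -> kerQ q xb.1 D \is a fin_num by exact: kerQ_fin.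
have ft D : measurable D -> theta D \is a fin_num by move=> mD; rewrite fin_num_measure.
rewrite -(fineK (fQ A mA)) -(fineK (fQ B mB)) -(fineK (ft A mA)) -(fineK (ft B mB)).
move: (fine _) (fine _) (fine _) (fine _) => a b c e.
by rewrite -!EFinD -!EFinM -?EFinB -?EFinM -?EFinD; congr (_%:E); ring.
Qed.

Lemma step_kernel_split_law e B : measurable B ->
  step_kernel q C eps theta e [set e' | B (e'.1.1, e'.2)] = sl e.1 B.
Proof.
move=> mB; rewrite /step_kernel /split_kernel/=.
have H : [set yk : X * d.-tuple nat | B (yk.1, vadd (vec0 d) yk.2)] = B.
  by apply/seteqP; split => -[y k] /=; rewrite vadd0l.
rewrite H; set CN := [set yk : X * d.-tuple nat | C yk.1].
have mCN : measurable CN by rewrite -[CN]/(fst @^-1` C); exact: measurable_preimageT.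
have mI : measurable (B `&` CN) by exact: measurableI.
have mD : measurable (B `\` CN) by exact: measurableD.
have [e0 e1] := andP eps_01.
have eE : eps%:E + (1 - eps)%:E = 1 :> \bar R by rewrite -EFinD subrKC.
have comb a : eps%:E * a + (1 - eps)%:E * a = a.
  by rewrite -[RHS]mul1e -eE ge0_muleDl// lee_fin ?subr_ge0// ltW.
rewrite comb.
rewrite -split_lawU//; first by rewrite setUIDK.
by apply/seteqP; split => // x [[_ ?] []].
Qed.

Variables (pi : probability X R) (x0 : X) (mu : probability (path_space E) R).
Hypothesis chain : forall n A B, measurable A -> past n B ->
  mu (B `&` [set y | A (y n)]) =
  \int[mu]_(y in B) step_kernel q C eps theta (state_at (atom_step x0) y n) A.

Let J n (y : path_space E) : X := (y n).1.1.

Let mJE : measurable_fun setT (fun e : E => e.1.1).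
Proof. exact: (measurableT_comp measurable_fst measurable_fst). Qed.

Let mcoin : measurable_fun setT (fun e : E => e.1.2).
Proof. exact: (measurableT_comp measurable_snd measurable_fst). Qed.

Let mJ n : measurable_fun setT (J n).
Proof. by apply: (measurableT_comp mJE); exact: measurable_coord. Qed.

Let law n := restricted_image mu measurableT (mJ n).

Let lawE n A : law n A = mu [set y | A (y n).1.1].
Proof. by rewrite restricted_imageE setIT. Qed.

Let coin n (b : bool) : set (path_space E) := [set y | (y n).1.2 = b].

Let mcoin_n n b : measurable (coin n b).
Proof.
rewrite -[coin n b]/((fun y : path_space E => (y n).1.2) @^-1` [set b]).
by apply: measurable_preimageT => //; apply: (measurableT_comp mcoin); exact: measurable_coord.
Qed.

Let state_law n B : measurable B ->
  mu [set y | B ((y n).1.1, (y n).2)] = \int[mu]_y sl (state_at (atom_step x0) y n).1 B.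
Proof.
move=> mB; have mB' : measurable [set e : E | B (e.1.1, e.2)].
  rewrite -[X in measurable X]/((fun e : E => (e.1.1, e.2)) @^-1` B).
  by apply: measurable_preimageT => //; apply: measurable_fun_pair.
have -> : [set y : path_space E | B ((y n).1.1, (y n).2)] =
  setT `&` [set y | [set e : E | B (e.1.1, e.2)] (y n)] by rewrite setTI.
rewrite chain//; last exact: pastT.
by apply: eq_integral => y _; rewrite step_kernel_split_law.
Qed.

Let law_int n A : measurable A ->
  law n A = \int[mu]_y sl (state_at (atom_step x0) y n).1 (A `*` setT).
Proof.
move=> mA; rewrite lawE -state_law; last exact: measurableX.
by congr (mu _); apply/seteqP; split => y /=; tauto.
Qed.

Let msl n D : measurable D ->
  measurable_fun setT (fun y : path_space E => sl (state_at (atom_step x0) y n).1 D).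
Proof.
move=> mD; apply: (measurableT_comp (f := fun e : E => sl e.1 D)).
  apply: (measurableT_comp (f := fun xb => sl xb D)) => //.
  by apply: measurable_fun_discrete => // [|b]; [exact: countableP|exact: measurable_split_law].
by case: n => [|n]; [exact: measurable_cst|exact: measurable_coord].
Qed.

(* Given its state, the coin is an independent Bernoulli variable. *)
Let law_free n A : measurable A -> mu (coin n false `&` [set y | A (y n).1.1]) = thinned mC eps_01 (law n) A.
Proof.
move=> mA; have mCC := measurableC mC.
have m1 : measurable ((A `&` C) `*` [set: d.-tuple nat]) by apply: measurableX => //; exact: measurableI.
have m2 : measurable ((A `&` ~` C) `*` [set: d.-tuple nat]) by apply: measurableX => //; exact: measurableI.
have [e0 e1] := andP eps_01.
rewrite thinnedE !law_int; [|exact: measurableI..].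
have s0 D y : measurable D -> 0 <= sl (state_at (atom_step x0) y n).1 D by move=> mD; exact: split_law_ge0.
rewrite -ge0_integralZl_EFin//; [|by move=> y _; exact: s0|exact: msl|by rewrite subr_ge0].
rewrite -ge0_integralD//; [|by move=> y _; rewrite mule_ge0 ?lee_fin ?subr_ge0//; exact: s0
  |by apply: measurable_funeM; exact: msl|by move=> y _; exact: s0|exact: msl].
have mB' : measurable [set e : E | ~~ e.1.2 /\ A e.1.1].
  have -> : [set e : E | ~~ e.1.2 /\ A e.1.1] =
      (fun e => e.1.2) @^-1` [set false] `&` (fun e => e.1.1) @^-1` A.
    by apply/seteqP; split => e /= [h ?]; split => //; move: h; case: (e.1.2).
  by apply: measurableI; apply: measurable_preimageT.
have -> : coin n false `&` [set y | A (y n).1.1] =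
    setT `&` [set y | [set e : E | ~~ e.1.2 /\ A e.1.1] (y n)].
  by apply/seteqP; split => y; rewrite /coin/= => -[h1 h2]; split => //; [rewrite h1|case: h2 => /negbTE ->|case: h2].
rewrite chain//; last exact: pastT.
by apply: eq_integral => y _; rewrite step_kernel_free.
Qed.

Let law_atom n : mu (coin n true) = eps%:E * law n C.
Proof.
have [e0 e1] := andP eps_01.
have mB' : measurable [set e : E | e.1.2].
  rewrite -[X in measurable X]/((fun e : E => e.1.2) @^-1` [set true]).
  exact: measurable_preimageT.
have -> : coin n true = setT `&` [set y | [set e : E | e.1.2] (y n)] by rewrite setTI.
rewrite chain//; last exact: pastT.
rewrite law_int// -ge0_integralZl_EFin//; last 3 first.
- by move=> y _; apply: split_law_ge0 => //; exact: measurableX.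
- by apply: msl; exact: measurableX.
- exact: ltW.
apply: eq_integral => y _; rewrite /step_kernel /split_kernel/=.
have -> : [set yk : X * d.-tuple nat | false] = set0 by apply/seteqP; split.
rewrite set0I set0D split_law0 mule0 !adde0; congr (_ * sl _ _).
by apply/seteqP; split => yk /= [].
Qed.

(** Entry [n] is a state at a positive time, whose coin has been tossed independently given the
    point. Averaging over this coin undoes the splitting, so that the next pair comes from [kerQ];
    at time 0, where the coin is 1, it comes from [theta] instead. *)
Lemma next_law n B : measurable B ->
  mu [set y | B ((y n.+1).1.1, (y n.+1).2)] = \int[law n]_x kerQ q x B.
Proof.
move=> mB; rewrite (state_law n.+1 mB).
have e0 : (0 <= eps)%R by case/andP: eps_01 => /ltW.
rewrite -(integral_split_law_thinned q_strict mC eps_01 Q_minor (law n) mB).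
have TE : coin n true `|` coin n false = setT.
  by apply/seteqP; split => // y _; rewrite /coin/=; case: (y n).1.2; [left|right].
rewrite -{1}TE ge0_integral_setU//; last 3 first.
- by rewrite TE; exact: (msl n.+1).
- by move=> y _; exact: split_law_ge0.
- by rewrite disj_set2E; apply/eqP/seteqP; split => // y []; rewrite /coin/= => ->.
congr (_ + _).
  rewrite (eq_integral (cst (theta B))); last first.
    by move=> y; rewrite inE /coin/= /split_law => ->.
  transitivity (theta B * mu (coin n true)); first exact: integral_cst.
  by rewrite law_atom muleC.
transitivity (\int[restricted_image mu (mcoin_n n false) (mJ n)]_x sl (x, false) B).
  rewrite ge0_integral_restricted_image//; last 2 first.
  - exact: measurable_split_law.
  - by move=> x; exact: split_law_ge0.
  apply: eq_integral => y; rewrite inE /coin/= /J.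
  by case: (y n) => -[x b] k /= ->.
apply: eq_measure_integral => A mA _.
by rewrite -law_free// -[LHS]/(mu (J n @^-1` A `&` coin n false)) setIC.
Qed.

Hypotheses (harris : harris_recurrent (kerP q)) (pi_inv : Defs.invariant (kerP q) pi).

(* If a coordinate never increases, the states from which it cannot increase
   contain a nonempty absorbing set, which has full measure. *)
Lemma increments_not_null r : 0 < mean_incr q pi r ->
  ~ (forall n, mu [set y | tnth (y n).2 r <> 0%N] = 0).
Proof.
move=> mean0 null.
pose U : set (X * d.-tuple nat) := setT `*` [set k | tnth k r <> 0%N].
have mU : measurable U by apply: measurableX => //; exact: measurable_nat_vector.
pose D := [set x | kerQ q x U = 0].
have mD : measurable D.
  rewrite -[D]/((fun x => kerQ q x U) @^-1` [set 0]).
  by apply: measurable_preimageT => //; exact: measurable_kerQ.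
have mC' n : measurable (core_seq q D n) by exact: measurable_core_seq.
(* Induction on [m]: since coordinate [r] does not grow, the states visited lie almost surely in
   [D]; and since the next state again lies in the current set, they are not discarded in the next
   round. *)
have law0 m n : law n (~` core_seq q D m) = 0.
  elim: m n => [|m IH] n.
    have : \int[law n]_x kerQ q x U = 0.
      rewrite -next_law//; apply: etrans (null n.+1); congr (mu _).
      by apply/seteqP; split => y /=; [case|].
    move=> /(ge0_integral_null (law n) measurableT (measurable_kerQ q mU) (fun x => measure_ge0 _ _)).
    by rewrite setTI => <-; congr (law n _); apply/seteqP; split => x /= /eqP.
  have mG := measurableC (mC' m).
  have : \int[law n]_x kerP q x (~` core_seq q D m) = 0.
    under eq_integral do rewrite kerP_kerQ.
    rewrite -next_law//; last exact: measurableX.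
    apply: etrans (IH n.+1); rewrite lawE; congr (mu _).
    by apply/seteqP; split => y /= => [[]|].
  move=> /(ge0_integral_null (law n) measurableT (measurable_kerP q mG) (fun x => kerP_ge0 q _ _)).
  rewrite setTI => nz.
  have mN : measurable [set x | kerP q x (~` core_seq q D m) != 0].
    by rewrite -[X in measurable X]setTI; apply: emeasurable_neq => //; exact: measurable_kerP.
  rewrite /= setCI (_ : ~` [set x | kerP q x _ = 0] = [set x | kerP q x (~` core_seq q D m) != 0]).
    exact: etrans (measureU0 mG mN nz) (IH n).
  by apply/seteqP; split => x /= /eqP.
have [x Kx] : exists x, core q D x.
  apply: contrapT => nK.
  have : law 0 setT = 0.
    have -> : setT = \bigcup_m ~` core_seq q D m.
      apply/seteqP; split => // x _; apply: contrapT => h; apply: nK; exists x => m _.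
      by apply: contrapT => nc; apply: h; exists m.
    by apply: measure_bigcup0 => m; [exact: measurableC|exact: law0].
  rewrite lawE (_ : [set _ | _] = setT)//.
  have -> : mu setT = 1 by exact: probability_setT.
  by move/eqP; rewrite eqe oner_eq0.
have full := absorbing_full q_strict harris pi_inv (absorbing_core q mD) Kx.
have mK : measurable (~` core q D) by apply: measurableC; have [] := absorbing_core q mD.
have := mean0; rewrite /mean_incr.
set f := (fun x => _); have f0 x' : 0 <= f x'.
  by apply: esum_ge0 => k _; rewrite mule_ge0// lee_fin.
have mf : measurable_fun setT f.
  have -> : f = fun z => \sum_(n <oo) oapp (fun k => (tnth k r)%:R%:E * q k z setT) 0 (pickle_inv n).
    by apply/funext => z; rewrite /f esum_pickle// => k; rewrite mule_ge0// lee_fin.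
  apply: ge0_emeasurable_sum => [n z _ _|n _].
    by case: pickle_inv => //= k; rewrite mule_ge0// lee_fin.
  case: pickle_inv => [k|] /=; last exact: measurable_cst.
  by apply: measurable_funeM; apply: measurable_kernel.
rewrite (_ : integral _ _ _ = 0) ?ltxx//; apply/ge0_integral_null => //.
have mfN : measurable (setT `&` [set x | f x != 0]) by exact: emeasurable_neq.
apply: (subset_measure0 mfN mK _ full) => z [_ /= fz] Kz; move: fz; apply/negP/negPn/eqP.
rewrite /f esum1// => k _; have [->|kr] := eqVneq (tnth k r) 0%N; first by rewrite mul0e.
rewrite (_ : q k z setT = 0) ?mule0//; apply/eqP; rewrite -measure_le0.
have <- : kerQ q z U = 0 by have := Kz 0%N I.
apply: esum_ge; exists [set k]; first by split.
rewrite fsbig_set1 (_ : [set y | U (y, k)] = setT)//.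
by apply/seteqP; split => // y _; split => //; exact/eqP.
Qed.

End Increments.

(** * Uniform law of large numbers on windows *)

Section LocalLinearity.
Context {R : realType} {d} {T : measurableType d} (P : probability T R).
Variable th : T -> T.
Hypotheses (mth : measurable_fun setT th)
  (pres : forall A, measurable A -> P (th @^-1` A) = P A).

(* Uniform law of large numbers for the first O(sqrt t) terms, at scale sqrt t. *)
Definition locally_linear (xi : T -> R) := forall L dl e : R, 0 < L -> 0 < dl -> 0 < e ->
  \forall t \near +oo, exists2 B : set T, measurable B & fine (P B) <= e /\
    forall x, ~ B x -> forall n, n%:R <= L * Num.sqrt t ->
      `|rsum th xi n x - n%:R * \int[P]_x xi x| <= dl * Num.sqrt t.

Lemma fine_measureU (A B : set T) : measurable A -> measurable B ->
  fine (P (A `|` B)) <= fine (P A) + fine (P B).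
Proof.
move=> mA mB; rewrite -lee_fin EFinD !fineK ?fin_num_measure//; last exact: measurableU.
exact: measureU2.
Qed.

Lemma fine_measure_bigsetU (A : nat -> set T) N (e : R) : (forall i, measurable (A i)) ->
  (forall i, (i < N)%N -> fine (P (A i)) <= e) ->
  fine (P (\big[setU/set0]_(i < N) A i)) <= N%:R * e.
Proof.
move=> mA; elim: N => [|N IH] Ae; first by rewrite big_ord0 measure0 mul0r.
rewrite big_ord_recr (le_trans (fine_measureU _ _))//.
  by apply: bigsetU_measurable.
by rewrite -natr1 mulrDl mul1r lerD//; [apply: IH => i iN; apply: Ae; exact: ltnW|exact: Ae].
Qed.

Lemma sqrt_near (A : R) : \forall t \near +oo, A <= Num.sqrt t.
Proof.
near=> t; rewrite (le_trans (ler_norm A))// -sqrtr_sqr.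
rewrite ler_sqrt; last by near: t; apply: nbhs_pinfty_ge; exact: num_real.
by near: t; apply: nbhs_pinfty_ge; exact: num_real.
Unshelve. all: by end_near. Qed.

(** Chebyshev's inequality controls the centered sums at [M.+2] grid points, and since the terms are
    nonnegative the sums are monotone between these. The number of grid points does not depend on
    [t], which makes the union bound tend to 0. *)
Lemma locally_linear_ge0 (xi : T -> R) :
  measurable_fun setT xi -> indep_maps P xi th -> rint P (fun x => xi x ^+ 2) ->
  (forall x, 0 <= xi x) -> locally_linear xi.
Proof.
move=> mxi ind xi2 xi0 L dl e L0 dl0 e0.
set a := \int[P]_x xi x.
have xi1 := rint_sqr mxi xi2.
have a0 : 0 <= a by apply: Rintegral_ge0.
pose eta x := xi x - a.
have meta : measurable_fun setT eta by apply: measurable_funB => //; exact: measurable_cst.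
have eta2 : rint P (fun x => eta x ^+ 2).
  apply: (rint_le (measurable_funX 2 meta) _ (rintD (rintZ 2 xi2) (rint_cst P (2 * a ^+ 2)))).
  move=> x; rewrite /eta ger0_norm ?sqr_ge0//.
  by have := sqr_ge0 (xi x + a); nra.
have eta_mean : \int[P]_x eta x = 0.
  by rewrite ExpB//; [rewrite Exp_cst subrr|exact: rint_cst].
have ind_eta : indep_maps P eta th.
  have msub : measurable_fun setT (fun z : R => z - a).
    by apply: measurable_funB => //; exact: measurable_cst.
  exact: (indep_maps_comp msub (@measurable_id _ _ _) ind).
pose var := \int[P]_x (eta x ^+ 2).
have var0 : 0 <= var by apply: Rintegral_ge0 => x _; exact: sqr_ge0.
have rsum_eta n x : rsum th eta n x = rsum th xi n x - n%:R * a.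
  elim: n x => [|n IH] x /=; first by rewrite mul0r subrr.
  by rewrite IH /eta -natr1; ring.
have mono n m x : rsum th xi n x <= rsum th xi (n + m) x.
  rewrite rsum_addn lerDl; move: (iter n th x).
  by elim: m => //= m IH z; rewrite addr_ge0.
(* So many blocks that the mean growth [a * (L * s / M)] over one block is at most [dl * s / 4],
   where [s] is [sqrt t]. *)
pose M := (Num.truncn (4 * (a * L) / dl)).+1.
have MP : a * L <= M%:R * dl / 4.
  have := truncnS_gt (4 * (a * L) / dl); rewrite -/M ltr_pdivrMr// => h.
  by rewrite ler_pdivlMr//; lra.
have M0 : 0 < M%:R :> R by rewrite ltr0n.
(* Threshold for [sqrt t] beyond which each of the [M.+2] Chebyshev bounds is at most [e / M.+2]:
   the variance of a sum is of order [sqrt t], the squared deviation of order [t]. *)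
pose A0 := (M.+2)%:R ^+ 2 * (L + 2) * var * 4 / (e * dl ^+ 2).
near=> t.
have s1 : 1 <= Num.sqrt t by near: t; exact: sqrt_near.
have sa : 8 * a / dl <= Num.sqrt t by near: t; exact: sqrt_near.
have sA : A0 <= Num.sqrt t by near: t; exact: sqrt_near.
move: (Num.sqrt t) s1 sa sA => s s1 sa sA.
have s0 : 0 < s by lra.
pose N := (Num.truncn (L * s)).+1.
(* Rounded up, so that [M] blocks of length [h] cover every [n < N]. *)
pose h := (N %/ M).+1.
have NL : N%:R <= L * s + 1.
  by rewrite /N -natr1 lerD2r truncn_le// mulr_ge0// ltW.
have hs : h%:R <= L * s / M%:R + 2.
  have : (N %/ M)%:R <= L * s / M%:R + 1.
    have M1 : M%:R^-1 <= 1 :> R by rewrite invf_le1// ler1n.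
    have : ((N %/ M) * M)%:R <= N%:R :> R by rewrite ler_nat; exact: leq_divM.
    rewrite natrM -ler_pdivlMr// => /le_trans; apply.
    apply: (@le_trans _ _ ((L * s + 1) / M%:R)); first by rewrite ler_wpM2r ?invr_ge0 ?(ltW M0).
    by rewrite mulrDl mul1r lerD2l.
  by rewrite /h -natr1; lra.
have hL : h%:R <= (L + 2) * s.
  apply: (le_trans hs); rewrite mulrDl lerD//; last by lra.
  rewrite ler_pdivrMr// ler_peMr ?ler1n//.
  by rewrite mulr_ge0// ltW.
have hNM : (N < h * M)%N by rewrite /h ltn_ceil.
pose A i := [set x | dl * s / 2 <= `|rsum th eta (i * h) x|].
have ds0 : 0 < dl * s / 2 by rewrite divr_gt0// mulr_gt0.
have mA i : measurable (A i).
  have -> : A i = (fun x => `|rsum th eta (i * h) x|) @^-1` `[dl * s / 2, +oo[%classic.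
    by apply/seteqP; split => x /=; rewrite /A/= in_itv/= andbT.
  apply: measurable_preimageT => //; apply: measurableT_comp; first exact: normr_measurable.
  exact: measurable_rsum.
exists (\big[setU/set0]_(i < M.+2) A i).
  by apply: bigsetU_measurable => i _; exact: mA.
split.
  rewrite (_ : e = M.+2%:R * (e / M.+2%:R)); last by field; rewrite -natr1 -natr1; lra.
  apply: fine_measure_bigsetU => // i iM.
  have [r2 _ rE] := rsum_moments mth meta ind_eta pres eta2 eta_mean (i * h).
  rewrite (le_trans (markov_sqr ds0 r2 (measurable_rsum mth meta _)))//.
  rewrite rE -/var ler_pdivrMr ?exprn_gt0//.
  have M20 : 0 < M.+2%:R :> R by rewrite ltr0n.
  have ih : (i * h)%:R <= M.+2%:R * ((L + 2) * s).
    by rewrite natrM ler_pM// ler_nat ltnW.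
  have : A0 * (e * dl ^+ 2) <= s * (e * dl ^+ 2).
    by rewrite ler_wpM2r// mulr_ge0 ?sqr_ge0// ltW.
  rewrite /A0 mulfVK; last by rewrite mulf_neq0// ?sqrf_eq0 gt_eqF.
  move=> A0s; apply: (@le_trans _ _ (M.+2%:R * ((L + 2) * s) * var)).
    by rewrite ler_wpM2r.
  rewrite -(ler_pM2l M20) (_ : M.+2%:R * (e / M.+2%:R * _) = e * (dl * s / 2) ^+ 2); last first.
    by field; rewrite gt_eqF.
  have : (M.+2%:R ^+ 2 * (L + 2) * var * 4) * s <= (s * (e * dl ^+ 2)) * s.
    by rewrite ler_wpM2r// ltW.
  move: (M.+2%:R : R) => m2 H.
  have -> : m2 * (m2 * ((L + 2) * s) * var) = (m2 ^+ 2 * (L + 2) * var * 4) * s / 4 by field.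
  have -> : e * (dl * s / 2) ^+ 2 = (s * (e * dl ^+ 2)) * s / 4 by field.
  by rewrite ler_wpM2r// invr_ge0.
move=> x nB n nL.
have nA i : (i < M.+2)%N -> `|rsum th xi (i * h) x - (i * h)%:R * a| < dl * s / 2.
  move=> iM; rewrite -rsum_eta ltNge; apply/negP => h'; apply: nB.
  by rewrite -bigcup_mkord; exists i.
have nN : (n < N)%N by rewrite -(ltr_nat R) (le_lt_trans nL)// truncnS_gt.
have h0 : (0 < h)%N by [].
have iM : (n %/ h < M.+1)%N.
  by rewrite ltnS -ltnS (leq_trans _ (leqnSn _))// ltn_divLR// mulnC (ltn_trans nN).
have n1 : ((n %/ h) * h <= n)%N by exact: leq_divM.
have n2 : (n < (n %/ h).+1 * h)%N by exact: ltn_ceil.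
have lo := nA (n %/ h)%N (ltnW iM).
have hi := nA (n %/ h).+1 iM.
have m1 := mono ((n %/ h) * h)%N (n - (n %/ h) * h)%N x.
have m2 := mono n ((n %/ h).+1 * h - n)%N x.
rewrite subnKC// in m1; rewrite subnKC ?(ltnW n2)// in m2.
have ah : a * h%:R <= dl * s / 2.
  rewrite (le_trans (ler_wpM2l a0 hs))// mulrDr.
  have : 8 * a <= s * dl by rewrite -ler_pdivrMr.
  have : a * (L * s / M%:R) <= dl * s / 4.
    rewrite mulrA ler_pdivrMr// mulrA (_ : dl * s / 4 * M%:R = (M%:R * dl / 4) * s); last by ring.
    by rewrite ler_wpM2r// ltW.
  lra.
have n1R : ((n %/ h) * h)%:R <= n%:R :> R by rewrite ler_nat.
have n2R : n%:R <= ((n %/ h) * h)%:R + h%:R :> R.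
  by rewrite -natrD ler_nat -mulSnr ltnW.
have E2 : ((n %/ h).+1 * h)%:R = ((n %/ h) * h)%:R + h%:R :> R by rewrite mulSnr natrD.
rewrite E2 in hi.
move: lo hi; rewrite !ltr_norml => /andP[lo _] /andP[_ hi].
rewrite ler_norml.
have a1 := ler_wpM2r a0 n1R.
have a2 := ler_wpM2r a0 n2R.
rewrite mulrDl in hi; rewrite mulrDl in a2; rewrite mulrC in ah.
apply/andP; split; lra.
Unshelve. all: by end_near. Qed.

Lemma locally_linearB (xi eta : T -> R) : rint P xi -> rint P eta ->
  locally_linear xi -> locally_linear eta -> locally_linear (fun x => xi x - eta x).
Proof.
move=> xi1 eta1 lx le L dl e L0 dl0 e0.
have dl2 : 0 < dl / 2 by rewrite divr_gt0.
have e2 : 0 < e / 2 by rewrite divr_gt0.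
near=> t.
have [B1 mB1 [PB1 H1]] : exists2 B : set T, measurable B & fine (P B) <= e / 2 /\
    forall x, ~ B x -> forall n, n%:R <= L * Num.sqrt t ->
      `|rsum th xi n x - n%:R * \int[P]_x xi x| <= dl / 2 * Num.sqrt t.
  by near: t; exact: lx.
have [B2 mB2 [PB2 H2]] : exists2 B : set T, measurable B & fine (P B) <= e / 2 /\
    forall x, ~ B x -> forall n, n%:R <= L * Num.sqrt t ->
      `|rsum th eta n x - n%:R * \int[P]_x eta x| <= dl / 2 * Num.sqrt t.
  by near: t; exact: le.
exists (B1 `|` B2); first exact: measurableU.
split; first by rewrite (le_trans (fine_measureU mB1 mB2))//; lra.
move=> x nB n nL.
have h1 := H1 x (fun b => nB (or_introl b)) n nL.
have h2 := H2 x (fun b => nB (or_intror b)) n nL.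
have -> : rsum th (fun x => xi x - eta x) n x = rsum th xi n x - rsum th eta n x.
  by elim: n x {nB nL h1 h2} => [|n IH] x /=; rewrite ?subrr// IH; ring.
rewrite ExpB//.
rewrite (_ : _ - _ = (rsum th xi n x - n%:R * \int[P]_x xi x) -
  (rsum th eta n x - n%:R * \int[P]_x eta x)); last by ring.
rewrite (le_trans (ler_normB _ _))//; lra.
Unshelve. all: by end_near. Qed.

(** The window around [truncn (t * kap)] is reached by applying the estimate to the path shifted to
    its left end; the shift preserves [P], hence the exceptional event keeps its probability. *)
Lemma locally_linear_shift (xi : T -> R) (kap L dl e : R) : locally_linear xi ->
  0 < kap -> 0 < L -> 0 < dl -> 0 < e ->
  \forall t \near +oo, exists2 B : set T, measurable B & fine (P B) <= e /\
    forall x, ~ B x -> forall n, `|n%:R - (Num.truncn (t * kap))%:R| <= L * Num.sqrt t ->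
      `|rsum th xi n x - rsum th xi (Num.truncn (t * kap)) x -
        (n%:R - (Num.truncn (t * kap))%:R) * \int[P]_x xi x| <= dl * Num.sqrt t.
Proof.
move=> lx k0 L0 dl0 e0.
(* From the left end, at most [L s + 1] before the center, to the right end the window has length at
   most [2 L s + 1]. *)
have L2 : 0 < 2 * L + 2 by lra.
have dl2 : 0 < dl / 2 by rewrite divr_gt0.
near=> t.
have s1 : 1 <= Num.sqrt t by near: t; exact: sqrt_near.
have sL : (L + 2) / kap <= Num.sqrt t by near: t; exact: sqrt_near.
have t0 : 0 <= t by near: t; apply: nbhs_pinfty_ge; exact: num_real.
have tE := sqr_sqrtr t0.
have [B mB [PB H]] : exists2 B : set T, measurable B & fine (P B) <= e /\
    forall x, ~ B x -> forall n, n%:R <= (2 * L + 2) * Num.sqrt t ->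
      `|rsum th xi n x - n%:R * \int[P]_x xi x| <= dl / 2 * Num.sqrt t.
  by near: t; exact: lx.
move: H; set n0 := Num.truncn (t * kap).
move: (Num.sqrt t) s1 sL tE => s s1 sL tE H.
have n0P : t * kap < n0%:R + 1 by rewrite natr1 truncnS_gt.
pose w := (Num.truncn (L * s)).+1.
have wL : w%:R <= L * s + 1 by rewrite /w -natr1 lerD2r truncn_le// mulr_ge0//; lra.
have Lw : L * s < w%:R by exact: truncnS_gt.
have wn : (w <= n0)%N.
  rewrite -ltnS -(ltr_nat R) -natr1 (le_lt_trans wL)//.
  apply: le_lt_trans n0P; rewrite -tE.
  have : (L + 2) <= s * kap by rewrite -ler_pdivrMr.
  nra.
exists (iter (n0 - w) th @^-1` B).
  by apply: measurable_preimageT => //; exact: measurable_iter.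
split; first by rewrite (iter_preserves mth pres).
move=> x nB n nL.
move: nL; rewrite ler_norml => /andP[nL1 nL2].
have bn : (n0 - w <= n)%N.
  rewrite leq_subLR -(ler_nat R) natrD; lra.
set b := (n0 - w)%N in nB bn.
have bE : b%:R = n0%:R - w%:R :> R by rewrite natrB.
have R1 : rsum th xi n x = rsum th xi b x + rsum th xi (n - b) (iter b th x).
  by rewrite -rsum_addn subnKC.
have R2 : rsum th xi n0 x = rsum th xi b x + rsum th xi w (iter b th x).
  by rewrite -rsum_addn subnK.
have nb : (n - b)%:R = n%:R - b%:R :> R by rewrite natrB.
have h1 : `|rsum th xi (n - b) (iter b th x) - (n - b)%:R * \int[P]_x xi x| <= dl / 2 * s.
  by apply: H => //; rewrite nb bE; lra.
have h2 : `|rsum th xi w (iter b th x) - w%:R * \int[P]_x xi x| <= dl / 2 * s.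
  by apply: H => //; lra.
rewrite R1 R2; move: h1 h2; rewrite nb bE.
move: (rsum _ _ (n - b) _) (rsum _ _ w _) (rsum _ _ b x) (\int[P]_x _ x) => u v c a h1 h2.
rewrite (_ : _ - _ = (u - (n%:R - (n0%:R - w%:R)) * a) - (v - w%:R * a)); last by ring.
rewrite (le_trans (ler_normB _ _))//; lra.
Unshelve. all: by end_near. Qed.

End LocalLinearity.

(** * Inversion of the cycle sums *)

Lemma nat_supP (A : set nat) (p b : nat) : A p -> (forall n, A n -> (n < b)%N) ->
  A (nat_sup A) /\ forall n, A n -> (n <= nat_sup A)%N.
Proof.
move=> Ap Ab.
have ex : exists n, `[< A n >] by exists p; exact/asboolP.
have bd n : `[< A n >] -> (n <= b)%N by move=> /asboolP/Ab/ltnW.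
have [n /asboolP An nmax] := ex_maxnP ex bd.
have H : [set n | A n /\ forall p, A p -> (p <= n)%N] (nat_sup A).
  by apply: (xgetPex 0%N); exists n; split => // m Am; apply: nmax; exact/asboolP.
exact: H.
Qed.

Section Minimum.
Context {R : realType} {d : nat}.
Implicit Types (A : {set 'I_d}) (f : 'I_d -> R).

Lemma min_overP A f i0 : i0 \in A ->
  (exists2 i, i \in A & min_over A f = f i) /\ forall i, i \in A -> min_over A f <= f i.
Proof.
move=> Ai0; have [i Ai imin] := @arg_minP _ _ _ i0 (fun i => i \in A) f Ai0.
have -> : min_over A f = f i; last by split; [exists i|].
apply/eqP; rewrite eq_le; apply/andP; split.
  by apply: ge_inf; [exists (f i) => _ [j Aj <-]; exact: imin|exists i].
by apply: lb_le_inf; [exists (f i), i|move=> _ [j Aj <-]; exact: imin].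
Qed.

Lemma min_over_dist A f g i0 (e : R) : i0 \in A -> (forall i, i \in A -> `|f i - g i| <= e) ->
  `|min_over A f - min_over A g| <= e.
Proof.
move=> Ai0 fg.
have [[i Ai fi] fmin] := min_overP f Ai0; have [[j Aj gj] gmin] := min_overP g Ai0.
have := fmin j Aj; have := gmin i Ai; rewrite fi gj => h1 h2.
have := fg i Ai; have := fg j Aj; rewrite !ler_norml => /andP[? ?] /andP[? ?].
by apply/andP; split; lra.
Qed.

End Minimum.

Section Inversion.
Context {R : realType} {d : nat}.
Variables (m V h : 'I_d -> R) (I : {set 'I_d}) (Cn : nat -> d.-tuple nat)
  (k : d.-tuple nat) (n0 : nat) (s K dl eta : R).
Hypotheses (m_gt0 : forall r, 0 < m r) (s_gt0 : 0 < s) (i0 : 'I_d) (I_i0 : i0 \in I).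
Hypothesis Cn_mono : forall p n, (p <= n)%N -> vle (Cn p) (Cn n).
Hypothesis Cn_near : forall r n, `|n%:R - n0%:R| <= K * s ->
  `|(tnth (Cn n) r)%:R - n0%:R * m r - s * V r - (n%:R - n0%:R) * m r| <= dl * s.
Hypothesis k_active : forall r, r \in I -> `|(tnth k r)%:R - n0%:R * m r - s * h r| <= dl * s.
Hypothesis k_inactive : forall r, r \notin I ->
  n0%:R * m r + s * V r + K * s * m r + dl * s <= (tnth k r)%:R.
Let z := min_over I (fun r => (h r - V r) / m r).
Hypotheses (eta_ge0 : 0 < eta) (dl_small : forall r, 2 * dl < eta * m r).
Hypotheses (window : `|z| * s + eta * s + 2 <= K * s) (n0_large : K * s <= n0%:R).

Let A := [set n | vle (Cn n) k].

Let A_down n p : (p <= n)%N -> A n -> A p.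
Proof.
move=> pn /forallP An; apply/forallP => i.
by rewrite (leq_trans _ (An i))//; have /forallP := Cn_mono pn.
Qed.

(** At [n1], which is [n0 + s z - eta s] rounded down, each active coordinate has room [eta s m_r],
    more than the two errors [dl s] can use up; at [n2], just above [n0 + s z + eta s], the
    coordinate that attains the minimum overflows. The summand 1 in the conclusion is for
    rounding. *)
Lemma inversion : let n := nat_sup A in
  [/\ A n, ~ A n.+1 & `|n%:R - n0%:R - s * z| <= eta * s + 1].
Proof.
have [[j Ij zj] zmin] := min_overP (fun r => (h r - V r) / m r) I_i0.
move: window zj zmin; rewrite -/z; move: z => zz win zj zmin.
have zs : `|s * zz| = `|zz| * s by rewrite normrM mulrC (gtr0_norm s_gt0).
have [zlo zhi] : - (`|zz| * s) <= s * zz /\ s * zz <= `|zz| * s.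
  by rewrite -zs; split; [rewrite lerNl -normrN; exact: ler_norm|exact: ler_norm].
have es0 : 0 < eta * s by rewrite mulr_gt0.
pose n1 := Num.truncn (n0%:R + s * zz - eta * s).
have n0l := n0_large.
have x0 : 0 <= n0%:R + s * zz - eta * s by lra.
have n1le : n1%:R <= n0%:R + s * zz - eta * s by rewrite truncn_le.
have n1gt : n0%:R + s * zz - eta * s < n1%:R + 1 by rewrite natr1 truncnS_gt.
pose n2 := (Num.truncn (n0%:R + s * zz + eta * s)).+1.
have n2gt : n0%:R + s * zz + eta * s < n2%:R by rewrite truncnS_gt.
have n2le : n2%:R <= n0%:R + s * zz + eta * s + 1.
  by rewrite /n2 -natr1 lerD2r truncn_le//; lra.
have An1 : A n1.
  apply/forallP => r; rewrite -(ler_nat R).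
  have nn : `|n1%:R - n0%:R| <= K * s by rewrite ler_norml; apply/andP; split; lra.
  have := Cn_near r nn; rewrite ler_norml => /andP[_ up].
  have [rI|rI] := boolP (r \in I); last first.
    have := k_inactive rI; have : (n1%:R - n0%:R) * m r <= K * s * m r.
      apply: ler_wpM2r; first by rewrite ltW.
      by move: nn; rewrite ler_norml => /andP[].
    lra.
  have := k_active rI; rewrite ler_norml => /andP[lo _].
  have zr : zz * m r <= h r - V r by rewrite -ler_pdivlMr//; exact: zmin.
  have h1 : (n1%:R - n0%:R) * m r <= (s * zz - eta * s) * m r.
    by apply: ler_wpM2r; [rewrite ltW|lra].
  have h2 : s * (zz * m r) <= s * (h r - V r) by rewrite ler_wpM2l// ltW.
  have h3 : s * (2 * dl) <= s * (eta * m r) by rewrite ler_wpM2l ?ltW.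
  lra.
have Ab n : A n -> (n < n2)%N.
  move=> An; rewrite ltnNge; apply/negP => n2n.
  have /forallP/(_ j) := A_down n2n An; rewrite -(ler_nat R) => up.
  have nn : `|n2%:R - n0%:R| <= K * s by rewrite ler_norml; apply/andP; split; lra.
  have := Cn_near j nn; rewrite ler_norml => /andP[lo _].
  have := k_active Ij; rewrite ler_norml => /andP[_ hi].
  have zr : zz * m j = h j - V j by rewrite zj divfK// gt_eqF.
  have h1 : (s * zz + eta * s) * m j <= (n2%:R - n0%:R) * m j.
    by apply: ler_wpM2r; [rewrite ltW|lra].
  have h2 : s * (zz * m j) = s * (h j - V j) by rewrite zr.
  have h3 : s * (2 * dl) < s * (eta * m j) by rewrite ltr_pM2l.
  lra.
have [An nmax] := nat_supP An1 Ab.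
move=> n; rewrite -/n in An nmax; split => //.
  by move=> /nmax; rewrite ltnn.
have l1 : n1%:R <= n%:R :> R by rewrite ler_nat; exact: nmax.
have l2 : n%:R + 1 <= n2%:R :> R by rewrite natr1 ler_nat; exact: Ab.
by rewrite ler_norml; apply/andP; split; lra.
Qed.

End Inversion.

Section CountInversion.
Context {d : nat}.
Variables (Sn : nat -> d.-tuple nat) (k : d.-tuple nat).
Hypothesis Sn_mono : forall p n, (p <= n)%N -> vle (Sn p) (Sn n).

Lemma count_bracket p b : vle (Sn p) k -> ~~ vle (Sn b) k ->
  (p <= nat_sup [set n | vle (Sn n) k] < b)%N.
Proof.
move=> Sp Sb; set A := [set n | _].
have Ab n : A n -> (n < b)%N.
  move=> An; rewrite ltnNge; apply: contra Sb => bn; apply/forallP => i.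
  have /forallP/(_ i) := Sn_mono bn; move/leq_trans; apply.
  by have /forallP := An.
have [An nmax] := @nat_supP A p b Sp Ab.
by rewrite (nmax p Sp) (Ab _ An).
Qed.

End CountInversion.

(** * Cycles of the split chain *)

Section ChainPaths.
Context {R : realType} {dX} {X : measurableType dX} {d : nat}.
Context {dO} {Om : measurableType dO}.
Variables (C : set X) (Z : nat -> Om -> X * bool * d.-tuple nat) (x0 : X).
Variable g : option X -> X -> d.-tuple nat -> R.

Local Notation E := (X * bool * d.-tuple nat)%type.

Definition coin (e : E) : bool := e.1.2.
Definition increment_of (r : 'I_d) (e e' : E) : R := (tnth e'.2 r)%:R.
Definition unit_time (e e' : E) : R := 1.
Definition reward_of (e e' : E) : R := g (collapse e.1.1 e.1.2) e'.1.1 e'.2.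
Definition abs_reward_of (e e' : E) : R := `|reward_of e e'|.

Local Notation e0 := (atom_step (d := d) x0).
Local Notation th := (regen coin e0).

Lemma increment_of_atom r (e e' : E) : coin e -> increment_of r e e' = increment_of r e0 e'.
Proof. by []. Qed.

Lemma reward_of_atom (e e' : E) : coin e -> reward_of e e' = reward_of e0 e'.
Proof. by case: e => -[x b] v; rewrite /coin/= => ->. Qed.

Lemma abs_reward_of_atom (e e' : E) : coin e -> abs_reward_of e e' = abs_reward_of e0 e'.
Proof. by move=> ce; rewrite /abs_reward_of reward_of_atom. Qed.

(** Almost sure properties under which the identities between cycles and path sums hold exactly: the
    truncated subtraction of increments never truncates, and no visit time takes its default
    value. *)
Definition regular_path (w : Om) : Prop :=
  [/\ (Z 0%N w).1.2 /\ (Z 0%N w).2 = vec0 d, forall n, (Z n w).1.2 -> C (Z n w).1.1,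
      forall n, vle (Z n w).2 (Z n.+1 w).2 & recurrent_path coin (step_path Z w)].

Section regular.
Variable w : Om.
Hypothesis reg : regular_path w.
Local Notation y := (step_path Z w).

Lemma coin_state_at n : coin (state_at e0 y n) = (Z n w).1.2.
Proof. by case: reg => -[c0 _] _ _ _; case: n => [|n] //=; rewrite c0. Qed.

Lemma in_atomE n : in_atom C Z n w <-> coin (state_at e0 y n).
Proof.
case: reg => _ cC _ _; rewrite coin_state_at /in_atom /J_ /chi; split=> [[]//|h].
by split => //; exact: cC.
Qed.

Lemma T_hit_time j : T_ C Z j w = hit_time coin e0 j y.
Proof.
case: reg => _ _ _ rec; elim: j => [//|j IH]; rewrite hit_timeS//= IH.
by congr (nat_inf _); apply/seteqP; split => n /= [h1 h2]; split => //; exact/in_atomE.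
Qed.

Lemma S_mono p n : (p <= n)%N -> vle (Z p w).2 (Z n w).2.
Proof.
case: reg => _ _ inc _ /subnKC <-; elim: (n - p)%N => [|j IH].
  by rewrite addn0; apply/forallP => i.
apply/forallP => i; rewrite addnS; have /forallP/(_ i) := inc (p + j)%N.
by apply: leq_trans; exact: (forallP IH i).
Qed.

Lemma T_lt j : (T_ C Z j w < T_ C Z j.+1 w)%N.
Proof. by case: reg => _ _ _ rec; rewrite !T_hit_time; exact: hit_time_lt. Qed.

Lemma path_sum_increment r n : path_sum e0 (increment_of r) y n = (tnth (Z n w).2 r)%:R.
Proof.
case: reg => -[_ s0] _ inc _; rewrite /path_sum.
elim: n => [|n IH]; first by rewrite big_nil s0 tnth_mktuple.
rewrite big_nat_recr//= IH /increment_of /= /last_step /incr /S_/= tnth_mktuple -natrD subnKC//.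
exact: (forallP (inc n) r).
Qed.

Lemma tnth_Csum r n : tnth (Csum C Z n w) r = tnth (Z (T_ C Z n w) w).2 r.
Proof.
case: reg => -[_ s0] _ inc _; rewrite tnth_mktuple.
elim: n => [|n IH]; first by rewrite big_nil /= s0 tnth_mktuple.
rewrite big_nat_recr//= IH /Y_ tnth_mktuple /S_ subnKC//.
exact: (forallP (S_mono (ltnW (T_lt n))) r).
Qed.

Lemma Csum_rsum r n : (tnth (Csum C Z n w) r)%:R = rsum th (cycle_sum coin e0 (increment_of r)) n y.
Proof.
case: (reg) => _ _ _ rec.
rewrite (rsum_cycle_sum (@increment_of_atom r))// -T_hit_time path_sum_increment.
by rewrite tnth_Csum.
Qed.

Lemma T_rsum n : (T_ C Z n w)%:R = rsum th (cycle_sum coin e0 unit_time) n y.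
Proof.
case: (reg) => _ _ _ rec.
rewrite (@rsum_cycle_sum _ _ _ _ _ unit_time)// -T_hit_time /path_sum.
by rewrite sumr_const_nat subn0.
Qed.

Lemma reward_path n : reward Z g n w = reward_of (state_at e0 y n) (state_at e0 y n.+1).
Proof.
case: reg => -[c0 _] _ _ _; case: n => [|n] //.
by rewrite /reward /reward_of /= /chi c0.
Qed.

Lemma reward_rsum n : \sum_(0 <= i < T_ C Z n w) reward Z g i w =
  rsum th (cycle_sum coin e0 reward_of) n y.
Proof.
case: (reg) => _ _ _ rec.
rewrite (rsum_cycle_sum reward_of_atom)// -T_hit_time /path_sum.
by apply: eq_bigr => i _; rewrite reward_path.
Qed.

Lemma abs_reward_rsum n : \sum_(0 <= i < T_ C Z n w) `|reward Z g i w| =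
  rsum th (cycle_sum coin e0 abs_reward_of) n y.
Proof.
case: (reg) => _ _ _ rec.
rewrite (rsum_cycle_sum abs_reward_of_atom)// -T_hit_time /path_sum.
by apply: eq_bigr => i _; rewrite reward_path.
Qed.

Lemma L1_cycle : (L_ C Z 1 w)%:R = cycle_sum coin e0 unit_time y.
Proof. by have := T_rsum 1; rewrite /= addr0 => <-; rewrite /L_ subn0. Qed.

Lemma Y1_cycle r : (tnth (Y_ C Z 1 w) r)%:R = cycle_sum coin e0 (increment_of r) y.
Proof.
have := Csum_rsum r 1; rewrite /= addr0 => <-.
by rewrite [in RHS]tnth_mktuple big_nat1.
Qed.

Lemma R1_cycle : Rcycle C Z g 1 w = cycle_sum coin e0 reward_of y.
Proof. by have := reward_rsum 1; rewrite /= addr0 => <-. Qed.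

Lemma R1_abs_cycle : Rcycle_abs C Z g 1 w = cycle_sum coin e0 abs_reward_of y.
Proof. by have := abs_reward_rsum 1; rewrite /= addr0 => <-. Qed.

End regular.

Hypothesis mC : measurable C.
Hypothesis mZ : forall n, measurable_fun setT (Z n).
Hypothesis mlast : forall n, measurable_fun setT (last_step Z n).
Hypothesis mg : measurable_reward g.

Lemma measurable_reward_of : measurable_fun setT (fun z : E * E => reward_of z.1 z.2).
Proof.
have [mS mN] := mg.
have mJ : measurable_fun setT (fun z : E * E => z.1.1.1).
  apply: (measurableT_comp (f := fun e : E => e.1.1)) => //.
  exact: (measurableT_comp measurable_fst measurable_fst).
have mb : measurable_fun setT (fun z : E * E => z.1.1.2).
  apply: (measurableT_comp (f := fun e : E => e.1.2)) => //.
  exact: (measurableT_comp measurable_snd measurable_fst).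
have mJ' : measurable_fun setT (fun z : E * E => z.2.1.1).
  apply: (measurableT_comp (f := fun e : E => e.1.1)) => //.
  exact: (measurableT_comp measurable_fst measurable_fst).
have mk : measurable_fun setT (fun z : E * E => z.2.2).
  exact: (measurableT_comp measurable_snd measurable_snd).
rewrite (_ : (fun z : E * E => _) = fun z : E * E =>
  if z.1.1.2 then g None z.2.1.1 z.2.2 else g (Some z.1.1.1) z.2.1.1 z.2.2); last first.
  by apply/funext => -[[[x b] v] e'] /=; rewrite /reward_of/=; case: b.
apply: measurable_fun_ifT => //.
- exact: (measurableT_comp mN (measurable_fun_pair mJ' mk)).
- exact: (measurableT_comp mS (measurable_fun_pair (measurable_fun_pair mJ mJ') mk)).
Qed.

Lemma measurable_abs_reward_of : measurable_fun setT (fun z : E * E => abs_reward_of z.1 z.2).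
Proof. exact: (measurableT_comp (@normr_measurable R setT) measurable_reward_of). Qed.

Lemma measurable_increment_of r : measurable_fun setT (fun z : E * E => increment_of r z.1 z.2).
Proof.
have mt : measurable_fun setT (fun v : d.-tuple nat => (tnth v r)%:R : R).
  by apply: measurable_discrete => ?; exact: measurable_nat_vector.
have m2 : measurable_fun setT (fun z : E * E => z.2.2).
  exact: (measurableT_comp measurable_snd measurable_snd).
exact: (measurableT_comp mt m2).
Qed.

Lemma measurable_unit_time : measurable_fun setT (fun z : E * E => unit_time z.1 z.2).
Proof. exact: measurable_cst. Qed.

(* T_1 is the return time of the path of the chain itself. *)
Lemma measurable_T1_eq n : measurable [set w | T_ C Z 1 w = n].
Proof.
pose at_ (e : E) := (e.1.1 \in C) && e.1.2.
pose p w : path_space E := fun n => Z n.+1 w.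
have mp : measurable_fun setT p by apply: measurable_to_path => i; exact: mZ.
have mat_ : measurable [set e | at_ e].
  rewrite (_ : [set e | at_ e] = (C `*` [set true]) `*` setT).
    by apply: measurableX => //; exact: measurableX.
  apply/seteqP; split => -[[x b] v]; rewrite /at_/=; first by move=> /andP[/set_mem ? ->].
  by move=> [[/= Cx ->] _]; rewrite mem_set.
rewrite (_ : [set w | _] = p @^-1` [set y | return_time at_ e0 y = n]).
  by apply: measurable_preimageT => //; exact: measurable_return_time_eq.
suff TE w : T_ C Z 1 w = return_time at_ e0 (p w) by apply/seteqP; split => w /=; rewrite -TE.
rewrite /= /return_time; congr (nat_inf _); apply/seteqP; split => -[|i] /=.
- by case.
- by move=> [_ [Ci bi]]; split => //; rewrite /at_ mem_set.
- by case.
- by move=> [_ /andP[/set_mem Ci bi]].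
Qed.

Lemma measurable_by_T1 d' (T : measurableType d') (F : nat -> Om -> T) :
  (forall n, measurable_fun setT (F n)) -> measurable_fun setT (fun w => F (T_ C Z 1 w) w).
Proof.
move=> mF _ A mA; rewrite setTI.
rewrite (_ : _ @^-1` A = \bigcup_n ([set w | T_ C Z 1 w = n] `&` F n @^-1` A)).
  apply: bigcupT_measurable => n; apply: measurableI; first exact: measurable_T1_eq.
  exact: measurable_preimageT.
apply/seteqP; split => w; first by move=> Aw; exists (T_ C Z 1 w).
by move=> [n _ [/= <-]].
Qed.

Lemma measurable_L1 : measurable_fun setT (fun w => (L_ C Z 1 w)%:R : R).
Proof.
rewrite (_ : (fun w => _) = fun w => (fun n (_ : Om) => n%:R : R) (T_ C Z 1 w) w).
  by apply: (@measurable_by_T1 _ R (fun n (_ : Om) => n%:R : R)) => n; exact: measurable_cst.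
by apply/funext => w; rewrite /L_ subn0.
Qed.

Lemma measurable_Y1 r : measurable_fun setT (fun w => (tnth (Y_ C Z 1 w) r)%:R : R).
Proof.
pose F n w : R := (tnth (vsub (Z n w).2 (Z 0%N w).2) r)%:R.
apply: (@measurable_by_T1 _ _ F) => n.
have mpair : measurable_fun setT (fun w => ((Z n w).2, (Z 0%N w).2)).
  by apply: measurable_fun_pair; apply: (measurableT_comp measurable_snd); exact: mZ.
have mt : measurable_fun setT (fun u : d.-tuple nat * d.-tuple nat =>
    (tnth (vsub u.1 u.2) r)%:R : R).
  apply: measurable_fun_discrete => [|?|v]; [exact: countableP|exact: measurable_nat_vector|].
  by apply: measurable_discrete => ?; exact: measurable_nat_vector.
exact: (measurableT_comp mt mpair).
Qed.

Lemma measurable_reward_n n : measurable_fun setT (reward Z g n).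
Proof. exact: (measurableT_comp measurable_reward_of (measurable_fun_pair (mZ n) (mlast n.+1))). Qed.

Lemma measurable_R1 : measurable_fun setT (Rcycle C Z g 1).
Proof.
pose F n w : R := \sum_(0 <= i < n) reward Z g i w.
apply: (@measurable_by_T1 _ _ F) => n; apply: measurable_sum => i; exact: measurable_reward_n.
Qed.

Lemma measurable_R1_abs : measurable_fun setT (Rcycle_abs C Z g 1).
Proof.
pose F n w : R := \sum_(0 <= i < n) `|reward Z g i w|.
apply: (@measurable_by_T1 _ _ F) => n; apply: measurable_sum => i.
exact: (measurableT_comp (@normr_measurable R setT) (measurable_reward_n i)).
Qed.

End ChainPaths.

(** * The four processes at finite time *)

Section Bounds.
Context {R : realType}.

Lemma index_bound (s z q n n0 tk eta : R) : `|n - n0 - s * z| <= eta * s + 1 ->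
  n0 <= tk -> tk < n0 + 1 -> `|q * (n - tk - s * z)| <= `|q| * (eta * s + 2).
Proof.
rewrite normrM ler_norml => /andP[h1 h2] h3 h4; apply: ler_wpM2l => //.
by rewrite ler_norml; apply/andP; split; lra.
Qed.

Lemma window_bound (s z n n0 eta K : R) : 0 < s -> `|n - n0 - s * z| <= eta * s + 1 ->
  `|z| * s + eta * s + 2 <= K * s -> `|n - n0| <= K * s /\ `|n + 1 - n0| <= K * s.
Proof.
move=> s0; rewrite ler_norml => /andP[h1 h2] h3.
have zs : `|s * z| = `|z| * s by rewrite normrM mulrC (gtr0_norm s0).
have : `|s * z| <= `|z| * s by rewrite zs.
rewrite ler_norml => /andP[z1 z2]; rewrite !ler_norml.
by split; apply/andP; split; lra.
Qed.

(** [T0], [T1], [T2] are the ends of the cycles [n0], [n] and [n + 1]; the count lies between the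
    last two, which differ by [ell] up to the linearization errors. *)
Lemma count_bound (s v T0 T1 T2 N ell z n n0 tk ds B : R) :
  s * v = T0 - n0 * ell -> `|T1 - T0 - (n - n0) * ell| <= ds ->
  `|T2 - T0 - (n + 1 - n0) * ell| <= ds -> T1 <= N -> N <= T2 ->
  `|ell * (n - tk - s * z)| <= B ->
  `|s * (v + ell * z) - (N - tk * ell)| <= B + ds + `|ell|.
Proof.
move=> sv; rewrite !ler_norml => /andP[? ?] /andP[? ?] ? ? /andP[? ?].
have e1 := ler_norm ell; have e2 := ler_norm (- ell); rewrite normrN in e2.
by rewrite mulrDr sv; apply/andP; split; lra.
Qed.

(** [A0], [A1], [A2] are sums of absolute rewards: the incomplete cycle contributes at most
    [A2 - A1], which by linearity of these sums is [aA] up to [2 ds]. *)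
Lemma reward_bound (s v r0 r1 A0 A1 A2 Q a aA z n n0 tk ds B : R) :
  s * v = r0 - n0 * a -> `|r1 - r0 - (n - n0) * a| <= ds ->
  `|A1 - A0 - (n - n0) * aA| <= ds -> `|A2 - A0 - (n + 1 - n0) * aA| <= ds ->
  `|Q - r1| <= A2 - A1 -> `|a * (n - tk - s * z)| <= B ->
  `|s * (v + a * z) - (Q - tk * a)| <= B + 3 * ds + `|aA|.
Proof.
move=> sv; rewrite !ler_norml => /andP[? ?] /andP[? ?] /andP[? ?] /andP[? ?] /andP[? ?].
have e1 := ler_norm aA.
by rewrite mulrDr sv; apply/andP; split; lra.
Qed.

Lemma active_bound (k tl s h m kap t n0 d0 mx : R) :
  `|k - t * (kap * m) - s * h| <= d0 / 2 * s -> 0 < m -> m <= mx -> 2 * mx <= s * d0 ->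
  n0 <= t * kap -> t * kap < n0 + 1 -> `|k - n0 * m - s * h| <= d0 * s.
Proof.
move=> + m0 mr sm h1 h2; rewrite !ler_norml => /andP[? ?].
have p1 : 0 <= (t * kap - n0) * m by rewrite mulr_ge0 ?subr_ge0// ltW.
have p2 : (t * kap - n0) * m <= 1 * m by apply: ler_wpM2r; [exact: ltW|lra].
by apply/andP; split; lra.
Qed.

(** An inactive coordinate has the surplus [t (lam - kap m) >= t c]. As [t = s^2], this is [s (s c)]
    and exceeds the other terms, which are of order [s], once [s c] dominates their coefficients. *)
Lemma inactive_bound (k lam s h m kap t n0 d0 mx v K K0 c M : R) : 0 < s -> s ^+ 2 = t ->
  `|k - t * lam - s * h| <= d0 / 2 * s -> 0 < d0 -> 0 < m -> m <= mx -> 0 < K ->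
  K0 + K * mx + d0 + `|M| + d0 <= s * c -> c <= lam - kap * m -> n0 <= t * kap ->
  `|v| <= K0 -> `|h| <= M -> n0 * m + s * v + K * s * m + d0 * s <= k.
Proof.
move=> s0 tE; rewrite ler_norml => /andP[h1 _] d00 m0 mr K_0 sc cr n0le vK hM.
have t0 : 0 <= t by rewrite -tE sqr_ge0.
have p1 : 0 <= (t * kap - n0) * m by rewrite mulr_ge0 ?subr_ge0// ltW.
have p2 : t * c <= t * (lam - kap * m) by exact: ler_wpM2l.
have p3 : s * (K0 + K * mx + d0 + `|M| + d0) <= s * (s * c) by apply: ler_wpM2l => //; exact: ltW.
have p4 : s * v <= s * K0.
  by apply: ler_wpM2l; [exact: ltW|exact: le_trans (ler_norm _) vK].
have p5 : s * (K * m) <= s * (K * mx).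
  by apply: ler_wpM2l; [exact: ltW|apply: ler_wpM2l => //; exact: ltW].
have p6 : s * - h <= s * `|M|.
  apply: ler_wpM2l; first exact: ltW.
  by rewrite (le_trans (ler_norm _))// normrN (le_trans hM)// ler_norm.
have p7 : s * (s * c) = t * c by rewrite -tE; ring.
have p8 : 0 <= s * d0 by rewrite mulr_ge0// ltW.
lra.
Qed.

Lemma le_sum5 (x1 x2 x3 x4 s : R) : 0 <= x1 -> 0 <= x2 -> 0 <= x3 -> 0 <= x4 ->
  x1 + x2 + x3 + x4 + 1 <= s -> [/\ 1 <= s, x1 <= s, x2 <= s, x3 <= s & x4 <= s].
Proof. by move=> *; split; lra. Qed.

Lemma window_sum (z b s eta : R) : 1 <= s -> z * s <= b * s ->
  z * s + eta * s + 2 <= (b + eta + 2) * s.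
Proof. by move=> *; lra. Qed.

Lemma large_index (K s n0 tk : R) : 1 <= s -> tk < n0 + 1 -> s * (K + 1) <= tk -> K * s <= n0.
Proof. by move=> *; lra. Qed.

Lemma eta_bound (q x y : R) : q * x <= y -> q * (x + 2) <= y + 2 * q.
Proof. by move=> *; lra. Qed.

Lemma final_bounds (x y s dl L a A : R) : 0 <= L -> 0 <= a -> 0 <= A ->
  4 * (2 + 3 * L + 2 * a + A) <= s * dl -> x <= dl / 4 * s -> y <= dl / 12 * s ->
  [/\ x + 2 <= dl * s, dl / 4 * s + 2 * L + y + L <= dl * s &
     dl / 4 * s + 2 * a + 3 * y + A <= dl * s].
Proof. by move=> *; split; lra. Qed.

End Bounds.

Lemma uniform_approx_near {R : realType} {d : nat} (lam : 'rV[R]_d) (H : set 'rV[R]_d)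
    (k : R -> 'rV[R]_d -> d.-tuple nat) (e : R) : uniform_approx H lam k -> 0 < e -> \forall t \near +oo, forall h, H h -> forall r,
  `|(tnth (k t h) r)%:R - t * lam ord0 r - Num.sqrt t * h ord0 r| <= e * Num.sqrt t.
Proof.
move=> k_approx e0; apply: filterS (k_approx _ e0) => t kt h Hh r; rewrite -lee_fin.
apply: le_trans kt; apply: le_trans (ereal_sup_ubound _); last by exists h.
by rewrite lee_fin (bigD1 r)//= lerDl sumr_ge0.
Qed.

Section MainEstimate.
Context {R : realType} {d : nat} {dT} {T : measurableType dT} (mu : probability T R).
Variable th : T -> T.
Hypotheses (mth : measurable_fun setT th)
  (pres : forall A, measurable A -> mu (th @^-1` A) = mu A).

Lemma locally_linear_all (I : eqType) (xi : I -> T -> R) (l : seq I) (kap L dl e : R) :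
  (forall i, locally_linear mu th (xi i)) -> 0 < kap -> 0 < L -> 0 < dl -> 0 < e ->
  \forall t \near +oo, exists2 B : set T, measurable B & fine (mu B) <= e /\
    forall x, ~ B x -> forall i, i \in l ->
    forall n, `|n%:R - (Num.truncn (t * kap))%:R| <= L * Num.sqrt t ->
      `|rsum th (xi i) n x - rsum th (xi i) (Num.truncn (t * kap)) x -
        (n%:R - (Num.truncn (t * kap))%:R) * \int[mu]_x xi i x| <= dl * Num.sqrt t.
Proof.
move=> ll k0 L0 dl0; elim: l e => [|j l IH] e e0.
  by near=> t; exists set0 => //; rewrite measure0 ltW.
have e2 : 0 < e / 2 by rewrite divr_gt0.
have N1 := locally_linear_shift mth pres (ll j) k0 L0 dl0 e2.
near=> t.
have [B1 mB1 [P1 H1]] : exists2 B : set T, measurable B & fine (mu B) <= e / 2 /\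
    forall x, ~ B x -> forall n, `|n%:R - (Num.truncn (t * kap))%:R| <= L * Num.sqrt t ->
      `|rsum th (xi j) n x - rsum th (xi j) (Num.truncn (t * kap)) x -
        (n%:R - (Num.truncn (t * kap))%:R) * \int[mu]_x xi j x| <= dl * Num.sqrt t.
  by near: t.
have [B2 mB2 [P2 H2]] : exists2 B : set T, measurable B & fine (mu B) <= e / 2 /\
    forall x, ~ B x -> forall i, i \in l ->
    forall n, `|n%:R - (Num.truncn (t * kap))%:R| <= L * Num.sqrt t ->
      `|rsum th (xi i) n x - rsum th (xi i) (Num.truncn (t * kap)) x -
        (n%:R - (Num.truncn (t * kap))%:R) * \int[mu]_x xi i x| <= dl * Num.sqrt t.
  by near: t; exact: IH.
exists (B1 `|` B2); first exact: measurableU.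
split; first by rewrite (le_trans (fine_measureU mu mB1 mB2))//; lra.
move=> x nB i; rewrite inE => /orP[/eqP->|il] n nL.
  by apply: H1 => // b; apply: nB; left.
by apply: H2 => // b; apply: nB; right.
Unshelve. all: by end_near. Qed.

Lemma positive_lower_bound (A : {set 'I_d}) (f : 'I_d -> R) : (forall i, i \in A -> 0 < f i) ->
  exists2 b, 0 < b & forall i, i \in A -> b <= f i.
Proof.
(* There may be no inactive coordinate, and then any bound will do. *)
move=> f0; have [->|[i0 Ai0]] := set_0Vmem A; first by exists 1 => // i; rewrite inE.
have [[i Ai fi] fmin] := min_overP f Ai0.
by exists (min_over A f) => //; rewrite fi; exact: f0.
Qed.

Variables (m lam : 'rV[R]_d).
Hypotheses (d_ge1 : (1 <= d)%N) (m_gt0 : forall r, 0 < m ord0 r) (lam_gt0 : forall r, 0 < lam ord0 r).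
Local Notation kap := (kappa m lam).
Local Notation I := (argmin_set m lam).

Lemma kappa_attained : exists2 i, i \in I & kap = lam ord0 i / m ord0 i.
Proof.
have i1 : Ordinal d_ge1 \in [set: 'I_d]%SET by rewrite inE.
have [[i _ fi] fmin] := min_overP (fun r => lam ord0 r / m ord0 r) i1.
by exists i => //; rewrite inE /kappa fi.
Qed.

Lemma kappa_gt0 : 0 < kap.
Proof. by have [i _ ->] := kappa_attained; rewrite divr_gt0. Qed.

Lemma kappa_active r : r \in I -> lam ord0 r = kap * m ord0 r.
Proof. by rewrite inE => /eqP <-; rewrite divfK// gt_eqF. Qed.

Lemma kappa_inactive r : r \notin I -> 0 < lam ord0 r - kap * m ord0 r.
Proof.
rewrite inE => ne; have i1 : r \in [set: 'I_d]%SET by rewrite inE.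
have [_ fmin] := min_overP (fun r => lam ord0 r / m ord0 r) i1.
by rewrite subr_gt0 -ltr_pdivlMr// lt_neqAle eq_sym ne fmin.
Qed.

Lemma zeta_bound (v : 'I_d -> R) (h : 'rV[R]_d) (M b : R) : 0 < b -> (forall r, b <= m ord0 r) ->
  (forall r, `|h ord0 r - v r| <= M) -> `|zeta m lam v h| <= M / b.
Proof.
move=> b0 bm hM; have [i Ii _] := kappa_attained.
have [[j _ zj] _] := min_overP (fun r => (h ord0 r - v r) / m ord0 r) Ii.
rewrite /zeta zj normrM normfV (gtr0_norm (m_gt0 j)).
rewrite ler_pM ?invr_ge0 ?(ltW (m_gt0 j))//.
by rewrite lef_pV2 ?posrE ?bm.
Qed.

Variables (xi : 'I_(d + 2) -> T -> R) (xiA : T -> R).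
Local Notation mean i := (\int[mu]_x xi i x).
Local Notation meanA := (\int[mu]_x xiA x).
Local Notation iL := (rshift d (ord0 : 'I_2)).
Local Notation iR := (rshift d (ord_max : 'I_2)).
Hypothesis mxi : forall i, measurable_fun setT (xi i).
Hypothesis ll : forall i, locally_linear mu th (xi i).
Hypothesis llA : locally_linear mu th xiA.
Hypothesis mE : forall r, m ord0 r = mean (lshift 2 r).

Definition renewal_fluctuation (t : R) (x : T) : 'rV[R]_(d + 2) :=
  \row_i ((Num.sqrt t)^-1 * (rsum th (xi i) (Num.truncn (t * kap)) x -
    (Num.truncn (t * kap))%:R * mean i)).
Local Notation V := renewal_fluctuation.

Hypothesis tightV : tight mu V.

Context {dO} {Om : measurableType dO} (Pa : probability Om R) (y : Om -> T).
Hypotheses (my : measurable_fun setT y)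
  (lawy : forall A, measurable A -> Pa (y @^-1` A) = mu A).
Variables (Cs : nat -> Om -> d.-tuple nat) (Ts : nat -> Om -> nat)
  (Nt : d.-tuple nat -> Om -> nat) (Rt : d.-tuple nat -> Om -> R) (reg : Om -> Prop).
Hypothesis reg_ae : {ae Pa, forall w, reg w}.
Hypothesis Cs_mono : forall w, reg w -> forall p n, (p <= n)%N -> vle (Cs p w) (Cs n w).
Hypothesis CsE : forall w, reg w -> forall r n,
  (tnth (Cs n w) r)%:R = rsum th (xi (lshift 2 r)) n (y w).
Hypothesis TsE : forall w, reg w -> forall n, (Ts n w)%:R = rsum th (xi iL) n (y w).
Hypothesis Nt_bracket : forall w, reg w -> forall k n, vle (Cs n w) k -> ~~ vle (Cs n.+1 w) k ->
  (Ts n w <= Nt k w < Ts n.+1 w)%N.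
Hypothesis Rt_near : forall w, reg w -> forall k n, vle (Cs n w) k -> ~~ vle (Cs n.+1 w) k ->
  `|Rt k w - rsum th (xi iR) n (y w)| <= rsum th xiA n.+1 (y w) - rsum th xiA n (y w).

Variables (H : set 'rV[R]_d) (k : R -> 'rV[R]_d -> d.-tuple nat) (M : R).
Hypothesis H_bounded : forall h, H h -> forall r, `|h ord0 r| <= M.
Hypothesis k_approx : uniform_approx H lam k.

Local Notation Ncyc k w := (nat_sup [set n | vle (Cs n w) k]).
Local Notation VY t w := (fun r => V t (y w) ord0 (lshift 2 r)).

(** The exceptional event gathers three causes: nonlinear cycle sums on the window, a fluctuation
    outside of the box, and an irregular path. Off this event the argument is deterministic and
    uniform in [h]. Cycle ends, counts and rewards enter only through the relations assumed
    above. *)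
Lemma main_estimate (dl e : R) : 0 < dl -> 0 < e -> \forall t \near +oo,
  exists2 B : set Om, measurable B & fine (Pa B) <= e /\ forall w, ~ B w -> forall h, H h ->
    let z := zeta m lam (VY t w) h in
    [/\ `|z - ((Ncyc (k t h) w)%:R - t * kap) / Num.sqrt t| <= dl,
        `|V t (y w) ord0 iL + mean iL * z -
           ((Nt (k t h) w)%:R - t * mean iL * kap) / Num.sqrt t| <= dl &
        `|V t (y w) ord0 iR + mean iR * z -
           (Rt (k t h) w - t * mean iR * kap) / Num.sqrt t| <= dl].
Proof.
move=> dl0 e0.
have [i0 Ii0 _] := kappa_attained.
have [b b0 bm] : exists2 b, 0 < b & forall i, i \in [set: 'I_d]%SET -> b <= m ord0 i.
  by apply: positive_lower_bound.
have {}bm r : b <= m ord0 r by apply: bm; rewrite inE.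
have [c c0 cm] : exists2 b, 0 < b & forall i, i \in (~: I)%SET -> b <= lam ord0 i - kap * m ord0 i.
  by apply: positive_lower_bound => i; rewrite inE; exact: kappa_inactive.
pose mx := \sum_r m ord0 r.
have mxm r : m ord0 r <= mx.
  by rewrite /mx (bigD1 r)//= lerDl sumr_ge0// => i _; exact: ltW.
have mx0 : 0 <= mx by rewrite sumr_ge0// => i _; exact: ltW.
have k0 := kappa_gt0.
have e2 : 0 < e / 2 by rewrite divr_gt0.
have [K0 K00 tV] := tightV e2.
set a := mean iR; set ell := mean iL.
(* An error in the number of cycles enters with factor 1, [ell] or [a], each at most [D] in
   modulus. *)
pose D := 1 + `|ell| + `|a|.
have D0 : 0 < D by rewrite /D; have := normr_ge0 ell; have := normr_ge0 a; lra.
pose eta := dl / (4 * D).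
have eta0 : 0 < eta by rewrite divr_gt0// mulr_gt0.
have etaD : eta * D = dl / 4 by rewrite /eta; field; rewrite gt_eqF.
(* The first bound is what [inversion] asks for, [2 dt < eta m_r]; the second lets three
   linearization errors fit into [dl / 4]. *)
pose dt := Num.min (eta * b / 3) (dl / 12).
have dt0 : 0 < dt by rewrite lt_min !divr_gt0// mulr_gt0.
have dt1 : dt <= eta * b / 3 by rewrite ge_min lexx.
have dsm r : 2 * dt < eta * m ord0 r.
  have : eta * b <= eta * m ord0 r by rewrite ler_pM2l.
  lra.
have dt2 : dt <= dl / 12 by rewrite ge_min lexx orbT.
(* Half width of the window in units of [sqrt t]: [zeta] is at most [(|M| + K0) / b] for
   fluctuations in the box, and [inversion] asks for at most [eta + 2] beyond it. *)
pose K := (`|M| + K0) / b + eta + 2.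
have Kgt0 : 0 < K.
  have : 0 <= (`|M| + K0) / b by rewrite divr_ge0 ?(ltW b0)// addr_ge0 ?normr_ge0 ?(ltW K00).
  by rewrite /K => ?; lra.
(* The index [None] stands for the absolute rewards, which have no component in the cycle vector. *)
pose xio (i : option 'I_(d + 2)) := if i is Some j then xi j else xiA.
have llo i : locally_linear mu th (xio i) by case: i.
have nearB := @locally_linear_all _ xio (None :: map Some (enum 'I_(d + 2))) kap K dt (e / 2) llo
  k0 Kgt0 dt0 e2.
have dt02 : 0 < dt / 2 by rewrite divr_gt0.
have nearK := uniform_approx_near k_approx dt02.
(* A sum, rather than a maximum, of the lower bounds needed for [sqrt t]; [le_sum5] takes it
   apart. *)
pose A1 := 2 * mx / dt + (K + 1) / kap + (K0 + K * mx + dt + `|M| + dt) / c +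
  4 * (2 + 3 * `|ell| + 2 * `|a| + `|meanA|) / dl + 1.
near=> t.
have sA : A1 <= Num.sqrt t by near: t; exact: sqrt_near.
have t0 : 0 <= t by near: t; apply: nbhs_pinfty_ge; exact: num_real.
have tE := sqr_sqrtr t0.
have hk : forall h, H h -> forall r, `|(tnth (k t h) r)%:R - t * lam ord0 r - Num.sqrt t * h ord0 r|
    <= dt / 2 * Num.sqrt t by near: t.
have [B1 mB1 [PB1 H1]] : exists2 B : set T, measurable B & fine (mu B) <= e / 2 /\
    forall x, ~ B x -> forall i, i \in None :: map Some (enum 'I_(d + 2)) ->
    forall n, `|n%:R - (Num.truncn (t * kap))%:R| <= K * Num.sqrt t ->
      `|rsum th (xio i) n x - rsum th (xio i) (Num.truncn (t * kap)) x -
        (n%:R - (Num.truncn (t * kap))%:R) * \int[mu]_x xio i x| <= dt * Num.sqrt t.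
  by near: t.
have PV : fine (mu [set x | ~ box K0 (V t x)]) <= e / 2 by near: t.
have mV i : measurable_fun setT (fun x => V t x ord0 i).
  under eq_fun do rewrite mxE.
  apply: measurable_funM; first exact: measurable_cst.
  by apply: measurable_funB; [exact: measurable_rsum|exact: measurable_cst].
have mBox : measurable [set x | ~ box K0 (V t x)].
  by apply: measurableC; exact: measurable_box.
have [N [mN N0 Nreg]] := reg_ae.
exists ((y @^-1` (B1 `|` [set x | ~ box K0 (V t x)])) `|` N).
  by apply: measurableU => //; apply: measurable_preimageT => //; exact: measurableU.
split.
  rewrite measureU0//; last by apply: measurable_preimageT => //; exact: measurableU.
  apply: (@le_trans _ _ (fine (mu (B1 `|` [set x | ~ box K0 (V t x)])))).
    by rewrite le_eqVlt -lawy ?eqxx//; exact: measurableU.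
  by rewrite (le_trans (fine_measureU mu mB1 mBox))// [leRHS](splitr e) lerD.
move=> w nB h Hh.
have rw : reg w by apply: contrapT => nr; apply: nB; right; exact: Nreg.
have nB1 : ~ B1 (y w) by move=> b1; apply: nB; left; left.
have boxV : box K0 (V t (y w)) by apply: contrapT => nb; apply: nB; left; right.
have {hk} hk := hk h Hh.
have hM := H_bounded Hh.
have ms0 : 0 <= 2 * mx / dt by rewrite divr_ge0 ?mulr_ge0 ?(ltW dt0).
have Ks0 : 0 <= (K + 1) / kap by rewrite divr_ge0 ?(ltW k0)// addr_ge0 ?(ltW Kgt0).
have cs0 : 0 <= (K0 + K * mx + dt + `|M| + dt) / c.
  by rewrite divr_ge0 ?(ltW c0)// !addr_ge0 ?mulr_ge0 ?(ltW K00) ?(ltW Kgt0) ?(ltW dt0).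
have ds0 : 0 <= 4 * (2 + 3 * `|ell| + 2 * `|a| + `|meanA|) / dl.
  by rewrite divr_ge0 ?(ltW dl0)// mulr_ge0 ?addr_ge0 ?mulr_ge0.
have [s1 sm sK sc sd] := le_sum5 ms0 Ks0 cs0 ds0 sA.
rewrite ler_pdivrMr// in sm; rewrite ler_pdivrMr// in sK.
rewrite ler_pdivrMr// in sc; rewrite ler_pdivrMr// in sd.
have s0 : 0 < Num.sqrt t := lt_le_trans ltr01 s1.
have VE i : Num.sqrt t * V t (y w) ord0 i = rsum th (xi i) (Num.truncn (t * kap)) (y w) -
    (Num.truncn (t * kap))%:R * mean i.
  by rewrite mxE mulrA divff ?mul1r// gt_eqF.
have n0le : (Num.truncn (t * kap))%:R <= t * kap.
  by rewrite truncn_le// mulr_ge0// ltW.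
have n0gt : t * kap < (Num.truncn (t * kap))%:R + 1 by rewrite natr1 truncnS_gt.
move: (Num.truncn (t * kap)) n0le n0gt VE H1 => n0 n0le n0gt VE H1.
have {}H1 := H1 _ nB1.
move: (Num.sqrt t) s0 s1 sm sK sc sd tE hk VE H1 => s s0 s1 sm sK sc sd tE hk VE H1.
have HI j n : `|n%:R - n0%:R| <= K * s ->
    `|rsum th (xi j) n (y w) - rsum th (xi j) n0 (y w) - (n%:R - n0%:R) * mean j| <= dt * s.
  by move=> nn; apply: (H1 (Some j)) => //; rewrite inE /= map_f ?mem_enum.
have HA n : `|n%:R - n0%:R| <= K * s ->
    `|rsum th xiA n (y w) - rsum th xiA n0 (y w) - (n%:R - n0%:R) * meanA| <= dt * s.
  by move=> nn; apply: (H1 None) => //; rewrite inE.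
have VK r : `|V t (y w) ord0 (lshift 2 r)| <= K0 by exact: boxV.
have zb : `|zeta m lam (VY t w) h| <= (`|M| + K0) / b.
  apply: zeta_bound => // r; apply: le_trans (ler_normB _ _) _; rewrite lerD//.
  exact: le_trans (hM r) (ler_norm _).
have Cn_near r n : `|n%:R - n0%:R| <= K * s ->
    `|(tnth (Cs n w) r)%:R - n0%:R * m ord0 r - s * V t (y w) ord0 (lshift 2 r) -
      (n%:R - n0%:R) * m ord0 r| <= dt * s.
  move=> nn; rewrite CsE// VE mE.
  rewrite (_ : _ - _ = rsum th (xi (lshift 2 r)) n (y w) - rsum th (xi (lshift 2 r)) n0 (y w) -
    (n%:R - n0%:R) * mean (lshift 2 r)); last by ring.
  exact: HI.
have kact r : r \in I -> `|(tnth (k t h) r)%:R - n0%:R * m ord0 r - s * h ord0 r| <= dt * s.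
  move=> /kappa_active lr; have := hk r; rewrite lr => hkr.
  exact: (active_bound 0 hkr (m_gt0 r) (mxm r) sm n0le n0gt).
have kina r : r \notin I -> n0%:R * m ord0 r + s * V t (y w) ord0 (lshift 2 r) +
    K * s * m ord0 r + dt * s <= (tnth (k t h) r)%:R.
  move=> rI; have cr : c <= lam ord0 r - kap * m ord0 r by apply: cm; rewrite inE.
  exact: (inactive_bound s0 tE (hk r) dt0 (m_gt0 r) (mxm r) Kgt0 sc cr n0le (VK r) (hM r)).
set z := zeta m lam (VY t w) h in zb *.
have win : `|z| * s + eta * s + 2 <= K * s.
  have zbs : `|z| * s <= (`|M| + K0) / b * s by exact: (ler_wpM2r (ltW s0) zb).
  exact: window_sum.
have n0K : K * s <= n0%:R.
  apply: (large_index s1 n0gt); rewrite -tE -mulrA.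
  exact: (ler_wpM2l (ltW s0) sK).
have [An nAn zn] := inversion m_gt0 s0 Ii0 (Cs_mono rw) Cn_near kact kina eta0 dsm win n0K.
rewrite -[min_over _ _]/z in zn.
move/negP: nAn => nAn.
have := Nt_bracket rw An nAn; have := Rt_near rw An nAn.
move: (nat_sup _) An nAn zn => n An nAn zn Rn Tn.
have [nn nn1] := window_bound s0 zn win; rewrite natr1 in nn1.
have qB q := index_bound q zn n0le n0gt.
have scale u v : `|s * u - v| <= dl * s -> `|u - v / s| <= dl.
  move=> uv; rewrite -(ler_pM2r s0) -{2}(gtr0_norm s0) -normrM mulrBl divfK ?gt_eqF//.
  by rewrite mulrC.
have etaM q : `|q| <= D -> `|q| * (eta * s) <= dl / 4 * s.
  move=> qD; rewrite mulrA -etaD; apply: ler_wpM2r; first exact: ltW.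
  by rewrite mulrC; apply: ler_wpM2l => //; exact: ltW.
have eB q : `|q| <= D -> `|q| * (eta * s + 2) <= dl / 4 * s + 2 * `|q|.
  by move=> /etaM; exact: eta_bound.
have dts : dt * s <= dl / 12 * s by exact: (ler_wpM2r (ltW s0) dt2).
have [e1 [eL ea]] : eta * s <= dl / 4 * s /\
    (`|ell| * (eta * s + 2) <= dl / 4 * s + 2 * `|ell| /\
     `|a| * (eta * s + 2) <= dl / 4 * s + 2 * `|a|).
  have ell0 := normr_ge0 ell; have a0 := normr_ge0 a.
  split; first by rewrite -[leLHS]mul1r -[X in X * _]normr1 etaM// normr1 /D -addrA lerDl addr_ge0.
  by split; apply: eB; rewrite /D; [rewrite addrAC lerDr addr_ge0|rewrite lerDr addr_ge0].
have [f1 f2 f3] := final_bounds (normr_ge0 ell) (normr_ge0 a) (normr_ge0 meanA) sd e1 dts.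
split; apply: scale.
- rewrite distrC -[X in `|X|](opprK) normrN.
  have -> : - ((n%:R - t * kap) - s * z) = - (1 * (n%:R - t * kap - s * z)) by ring.
  rewrite normrN; apply: (le_trans (qB 1)); rewrite normr1 mul1r; exact: f1.
- have [T1 T2] : (Ts n w)%:R <= (Nt (k t h) w)%:R :> R /\
      (Nt (k t h) w)%:R <= (Ts n.+1 w)%:R :> R.
    by move: Tn => /andP[T1 /ltnW T2]; split; rewrite ler_nat.
  have h1 : `|(Ts n w)%:R - (Ts n0 w)%:R - (n%:R - n0%:R) * ell| <= dt * s.
    by rewrite !TsE//; exact: HI.
  have h2 : `|(Ts n.+1 w)%:R - (Ts n0 w)%:R - (n%:R + 1 - n0%:R) * ell| <= dt * s.
    by rewrite !TsE// natr1; exact: HI.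
  have v1 : s * V t (y w) ord0 iL = (Ts n0 w)%:R - n0%:R * ell by rewrite TsE// VE.
  have := count_bound v1 h1 h2 T1 T2 (le_trans (qB ell) eL).
  rewrite (_ : t * kap * ell = t * ell * kap); last by ring.
  by move=> h3; exact: le_trans h3 f2.
- have h1 := HI iR n nn; have h2 := HA n nn; have h3 := HA n.+1 nn1; rewrite -natr1 in h3.
  have := reward_bound (VE iR) h1 h2 h3 Rn (le_trans (qB a) ea).
  rewrite (_ : t * kap * a = t * a * kap); last by ring.
  by move=> h4; exact: le_trans h4 f3.
Unshelve. all: by end_near. Qed.

End MainEstimate.

(** * The limit *)

Lemma truncn_div_cvg {R : realType} (kap : R) : 0 <= kap ->
  (Num.truncn (t * kap))%:R / t @[t --> +oo] --> kap.
Proof.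
move=> k0; apply/cvgrPdist_le => e e0; near=> t.
have t1 : 1 <= t by near: t; apply: nbhs_pinfty_ge; exact: num_real.
have te : e^-1 <= t by near: t; apply: nbhs_pinfty_ge; exact: num_real.
have t0 : 0 < t by exact: lt_le_trans ltr01 t1.
have n1 : (Num.truncn (t * kap))%:R <= t * kap by rewrite truncn_le// mulr_ge0// ltW.
have n2 : t * kap < (Num.truncn (t * kap))%:R + 1 by rewrite natr1 truncnS_gt.
have et : 1 <= e * t by rewrite -ler_pdivrMl// mulr1.
have -> : kap - (Num.truncn (t * kap))%:R / t = (t * kap - (Num.truncn (t * kap))%:R) / t.
  by field; rewrite gt_eqF.
by rewrite normrM normfV (gtr0_norm t0) ler_pdivrMr// ler_norml; apply/andP; split; lra.
Unshelve. all: by end_near. Qed.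

(** * Fluctuations of the cycle sums *)

Section Fluctuation.
Context {R : realType} {d : nat} {dT} {T : measurableType dT} (mu : probability T R).
Variable th : T -> T.
Hypotheses (mth : measurable_fun setT th)
  (pres : forall A, measurable A -> mu (th @^-1` A) = mu A).
Variable xi : 'I_(d + 2) -> T -> R.
Hypothesis mxi : forall i, measurable_fun setT (xi i).
Hypothesis xi2 : forall i, rint mu (fun x => xi i x ^+ 2).
(** Cramer-Wold: a linear combination of the centered components is a scalar sequence to which the
    one-dimensional limit theorem applies. Independence is assumed for these combinations, since it
    does not follow from that of the single components. *)
Let cxi (u : 'rV[R]_(d + 2)) x := \sum_i u ord0 i * (xi i x - \int[mu]_x xi i x).
Hypothesis ind : forall u, indep_maps mu (cxi u) th.
Variables m lam : 'rV[R]_d.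
Hypothesis kap0 : 0 <= kappa m lam.
Local Notation V := (renewal_fluctuation mu th m lam xi).

Let rxi i : rint mu (xi i). Proof. exact: rint_sqr. Qed.

Let mcxi u : measurable_fun setT (cxi u).
Proof.
apply: measurable_sum => i; apply: measurable_funM; first exact: measurable_cst.
by apply: measurable_funB => //; exact: measurable_cst.
Qed.

Lemma measurable_fluctuation t i : measurable_fun setT (fun x => V t x ord0 i).
Proof.
under eq_fun do rewrite mxE.
apply: measurable_funM; first exact: measurable_cst.
by apply: measurable_funB; [exact: measurable_rsum|exact: measurable_cst].
Qed.

Lemma centered_mean0 u : \int[mu]_x cxi u x = 0.
Proof.
have rB i : rint mu (fun x => xi i x - \int[mu]_x xi i x) by apply: rintB => //; exact: rint_cst.
rewrite /cxi Exp_sum => [|i]; last exact: rintZ.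
apply: big1 => i _; rewrite ExpZ// ExpB//; last exact: rint_cst.
by rewrite Exp_cst subrr mulr0.
Qed.

Lemma centered_sqr u : rint mu (fun x => cxi u x ^+ 2).
Proof.
have sq (i : 'I_(d + 2)) : rint mu (fun x => (u ord0 i * (xi i x - \int[mu]_x xi i x)) ^+ 2).
  rewrite (_ : (fun x => _) = fun x => u ord0 i ^+ 2 *
    ((xi i x ^+ 2 + (- 2 * \int[mu]_x xi i x) * xi i x) + (\int[mu]_x xi i x) ^+ 2)); last first.
    by apply/funext => x; ring.
  apply: rintZ; apply: rintD; last exact: rint_cst.
  by apply: rintD => //; exact: rintZ.
have ms (i : 'I_(d + 2)) : measurable_fun setT (fun x => u ord0 i * (xi i x - \int[mu]_x xi i x)).
  apply: measurable_funM; first exact: measurable_cst.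
  by apply: measurable_funB => //; exact: measurable_cst.
rewrite (_ : (fun x => _) = fun x => \sum_i \sum_j
  (u ord0 i * (xi i x - \int[mu]_x xi i x)) * (u ord0 j * (xi j x - \int[mu]_x xi j x))).
  by apply: rint_sum => i; apply: rint_sum => j; exact: rintM_sqr.
apply/funext => x; rewrite /cxi expr2 mulr_suml.
by apply: eq_bigr => i _; rewrite mulr_sumr.
Qed.

Lemma dotmx_fluctuation u t x :
  dotmx u (V t x) = (Num.sqrt t)^-1 * rsum th (cxi u) (Num.truncn (t * kappa m lam)) x.
Proof.
rewrite dotmxE; set n := Num.truncn _.
have -> : rsum th (cxi u) n x =
    \sum_i u ord0 i * (rsum th (xi i) n x - n%:R * \int[mu]_x xi i x).
  rewrite rsumE exchange_big/=; apply: eq_bigr => i _.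
  rewrite -mulr_sumr sumrB -rsumE; congr (_ * (_ - _)).
  by rewrite sumr_const_nat subn0 mulr_natl.
by rewrite mulr_sumr; apply: eq_bigr => i _; rewrite mxE -/n; ring.
Qed.

Lemma fluctuation_cos u be : \int[mu]_x cos (dotmx u (V t x) + be) @[t --> +oo] -->
  cos be * expR (- (kappa m lam * (\int[mu]_x (cxi u x ^+ 2)) / 2)).
Proof.
under eq_fun do (under eq_Rintegral do rewrite dotmx_fluctuation).
apply: renewal_cos_cvg => //; first exact: centered_sqr.
- exact: centered_mean0.
- exact: truncn_div_cvg.
Qed.

Lemma tight_fluctuation : tight mu V.
Proof.
move=> e e0.
pose u i : 'rV[R]_(d + 2) := delta_mx ord0 i.
pose s := \sum_i \int[mu]_x (cxi (u i) x ^+ 2).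
have s0 : 0 <= s.
  by apply: sumr_ge0 => i _; apply: Rintegral_ge0 => x _; exact: sqr_ge0.
(* Chosen for Markov's inequality applied to the squared Euclidean norm, whose mean is at most
   [kappa m lam * s]; the [+ 1] makes [K] positive. *)
pose K := Num.sqrt (kappa m lam * s / e) + 1.
have K0 : 0 < K by rewrite ltr_wpDl// sqrtr_ge0.
exists K => //; near=> t.
have t0 : 0 < t by near: t; apply: nbhs_pinfty_gt; exact: num_real.
have uE i j : u i ord0 j = (j == i)%:R by rewrite /u mxE.
have VE i x : V t x ord0 i = (Num.sqrt t)^-1 * rsum th (cxi (u i)) (Num.truncn (t * kappa m lam)) x.
  rewrite -dotmx_fluctuation dotmxE (bigD1 i)//= big1 => [|j ji].
    by rewrite uE eqxx mul1r addr0.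
  by rewrite uE (negbTE ji) mul0r.
have V2 i : rint mu (fun x => V t x ord0 i ^+ 2) /\
    \int[mu]_x (V t x ord0 i ^+ 2) <= kappa m lam * \int[mu]_x (cxi (u i) x ^+ 2).
  have [r2 _ E2] := rsum_moments mth (mcxi (u i)) (ind (u i)) pres (centered_sqr _)
    (centered_mean0 _) (Num.truncn (t * kappa m lam)).
  under eq_fun do rewrite VE exprMn exprVn sqr_sqrtr ?(ltW t0)//.
  split; first exact: rintZ.
  rewrite ExpZ// E2 mulrA ler_wpM2r//.
    by apply: Rintegral_ge0 => x _; exact: sqr_ge0.
  by rewrite ler_pdivrMl// truncn_le// mulr_ge0// ltW.
pose f x := Num.sqrt (\sum_i V t x ord0 i ^+ 2).
have fE x : f x ^+ 2 = \sum_i V t x ord0 i ^+ 2.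
  by rewrite sqr_sqrtr// sumr_ge0// => i _; exact: sqr_ge0.
have mf : measurable_fun setT f.
  apply: (measurableT_comp (continuous_measurable_fun (@sqrt_continuous R))).
  by apply: measurable_sum => i; apply: measurable_funX; exact: measurable_fluctuation.
have rf : rint mu (fun x => f x ^+ 2).
  by rewrite (funext fE); apply: rint_sum => i; have [] := V2 i.
have boxf : [set x | ~ box K (V t x)] `<=` [set x | K <= `|f x|].
  move=> x /= nb; rewrite ger0_norm ?sqrtr_ge0// leNgt; apply/negP => fK.
  apply: nb => i; rewrite -(ler_pXn2r (n := 2))// ?nnegrE ?(ltW K0)// real_normK ?num_real//.
  apply: (@le_trans _ _ (f x ^+ 2)).
    by rewrite fE (bigD1 i)//= lerDl sumr_ge0// => j _; exact: sqr_ge0.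
  by rewrite lerXn2r ?nnegrE ?sqrtr_ge0 ?(ltW K0)// ltW.
apply: (@le_trans _ _ (fine (mu [set x | K <= `|f x|]))).
  have mb : measurable [set x | ~ box K (V t x)].
    by apply: measurableC; apply: measurable_box => i; exact: measurable_fluctuation.
  have mK : measurable [set x | K <= `|f x|].
    have -> : [set x | K <= `|f x|] = (fun x => `|f x|) @^-1` `[K, +oo[%classic.
      by apply/seteqP; split => x /=; rewrite in_itv/= andbT.
    by apply: measurable_preimageT => //; exact: measurableT_comp.
  by apply: fine_le; rewrite ?fin_num_measure//; apply: le_measure; rewrite ?inE.
apply: (le_trans (markov_sqr K0 rf mf)); rewrite ler_pdivrMr ?exprn_gt0//.
have -> : \int[mu]_x (f x ^+ 2) = \sum_i \int[mu]_x (V t x ord0 i ^+ 2).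
  under eq_Rintegral do rewrite fE.
  by rewrite Exp_sum// => i; have [] := V2 i.
have h1 : \sum_i \int[mu]_x (V t x ord0 i ^+ 2) <= kappa m lam * s.
  by rewrite mulr_sumr; apply: ler_sum => i _; have [] := V2 i.
apply: (le_trans h1); rewrite -ler_pdivrMl// mulrC.
have q0 : 0 <= kappa m lam * s / e by rewrite divr_ge0 ?(ltW e0)// mulr_ge0.
rewrite -{1}(sqr_sqrtr q0) lerXn2r ?nnegrE ?sqrtr_ge0 ?(ltW K0)//.
by rewrite lerDl.
Unshelve. all: by end_near. Qed.

End Fluctuation.

(** [W kap] is almost surely the increment from time 0, whose projections are normal. The case of
    variance 0 is separate: there the projection vanishes almost surely. *)
Lemma brownian_cos {R : realType} {n : nat} {dO} {Om : measurableType dO} (P : probability Om R)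
    (W : R -> Om -> 'rV[R]_n) (Sigma : 'M[R]_n) (kap : R) (u : 'rV[R]_n) (be : R) :
  brownian_motion P W Sigma -> 0 <= kap -> 0 <= (u *m Sigma *m u^T) ord0 ord0 ->
  \int[P]_w cos (dotmx u (W kap w) + be) =
  cos be * expR (- (kap * (u *m Sigma *m u^T) ord0 ord0 / 2)).
Proof.
move=> [mW W0 gauss _ _] k0 s0; set s := (u *m Sigma *m u^T) ord0 ord0 in s0 *.
pose D w := dotmx u (W kap w - W 0 w).
have mdot t : 0 <= t -> measurable_fun setT (fun w => dotmx u (W t w)).
  move=> t0; under eq_fun do rewrite dotmxE.
  apply: measurable_sum => i; apply: measurable_funM; first exact: measurable_cst.
  exact: mW.
have DE w : D w = dotmx u (W kap w) - dotmx u (W 0 w).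
  by rewrite /D !dotmxE -sumrB; apply: eq_bigr => i _; rewrite !mxE mulrBr.
have mD : measurable_fun setT D.
  by rewrite (funext DE); apply: measurable_funB; exact: mdot.
have mcos (f : Om -> R) : measurable_fun setT f -> measurable_fun setT (fun w => (cos (f w + be))%:E).
  move=> mf; apply/measurable_EFinP.
  apply: (measurableT_comp (continuous_measurable_fun (@continuous_cos R))).
  by apply: measurable_funD => //; exact: measurable_cst.
transitivity (\int[P]_w cos (D w + be)).
  congr fine; apply: ae_eq_integral => //; [exact/mcos/mdot|exact: mcos|].
  apply: filterS W0 => w w0 _; rewrite DE w0.
  by rewrite [dotmx u 0]/dotmx trmx0 mulmx0 mxE subr0.
have := gauss 0 kap (lexx 0) k0 u.
have -> : (u *m ((kap - 0) *: Sigma) *m u^T) ord0 ord0 = kap * s.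
  by rewrite subr0 -scalemxAr -scalemxAl mxE.
rewrite /centered_normal; case: eqVneq => [-> D0|ks0 lawD].
  rewrite mul0r oppr0 expR0 mulr1 -[RHS](Exp_cst P).
  congr fine; apply: ae_eq_integral => //; first exact: mcos.
  have mD0 : measurable [set w | D w = 0].
    exact: (measurable_preimageT mD (@measurable_set1 _ (0 : R))).
  exists (~` [set w | D w = 0]); split; first exact: measurableC.
    by apply: (etrans (probability_setC P mD0)); rewrite [X in (1 - X)%E]D0 subee.
  by move=> w /= nw Dw; apply: nw => _; rewrite Dw add0r.
have ks : 0 < kap * s by rewrite lt_neqAle eq_sym ks0 mulr_ge0.
under eq_Rintegral do rewrite -[D _]mul1r.
rewrite (Exp_cos_normal 1 be _ mD lawD) ?sqrtr_gt0//.
by rewrite expr1n mulr1 sqr_sqrtr// ltW.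
Qed.

Section LimitFunctional.
Context {R : realType} {d : nat} (m lam : 'rV[R]_d) (H : set 'rV[R]_d) (M : R).
Hypotheses (d_ge1 : (1 <= d)%N) (m_gt0 : forall r, 0 < m ord0 r).
Hypothesis H_bounded : forall h, H h -> forall r, `|h ord0 r| <= M.
Variables al be ga : R.

(** One family for the four limits: with [v = W kappa0] the coefficients weigh [zeta], [W_L] and
    [W_R]. *)
Definition limit_functional (v : 'rV[R]_(d + 2)) (h : 'rV[R]_d) : R :=
  al * zeta m lam (fun r => v ord0 (lshift 2 r)) h + be * v ord0 (rshift d ord0)
    + ga * v ord0 (rshift d ord_max).

Let lower : exists2 b, 0 < b & forall r, b <= m ord0 r.
Proof.
have [|b b0 bm] := @positive_lower_bound _ _ [set: 'I_d]%SET (fun r => m ord0 r).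
  by move=> r _; exact: m_gt0.
by exists b => // r; apply: bm; rewrite inE.
Qed.

Lemma limit_functional_linfty v : @linfty R _ H (limit_functional v).
Proof.
have [b b0 bm] := lower.
pose K := \sum_i `|v ord0 i|.
have vK i : `|v ord0 i| <= K by rewrite /K (bigD1 i)//= lerDl sumr_ge0.
exists (`|al| * ((M + K) / b) + `|be| * K + `|ga| * K) => h Hh.
rewrite /limit_functional; apply: le_trans (ler_normD _ _) _; apply: lerD.
  apply: le_trans (ler_normD _ _) _; rewrite !normrM lerD ?ler_wpM2l//.
  apply: zeta_bound => // r; apply: le_trans (ler_normB _ _) _; rewrite lerD//.
  exact: H_bounded.
by rewrite normrM ler_wpM2l.
Qed.

Lemma limit_functional_continuous v (e : R) : 0 < e -> \forall v' \near v,
  forall h, H h -> `|limit_functional v h - limit_functional v' h| <= e.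
Proof.
move=> e0; have [b b0 bm] := lower.
pose D := `|al| / b + `|be| + `|ga| + 1.
have D0 : 0 < D by rewrite /D ltr_wpDl// !addr_ge0// divr_ge0// ltW.
have eD : 0 < e / D by rewrite divr_gt0.
apply: filterS (nbhsx_ballx v _ eD) => v' vv h _.
have {}vv i : `|v ord0 i - v' ord0 i| <= e / D.
  by apply: ltW; case: vv => _ /(_ ord0 i).
have [i0 Ii0 _] := kappa_attained m lam d_ge1.
have zz : `|zeta m lam (fun r => v ord0 (lshift 2 r)) h -
    zeta m lam (fun r => v' ord0 (lshift 2 r)) h| <= b^-1 * (e / D).
  apply: (min_over_dist Ii0) => r _.
  have -> (x y y' c : R) : (x - y) / c - (x - y') / c = c^-1 * (y' - y) by ring.
  rewrite normrM normfV (gtr0_norm (m_gt0 r)) ler_pM ?invr_ge0 ?(ltW (m_gt0 r))//; last by rewrite distrC.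
  by rewrite lef_pV2 ?posrE.
rewrite /limit_functional.
set z := zeta _ _ _ h in zz *; set z' := zeta _ _ _ h in zz *.
have -> (x y x' y' : R) : al * z + be * x + ga * y - (al * z' + be * x' + ga * y') =
    al * (z - z') + be * (x - x') + ga * (y - y') by ring.
apply: (@le_trans _ _ (`|al| * (b^-1 * (e / D)) + `|be| * (e / D) + `|ga| * (e / D))).
  apply: le_trans (ler_normD _ _) _; apply: lerD; last by rewrite normrM ler_wpM2l.
  by apply: le_trans (ler_normD _ _) _; rewrite !normrM lerD ?ler_wpM2l.
rewrite mulrA -!mulrDl -[leRHS](divfK (lt0r_neq0 D0)) mulrC.
by apply: ler_wpM2l; [exact: ltW|rewrite lerDl].
Qed.

End LimitFunctional.

Lemma compact_rV_bounded {R : realType} n (H : set 'rV[R]_n) : compact H ->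
  exists M, forall h, H h -> forall r, `|h ord0 r| <= M.
Proof.
move=> cH; have bdd r : exists M, forall h, H h -> `|h ord0 r| <= M.
  have : compact ((fun h : 'rV[R]_n => h ord0 r) @` H).
    by apply: continuous_compact => //; apply: continuous_subspaceT => h; exact: coord_continuous.
  move=> /compact_bounded[M [_ /(_ (M + 1))]]; rewrite ltrDl ltr01 => /(_ isT) HM.
  by exists (M + 1) => h Hh; apply: HM; exists h.
have {bdd}[M HM] := choice bdd.
exists (\sum_r `|M r|) => h Hh r; apply: le_trans (HM r h Hh) _.
by apply: le_trans (ler_norm _) _; rewrite (bigD1 r)//= lerDl sumr_ge0.
Qed.

Lemma bounded_vectors {R : realType} {d : nat} (N : nat) (F : d.-tuple nat -> R) :
  exists L, forall v, (forall r, tnth v r <= N)%N -> `|F v| <= L.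
Proof.
pose F' (v : d.-tuple 'I_N.+1) := `|F [tuple val (tnth v r) | r < d]|.
exists (\sum_v F' v) => v vN.
pose v' := [tuple (inord (tnth v r) : 'I_N.+1) | r < d].
rewrite (bigD1 v')//= (_ : `|F v| = F' v') ?lerDl ?sumr_ge0// => [i _|].
  exact: normr_ge0.
congr (`|F _|); apply: eq_from_tnth => r.
by rewrite tnth_mktuple /= tnth_mktuple inordK ?ltnS.
Qed.

(** For fixed large [t] the vectors [k t h] with [h] in [H] have bounded coordinates, so there are
    finitely many of them, and any function of [k t h] is bounded in [h]. *)
Lemma process_linfty {R : realType} {d : nat} (lam : 'rV[R]_d) (H : set 'rV[R]_d)
    (k : R -> 'rV[R]_d -> d.-tuple nat) (M : R) (U : Type) (F : R -> U -> d.-tuple nat -> R) :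
  uniform_approx H lam k -> (forall h, H h -> forall r, `|h ord0 r| <= M) ->
  \forall t \near +oo, forall w : U, @linfty R _ H (fun h => F t w (k t h)).
Proof.
move=> k_approx HM; apply: filterS (uniform_approx_near k_approx ltr01) => t kt w.
pose B := \sum_r `|t * lam ord0 r| + Num.sqrt t * `|M| + Num.sqrt t.
have [L FL] := bounded_vectors (Num.truncn B) (F t w).
exists L => h Hh; apply: FL => r.
rewrite -ltnS -(ltr_nat R); apply: le_lt_trans (truncnS_gt _).
have := kt h Hh r; rewrite mul1r ler_norml => /andP[_].
rewrite -addrA -opprD lerBlDr => /le_trans; apply.
rewrite /B addrC lerD2r lerD//.
  by rewrite (le_trans (ler_norm _))// (bigD1 r)//= lerDl sumr_ge0.
rewrite ler_wpM2l ?sqrtr_ge0// (le_trans (ler_norm _))// (le_trans (HM h Hh r))//.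
exact: ler_norm.
Qed.

(** * Cycle moments of the split chain and the joint limit *)

Section SplitChainCycles.
Context {R : realType} {d : nat} {dX} {X : measurableType dX}.
Variable q : d.-tuple nat -> R.-ker X ~> X.
Hypothesis q_strict : strict_semi_markov q.
Variable pi : probability X R.
Hypothesis P_harris : positive_harris (kerP q) pi.
Hypothesis mean_gt0 : forall r, (0 < mean_incr q pi r)%E.
Variable C : set X.
Hypotheses (mC : measurable C) (C_pos : (0 < pi C)%E).
Variable eps : R.
Hypothesis eps_01 : 0 < eps <= 1.
Variable theta : probability (X * d.-tuple nat)%type R.
Hypothesis Q_minor : minorized q C eps theta.
Context {dO} {Om : measurableType dO}.
Variables (Pa : probability Om R) (Z : nat -> Om -> X * bool * d.-tuple nat).
Hypothesis Z_split : markov_chain Pa Z (atom_init C pi) (split_kernel q C eps theta).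
Variable g : option X -> X -> d.-tuple nat -> R.
Hypothesis mg : measurable_reward g.
Hypothesis moments : (\int[Pa]_w (((L_ C Z 1 w)%:R ^+ 2 + (vnorm1 (Y_ C Z 1 w))%:R ^+ 2
                           + (Rcycle_abs C Z g 1 w) ^+ 2)%:E) < +oo)%E.
Variable x0 : X.

Local Notation E := (X * bool * d.-tuple nat)%type.
Local Notation e0 := (@atom_step _ X d x0).
Local Notation th := (regen (@coin _ X d) e0).
Local Notation mu := (path_law Z_split).
Local Notation y := (step_path Z).
Local Notation cyc := (cycle_sum (@coin _ X d) e0).

Let mZ n : measurable_fun setT (Z n). Proof. by case: Z_split. Qed.

Let mlast n : measurable_fun setT (last_step Z n). Proof. exact: measurable_last_step Z_split n. Qed.

Let my : measurable_fun setT y. Proof. exact: measurable_step_path Z_split. Qed.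

Let mcoin : measurable [set e : E | coin e].
Proof.
rewrite -[X in measurable X]/((fun e : E => e.1.2) @^-1` [set true]).
by apply: measurable_preimageT => //; exact: (measurableT_comp measurable_snd measurable_fst).
Qed.

Let k_ge0 := @step_kernel_ge0 _ _ _ _ _ _ _ _ mC eps_01 Q_minor.
Let mk := @measurable_step_kernel _ _ _ _ q _ eps theta mC.

Let k_atom (e : E) A : measurable A -> coin e ->
  step_kernel q C eps theta e A = step_kernel q C eps theta e0 A.
Proof. by move=> _ ce; exact: step_kernel_atom. Qed.

Let chain n A B := @path_law_chain _ _ _ _ _ _ _ _ mC eps_01 Q_minor _ _ _ _ _ Z_split x0 n A B.

Let returns : mu [set p | return_time (@coin _ X d) e0 p = 0%N] = 0%E.
Proof.
have [_ pi_inv] := P_harris.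
exact: (split_chain_returns q_strict mC eps_01 Q_minor pi_inv C_pos (@chain)).
Qed.

Lemma measurable_th : measurable_fun setT th.
Proof. exact: measurable_regen. Qed.

Lemma th_preserves B : measurable B -> mu (th @^-1` B) = mu B.
Proof. exact: (regen_preserves mcoin k_ge0 mk k_atom (@chain) returns). Qed.

Lemma measurable_cyc (f : E -> E -> R) : measurable_fun setT (fun z : E * E => f z.1 z.2) ->
  measurable_fun setT (cyc f).
Proof. by move=> mf; exact: measurable_cycle_sum. Qed.

Lemma cyc_indep (f : E -> E -> R) : measurable_fun setT (fun z : E * E => f z.1 z.2) ->
  indep_maps mu (cyc f) th.
Proof. exact: (cycle_sum_indep mcoin k_ge0 mk k_atom (@chain) returns). Qed.

Lemma regular_ae : {ae Pa, forall w, regular_path C Z w}.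
Proof.
have [mrec rec1] := recurrent_ae mcoin k_ge0 mk k_atom (@chain) returns.
have rec_ae : {ae Pa, forall w, recurrent_path (@coin _ X d) (y w)}.
  exists (~` (y @^-1` [set p | recurrent_path (@coin _ X d) p])); split => //.
    by apply: measurableC; exact: measurable_preimageT.
  rewrite probability_setC; last exact: measurable_preimageT.
  by rewrite -(path_lawE Z_split) rec1 subee.
have inc := ae_foralln (increasing_ae Z_split).
have cC := ae_foralln (coin_ae mC Z_split).
apply: filterS (filterI (filterI (start_ae mC Z_split) rec_ae) (filterI inc cC)).
move=> w [[[C0 c0 s0] rw] [iw cw]]; split => // -[|n] //; exact: cw.
Qed.

Lemma Exp_path (F : path_space E -> R) (f : Om -> R) :
  measurable_fun setT F -> measurable_fun setT f ->
  (forall w, regular_path C Z w -> f w = F (y w)) -> rint mu F ->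
  \int[Pa]_w f w = \int[mu]_p F p.
Proof.
move=> mF mf fF iF.
have E1 : (\int[Pa]_w (f w)%:E = \int[Pa]_w (F (y w))%:E)%E.
  apply: ae_eq_integral => //; first exact/measurable_EFinP.
    by apply/measurable_EFinP; exact: measurableT_comp.
  by apply: filterS regular_ae => w rw _; rewrite fF.
rewrite /Rintegral E1; congr (fine _).
rewrite integral_distribution//; last first.
  apply/integrableP; split; first by apply/measurable_EFinP; exact: measurableT_comp.
  have /integrableP[_] := iF; rewrite ge0_integral_distribution//.
  by apply: measurableT_comp => //; exact/measurable_EFinP.
exact/measurable_EFinP.
Qed.

Local Notation fI := (@increment_of R dX X d).
Local Notation fU := (@unit_time R dX X d).
Local Notation fR := (reward_of g).
Local Notation fA := (abs_reward_of g).

Let mI r : measurable_fun setT (fun z : E * E => fI r z.1 z.2) := measurable_increment_of r.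
Let mU : measurable_fun setT (fun z : E * E => fU z.1 z.2) := measurable_unit_time.
Let mR : measurable_fun setT (fun z : E * E => fR z.1 z.2) := measurable_reward_of mg.
Let mA : measurable_fun setT (fun z : E * E => fA z.1 z.2) := measurable_abs_reward_of mg.

Lemma cyc_ge0 (f : E -> E -> R) : (forall e e', 0 <= f e e') -> forall p, 0 <= cyc f p.
Proof. by move=> f0 p; rewrite /cycle_sum /path_sum sumr_ge0. Qed.

(** Counterpart of the integrand of [moments] on the path space. It dominates the square of each
    cycle sum. *)
Let G p := cyc fU p ^+ 2 + (\sum_r cyc (fI r) p) ^+ 2
  + cyc fA p ^+ 2.

Let mG : measurable_fun setT G.
Proof.
apply: measurable_funD; first apply: measurable_funD; apply: measurable_funX.
- exact: measurable_cyc.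
- by apply: measurable_sum => r; exact: measurable_cyc.
- exact: measurable_cyc.
Qed.

Let iG : rint mu G.
Proof.
apply: rint_ge0_fin => //; first by move=> p; rewrite !addr_ge0 ?sqr_ge0.
rewrite ge0_integral_distribution//; [|exact/measurable_EFinP|by move=> p; rewrite lee_fin !addr_ge0 ?sqr_ge0].
apply: le_lt_trans moments; rewrite le_eqVlt; apply/orP; left; apply/eqP/esym.
apply: ae_eq_integral => //.
- apply/measurable_EFinP; apply: measurable_funD; first apply: measurable_funD; apply: measurable_funX.
  + exact: (measurable_L1 x0 mC mZ).
  + rewrite (_ : (fun w => _) = fun w => \sum_r (tnth (Y_ C Z 1 w) r)%:R); last first.
      by apply/funext => w; rewrite /vnorm1 natr_sum.
    by apply: measurable_sum => r; exact: (measurable_Y1 x0 mC mZ).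
  + exact: (measurable_R1_abs x0 mC mZ mlast mg).
- by apply/measurable_EFinP; exact: measurableT_comp.
apply: filterS regular_ae => w rw _ /=; rewrite /G.
rewrite (L1_cycle x0 rw) (R1_abs_cycle x0 g rw) /vnorm1 natr_sum.
by congr ((_ + _ ^+ 2 + _)%:E); apply: eq_bigr => r _; rewrite (Y1_cycle x0 rw).
Qed.

Lemma cyc_unit_sqr : rint mu (fun p => cyc fU p ^+ 2).
Proof.
apply: (rint_le _ _ iG) => [|p]; first by apply: measurable_funX; exact: measurable_cyc.
by rewrite ger0_norm ?sqr_ge0// /G -addrA lerDl addr_ge0 ?sqr_ge0.
Qed.

Lemma cyc_abs_sqr : rint mu (fun p => cyc fA p ^+ 2).
Proof.
apply: (rint_le _ _ iG) => [|p]; first by apply: measurable_funX; exact: measurable_cyc.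
by rewrite ger0_norm ?sqr_ge0// /G lerDr addr_ge0 ?sqr_ge0.
Qed.

Lemma cyc_increment_sqr r : rint mu (fun p => cyc (fI r) p ^+ 2).
Proof.
apply: (rint_le _ _ iG) => [|p]; first by apply: measurable_funX; exact: measurable_cyc.
rewrite ger0_norm ?sqr_ge0// (@le_trans _ _ ((\sum_r cyc (fI r) p) ^+ 2))//; last first.
  by rewrite /G addrAC lerDr addr_ge0 ?sqr_ge0.
have c0 i : 0 <= cyc (fI i) p by apply: cyc_ge0 => e e'; rewrite ler0n.
rewrite lerXn2r ?nnegrE ?sumr_ge0//.
by rewrite (bigD1 r)//= lerDl sumr_ge0.
Qed.

Lemma cyc_reward_le p : `|cyc fR p| <= cyc fA p.
Proof. exact: ler_norm_sum. Qed.

Lemma cyc_reward_sqr : rint mu (fun p => cyc fR p ^+ 2).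
Proof.
apply: (rint_le _ _ cyc_abs_sqr) => [|p]; first by apply: measurable_funX; exact: measurable_cyc.
rewrite ger0_norm ?sqr_ge0// -(real_normK (num_real (cyc fR p))).
by rewrite lerXn2r ?nnegrE ?normr_ge0 ?cyc_reward_le// (le_trans _ (cyc_reward_le p)).
Qed.

Lemma mean_YE r : mean_Y C Z Pa ord0 r = \int[mu]_p cyc (fI r) p.
Proof.
rewrite mxE unlock; apply: Exp_path.
- exact: measurable_cyc.
- exact: (measurable_Y1 x0 mC mZ).
- by move=> w rw; rewrite (Y1_cycle x0 rw).
- by apply: rint_sqr (cyc_increment_sqr r); exact: measurable_cyc.
Qed.

Lemma mean_LE : mean_L C Z Pa = \int[mu]_p cyc fU p.
Proof.
rewrite /mean_L unlock; apply: Exp_path.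
- exact: measurable_cyc.
- exact: (measurable_L1 x0 mC mZ).
- by move=> w rw; rewrite (L1_cycle x0 rw).
- by apply: rint_sqr cyc_unit_sqr; exact: measurable_cyc.
Qed.

Lemma mean_RE : mean_R C Z g Pa = \int[mu]_p cyc fR p.
Proof.
rewrite /mean_R unlock; apply: Exp_path.
- exact: measurable_cyc.
- exact: (measurable_R1 x0 mC mZ mlast mg).
- by move=> w rw; rewrite (R1_cycle x0 g rw).
- by apply: rint_sqr cyc_reward_sqr; exact: measurable_cyc.
Qed.

Let mean0_null (F : path_space E -> R) : measurable_fun setT F -> (forall p, 0 <= F p) ->
  rint mu F -> \int[mu]_p F p = 0 -> mu [set p | F p != 0] = 0%E.
Proof.
move=> mF F0 iF EF; have mF' : measurable_fun setT (EFin \o F) by exact/measurable_EFinP.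
have : (\int[mu]_(p in setT) (EFin \o F) p)%E = 0%E by rewrite /= Exp_EFin// EF.
have f0 p : (0 <= (EFin \o F) p)%E by rewrite lee_fin.
by have [h _] := ge0_integral_null mu measurableT mF' f0 => /h; rewrite setTI.
Qed.

(** A cycle sum of length 0 means that there is no return, which is a null event. *)
Lemma mean_L_gt0 : 0 < mean_L C Z Pa.
Proof.
have U0 p : 0 <= cyc fU p by apply: cyc_ge0 => e e'; exact: ler01.
have iU : rint mu (cyc fU) by apply: rint_sqr cyc_unit_sqr; exact: measurable_cyc.
rewrite mean_LE lt_neqAle Rintegral_ge0 ?andbT//; apply/eqP => /esym EU.
have N := mean0_null (measurable_cyc mU) U0 iU EU.
have mN : measurable [set p | cyc fU p != 0].
  have := measurable_preimageT (measurable_cyc mU) (measurableC (@measurable_set1 _ (0 : R))).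
  by congr measurable; apply/seteqP; split => p /= /eqP.
have : mu setT = 0%E.
  rewrite (_ : setT = [set p | cyc fU p != 0] `|`
      [set p | return_time (@coin _ X d) e0 p = 0%N]).
    by rewrite measureU0//; exact: measurable_return_time_eq.
  apply/seteqP; split => // p _; rewrite /=.
  have [->|r0] := eqVneq (return_time (@coin _ X d) e0 p) 0%N; first by right.
  by left; rewrite /cycle_sum /path_sum sumr_const_nat subn0 pnatr_eq0.
have -> : mu setT = 1%E by exact: probability_setT.
by move/eqP; rewrite eqe oner_eq0.
Qed.

(** If the mean were 0, coordinate [r] would almost surely not grow in the first cycle, hence in no
    cycle by stationarity, hence never, against [increments_not_null]. *)
Lemma mean_Y_gt0 r : 0 < mean_Y C Z Pa ord0 r.
Proof.
have [harris pi_inv] := P_harris.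
have I0 p : 0 <= cyc (fI r) p by apply: cyc_ge0 => e e'; rewrite ler0n.
have iI : rint mu (cyc (fI r)) by apply: rint_sqr (cyc_increment_sqr r); exact: measurable_cyc.
rewrite mean_YE lt_neqAle Rintegral_ge0 ?andbT//; apply/eqP => /esym EI.
apply: (increments_not_null q_strict mC eps_01 Q_minor (@chain) harris pi_inv (mean_gt0 r)) => n.
have [mrec rec1] := recurrent_ae mcoin k_ge0 mk k_atom (@chain) returns.
have N0 := mean0_null (measurable_cyc (mI r)) I0 iI EI.
have mN0 : measurable [set p | cyc (fI r) p != 0].
  have := measurable_preimageT (measurable_cyc (mI r)) (measurableC (@measurable_set1 _ (0 : R))).
  by congr measurable; apply/seteqP; split => p /= /eqP.
pose N j := iter j th @^-1` [set p | cyc (fI r) p != 0].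
have mN j : measurable (N j).
  by apply: measurable_preimageT => //; apply: measurable_iter; exact: measurable_th.
have N0j j : mu (N j) = 0%E.
  by rewrite /N (iter_preserves measurable_th th_preserves).
have mUN : measurable (\bigcup_j N j) by exact: bigcupT_measurable.
have mrecC := measurableC mrec.
have rec0 : mu (~` [set p | recurrent_path (@coin _ X d) p]) = 0%E.
  by rewrite probability_setC// rec1 subee.
apply: (subset_measure0 _ _ _ (etrans (measureU0 mrecC mUN (measure_bigcup0 mN N0j)) rec0)).
- rewrite -[X in measurable X]/((fun p : path_space E => p n) @^-1` (snd @^-1` [set v | tnth v r <> 0%N])).
  apply: measurable_preimageT; first exact: measurable_coord.
  by apply: measurable_preimageT => //; exact: measurable_nat_vector.
- exact: measurableU.
move=> p /= pn; have [rp|] := pselect (recurrent_path (@coin _ X d) p); [right|by left].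
apply: contrapT => nN; apply: pn.
have cyc0 j : cyc (fI r) (iter j th p) = 0.
  by apply: contrapT => /eqP h; apply: nN; exists j.
have : rsum th (cyc (fI r)) n.+1 p = 0.
  by rewrite rsumE big1// => j _; exact: cyc0.
rewrite (rsum_cycle_sum (@increment_of_atom R _ X d x0 r))// /path_sum.
move=> /eqP; rewrite psumr_eq0 => [/allP h|i _]; last by rewrite /increment_of ler0n.
(* Each cycle takes at least one step, so the first [n.+1] cycles contain entry [n]. *)
have le_hit j : (j <= hit_time (@coin _ X d) e0 j p)%N.
  by elim: j => // j IH; rewrite (leq_ltn_trans IH)//; exact: hit_time_lt.
have nT := le_hit n.+1.
have := h n; rewrite mem_index_iota nT /= => /(_ isT).
by rewrite /increment_of /= pnatr_eq0 => /eqP.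
Qed.

Definition component (i : 'I_(d + 2)) : E -> E -> R :=
  match fintype.split i with
  | inl r => fI r
  | inr j => if j == ord0 then fU else fR
  end.

Local Notation ccyc i := (cyc (component i)).
Definition cmean i := \int[mu]_p ccyc i p.

Lemma measurable_component i : measurable_fun setT (fun z : E * E => component i z.1 z.2).
Proof. by rewrite /component; case: (fintype.split i) => [r|j] //; case: ifP. Qed.

Lemma ccyc_sqr i : rint mu (fun p => ccyc i p ^+ 2).
Proof.
rewrite /component; case: (fintype.split i) => [r|j]; first exact: cyc_increment_sqr.
by case: ifP => _; [exact: cyc_unit_sqr|exact: cyc_reward_sqr].
Qed.

Lemma ccyc_rint i : rint mu (ccyc i).
Proof. by apply: rint_sqr (ccyc_sqr i); apply: measurable_cyc; exact: measurable_component. Qed.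

Lemma cycle_vectorE w i : regular_path C Z w -> cycle_vector C Z g w ord0 i = ccyc i (y w).
Proof.
move=> rw; rewrite /cycle_vector mxE /component; case: (fintype.split i) => [r|j]; rewrite mxE.
  by rewrite (Y1_cycle x0 rw).
by case: ifP => _; [rewrite (L1_cycle x0 rw)|rewrite (R1_cycle x0 g rw)].
Qed.

Lemma measurable_cycle_vector i : measurable_fun setT (fun w => cycle_vector C Z g w ord0 i).
Proof.
rewrite /cycle_vector; under eq_fun do rewrite mxE.
case: (fintype.split i) => [r|j]; under eq_fun do rewrite mxE; first exact: (measurable_Y1 x0 mC mZ).
by case: (j == ord0); [exact: (measurable_L1 x0 mC mZ)|exact: (measurable_R1 x0 mC mZ mlast mg)].
Qed.

Definition centered (u : 'rV[R]_(d + 2)) p := \sum_i u ord0 i * (ccyc i p - cmean i).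

Lemma cov_cycle_vector u :
  (u *m cov_mx Pa (cycle_vector C Z g) *m u^T) ord0 ord0 = \int[mu]_p (centered u p ^+ 2).
Proof.
have mc i : measurable_fun setT (ccyc i) by apply: measurable_cyc; exact: measurable_component.
have mcB i : measurable_fun setT (fun p => ccyc i p - cmean i).
  by apply: measurable_funB => //; exact: measurable_cst.
have cB2 i : rint mu (fun p => (ccyc i p - cmean i) ^+ 2).
  have -> : (fun p => (ccyc i p - cmean i) ^+ 2) =
      (fun p => (ccyc i p ^+ 2 + (- 2 * cmean i) * ccyc i p) + cmean i ^+ 2).
    by apply/funext => p; ring.
  apply: rintD; last exact: rint_cst.
  by apply: rintD; [exact: ccyc_sqr|apply: rintZ; exact: ccyc_rint].
have iM i j : rint mu (fun p => (ccyc i p - cmean i) * (ccyc j p - cmean j)).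
  exact: rintM_sqr.
have covE i j : cov_mx Pa (cycle_vector C Z g) i j =
    \int[mu]_p ((ccyc i p - cmean i) * (ccyc j p - cmean j)).
  have EV l : fine ('E_Pa[fun w => cycle_vector C Z g w ord0 l])%E = cmean l.
    rewrite unlock; apply: Exp_path => //.
    - exact: measurable_cycle_vector.
    - by move=> w rw; exact: cycle_vectorE.
    - exact: ccyc_rint.
  rewrite mxE unlock !EV unlock; apply: Exp_path => //.
  - exact: measurable_funM.
  - apply: measurable_funM; apply: measurable_funB; rewrite ?measurable_cst//;
      exact: measurable_cycle_vector.
  - by move=> w rw /=; rewrite -!cycle_vectorE.
rewrite !mxE.
transitivity (\sum_i \sum_j (u ord0 i * u ord0 j) *
    \int[mu]_p ((ccyc i p - cmean i) * (ccyc j p - cmean j))).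
  rewrite exchange_big/=; apply: eq_bigr => j _; rewrite !mxE mulr_suml.
  by apply: eq_bigr => i _; rewrite covE; ring.
transitivity (\int[mu]_p (\sum_i \sum_j (u ord0 i * u ord0 j) *
    ((ccyc i p - cmean i) * (ccyc j p - cmean j)))).
  rewrite Exp_sum => [|i]; last by apply: rint_sum => j; exact: rintZ.
  apply: eq_bigr => i _; rewrite Exp_sum => [|j]; last exact: rintZ.
  by apply: eq_bigr => j _; rewrite ExpZ.
apply: eq_Rintegral => p _; rewrite /centered expr2 mulr_suml.
apply: eq_bigr => i _; rewrite mulr_sumr; apply: eq_bigr => j _; ring.
Qed.

(** A linear combination of cycle sums is the cycle sum of the combined step function, and centering
    only shifts it by a constant. *)
Lemma centered_indep u : indep_maps mu (centered u) th.
Proof.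
pose f (e e' : E) := \sum_i u ord0 i * component i e e'.
have mf : measurable_fun setT (fun z : E * E => f z.1 z.2).
  apply: measurable_sum => i; apply: measurable_funM; first exact: measurable_cst.
  exact: measurable_component.
have -> : centered u = (fun z => z - \sum_i u ord0 i * cmean i) \o cyc f.
  apply/funext => p /=; rewrite /centered /cycle_sum /path_sum /f exchange_big/= -sumrB.
  by apply: eq_bigr => i _; rewrite mulrBr mulr_sumr.
apply: (@indep_maps_comp _ _ _ _ _ _ _ _ _ _ _ _ (cyc f) th _ id) => //.
- by apply: measurable_funB => //; exact: measurable_cst.
- exact: cyc_indep.
Qed.

Let ll_ge0 (f : E -> E -> R) : measurable_fun setT (fun z : E * E => f z.1 z.2) ->
  (forall e e', 0 <= f e e') -> rint mu (fun p => cyc f p ^+ 2) -> locally_linear mu th (cyc f).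
Proof.
move=> mf f0 f2; apply: (locally_linear_ge0 measurable_th th_preserves) => //.
- exact: measurable_cyc.
- exact: cyc_indep.
- exact: cyc_ge0.
Qed.

Lemma locally_linear_abs_reward : locally_linear mu th (cyc fA).
Proof. by apply: ll_ge0 cyc_abs_sqr => // e e'; exact: normr_ge0. Qed.

(** Linearity is known for nonnegative terms, and both parts of [fR = (fR + fA) - fA] are of this
    kind. *)
Lemma locally_linear_reward : locally_linear mu th (cyc fR).
Proof.
pose f (e e' : E) := fR e e' + fA e e'.
have mf : measurable_fun setT (fun z : E * E => f z.1 z.2) by exact: measurable_funD.
have fE p : cyc f p = cyc fR p + cyc fA p by rewrite /cycle_sum /path_sum big_split.
have f2 : rint mu (fun p => cyc f p ^+ 2).
  rewrite (_ : (fun p => _) = fun p => cyc fR p ^+ 2 + 2 * (cyc fR p * cyc fA p) + cyc fA p ^+ 2).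
    apply: rintD; last exact: cyc_abs_sqr.
    apply: rintD; first exact: cyc_reward_sqr.
    apply: rintZ; apply: rintM_sqr; [exact: measurable_cyc|exact: measurable_cyc| |exact: cyc_abs_sqr].
    exact: cyc_reward_sqr.
  by apply/funext => p; rewrite fE; ring.
rewrite (_ : cyc fR = fun p => cyc f p - cyc fA p); last first.
  by apply/funext => p; rewrite fE addrK.
apply: locally_linearB.
- by apply: rint_sqr f2; exact: measurable_cyc.
- by apply: rint_sqr cyc_abs_sqr; exact: measurable_cyc.
- apply: ll_ge0 => // e e'; rewrite /f /abs_reward_of -lerBlDl sub0r.
  by rewrite -normrN; exact: ler_norm.
- exact: locally_linear_abs_reward.
Qed.

Lemma locally_linear_component i : locally_linear mu th (ccyc i).
Proof.
rewrite /component; case: (fintype.split i) => [r|j]; last case: ifP => _.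
- by apply: ll_ge0 (cyc_increment_sqr r) => // e e'; rewrite ler0n.
- by apply: ll_ge0 cyc_unit_sqr => // e e'; rewrite ler01.
- exact: locally_linear_reward.
Qed.

Lemma component_lshift r : component (lshift 2 r) = fI r.
Proof. by rewrite /component (unsplitK (inl _ r)). Qed.

Lemma component_time : component (rshift d ord0) = fU.
Proof. by rewrite /component (unsplitK (inr _ ord0)). Qed.

Lemma component_reward : component (rshift d ord_max) = fR.
Proof. by rewrite /component (unsplitK (inr _ ord_max)). Qed.

Lemma Csum_mono w : regular_path C Z w -> forall p n, (p <= n)%N -> vle (Csum C Z p w) (Csum C Z n w).
Proof.
move=> rw p n /subnKC <-; apply/forallP => r; rewrite !(tnth_Csum x0 rw).
elim: (n - p)%N => [|j IH]; first by rewrite addn0.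
by rewrite addnS (leq_trans IH)//; exact: (forallP (S_mono rw (ltnW (T_lt x0 rw _))) r).
Qed.

Lemma vle_Csum w : regular_path C Z w -> forall n v, vle (Csum C Z n w) v = vle (S_ Z (T_ C Z n w) w) v.
Proof. by move=> rw n v; apply: eq_forallb => r; rewrite (tnth_Csum x0 rw). Qed.

Lemma Ncount_bracket w : regular_path C Z w -> forall v n,
  vle (Csum C Z n w) v -> ~~ vle (Csum C Z n.+1 w) v ->
  (T_ C Z n w <= Ncount Z v w < T_ C Z n.+1 w)%N.
Proof. by move=> rw v n; rewrite !(vle_Csum rw); apply: count_bracket => p j; exact: (S_mono rw). Qed.

(** The steps after the last complete cycle stay within the next one, whose total absolute reward
    bounds their contribution. *)
Lemma Rtotal_near w : regular_path C Z w -> forall v n,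
  vle (Csum C Z n w) v -> ~~ vle (Csum C Z n.+1 w) v ->
  `|Rtotal Z g v w - rsum th (cyc fR) n (y w)| <=
    rsum th (cyc fA) n.+1 (y w) - rsum th (cyc fA) n (y w).
Proof.
move=> rw v n Cn CSn; have /andP[n1 /ltnW n2] := Ncount_bracket rw Cn CSn.
rewrite -!(reward_rsum x0 g rw) -!(abs_reward_rsum x0 g rw) /Rtotal.
rewrite (big_cat_nat _ n1)//= addrAC subrr add0r.
rewrite (big_cat_nat _ (leq_trans n1 n2))//= addrAC subrr add0r.
rewrite [leRHS](big_cat_nat _ n2)//=; apply: le_trans (ler_norm_sum _ _ _) _.
by rewrite lerDl sumr_ge0.
Qed.

Variable lam : 'rV[R]_d.
Hypothesis lam_simplex : simplex lam.
Variable H : set 'rV[R]_d.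
Hypothesis H_compact : compact H.
Variable k : R -> 'rV[R]_d -> d.-tuple nat.
Hypothesis k_approx : uniform_approx H lam k.
Hypothesis d_ge1 : (1 <= d)%N.
Context {dO'} {Om' : measurableType dO'} (P' : probability Om' R)
  (W : R -> Om' -> 'rV[R]_(d + 2)).
Hypothesis W_brownian : brownian_motion P' W (cov_mx Pa (cycle_vector C Z g)).

Local Notation m := (mean_Y C Z Pa).
Local Notation ell := (mean_L C Z Pa).
Local Notation a := (mean_R C Z g Pa).
Local Notation kap := (kappa m lam).
Local Notation xi := (fun i => ccyc i).
Local Notation V := (renewal_fluctuation mu th m lam xi).

Let lam_gt0 r : 0 < lam ord0 r. Proof. by have [/(_ r)/andP[]] := lam_simplex. Qed.

Let kap0 : 0 < kap. Proof. exact: (kappa_gt0 d_ge1 mean_Y_gt0 lam_gt0). Qed.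

(** A linear combination of the three processes is treated at once, because the error bounds hold
    for them simultaneously with one vector [V t]. Particular weights give the four statements; the
    last one needs the processes jointly, as there the [zeta] terms cancel. *)
Lemma process_cvg (c1 c2 c3 : R) :
  weak_cvg_linfty H Pa (fun t w h =>
    c1 * (((Ncycle C Z (k t h) w)%:R - t * kap) / Num.sqrt t) +
    c2 * (((Ncount Z (k t h) w)%:R - t * ell * kap) / Num.sqrt t) +
    c3 * ((Rtotal Z g (k t h) w - t * a * kap) / Num.sqrt t))
  P' (fun w => limit_functional m lam (c1 + c2 * ell + c3 * a) c2 c3 (W kap w)).
Proof.
have [M HM] := compact_rV_bounded H_compact.
have mxi i : measurable_fun setT (ccyc i) by apply: measurable_cyc; exact: measurable_component.
have tightV : tight mu V.
  apply: (tight_fluctuation measurable_th th_preserves mxi ccyc_sqr centered_indep).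
  exact: ltW.
have mV t i : measurable_fun setT (fun p => V t p ord0 i).
  exact: (measurable_fluctuation _ measurable_th mxi).
have mVy t i : measurable_fun setT (fun w => V t (y w) ord0 i).
  exact: (measurableT_comp (mV t i) my).
have mW i : measurable_fun setT (fun w => W kap w ord0 i).
  by have [mW _ _ _ _] := W_brownian; apply: mW; exact: ltW.
apply: (@weak_cvg_linfty_approx _ _ _ _ _ _ _ _ _ _ _ _ _ (fun t w => V t (y w))) => //.
- by move=> v; exact: (limit_functional_linfty _ d_ge1 mean_Y_gt0 HM).
- by move=> v e e0; apply: limit_functional_continuous => //; exact: mean_Y_gt0.
- move=> u be; have s0 : 0 <= \int[mu]_p (centered u p ^+ 2).
    by apply: Rintegral_ge0 => p _; exact: sqr_ge0.
  rewrite (brownian_cos _ W_brownian (ltW kap0)) cov_cycle_vector//.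
  rewrite (_ : (fun t => _) = fun t => \int[mu]_p cos (dotmx u (V t p) + be)).
    exact: (fluctuation_cos measurable_th th_preserves mxi ccyc_sqr centered_indep (ltW kap0)).
  apply/funext => t.
  have mcos n (f : measurableType n) (F : f -> 'rV[R]_(d + 2)) :
    (forall i, measurable_fun setT (fun w => F w ord0 i)) ->
    measurable_fun setT (fun w => cos (dotmx u (F w) + be)).
    move=> mF; apply: (measurableT_comp (continuous_measurable_fun (@continuous_cos R))).
    apply: measurable_funD; last exact: measurable_cst.
    under eq_fun do rewrite dotmxE.
    by apply: measurable_sum => i; apply: measurable_funM => //; exact: measurable_cst.
  apply: (@Exp_path (fun p => cos (dotmx u (V t p) + be))) => //; [exact: mcos|exact: mcos|].
  by apply: (@rint_bounded _ _ _ _ _ 1) => [|p]; [exact: mcos|rewrite ler_norml cos_geN1 cos_le1].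
- apply: (@process_linfty _ _ _ _ _ M Om (fun t w v =>
    c1 * (((Ncycle C Z v w)%:R - t * kap) / Num.sqrt t) +
    c2 * (((Ncount Z v w)%:R - t * ell * kap) / Num.sqrt t) +
    c3 * ((Rtotal Z g v w - t * a * kap) / Num.sqrt t)) k_approx HM).
(* The three errors enter with weights [c1], [c2], [c3], whose absolute values add up to less than
   [D]. *)
move=> dl e dl0 e0; pose D := `|c1| + `|c2| + `|c3| + 1.
have D0 : 0 < D by rewrite ltr_wpDl// !addr_ge0.
have dD : 0 < dl / D by rewrite divr_gt0.
have mE r : m ord0 r = \int[mu]_p ccyc (lshift 2 r) p by rewrite component_lshift mean_YE.
have lE : ell = \int[mu]_p ccyc (rshift d ord0) p by rewrite component_time mean_LE.
have aE : a = \int[mu]_p ccyc (rshift d ord_max) p by rewrite component_reward mean_RE.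
have CsE w : regular_path C Z w -> forall r n,
    (tnth (Csum C Z n w) r)%:R = rsum th (ccyc (lshift 2 r)) n (y w).
  by move=> rw r n; rewrite component_lshift (Csum_rsum x0 rw).
have TsE w : regular_path C Z w -> forall n,
    (T_ C Z n w)%:R = rsum th (ccyc (rshift d ord0)) n (y w).
  by move=> rw n; rewrite component_time (T_rsum x0 rw).
have Rnear w : regular_path C Z w -> forall v n,
    vle (Csum C Z n w) v -> ~~ vle (Csum C Z n.+1 w) v ->
    `|Rtotal Z g v w - rsum th (ccyc (rshift d ord_max)) n (y w)| <=
      rsum th (cyc fA) n.+1 (y w) - rsum th (cyc fA) n (y w).
  by rewrite component_reward; exact: Rtotal_near.
have lawy A : measurable A -> Pa (y @^-1` A) = mu A by [].
have main := main_estimate measurable_th th_preserves d_ge1 mean_Y_gt0 lam_gt0 mxi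
  locally_linear_component locally_linear_abs_reward mE tightV my lawy regular_ae
  Csum_mono CsE TsE Ncount_bracket Rnear HM k_approx dD e0.
apply: filterS main => t [B mB [PB nB]]; exists B; split => // w Bw h Hh.
have [] := nB w Bw h Hh; rewrite -lE -aE /limit_functional.
rewrite -[nat_sup _]/(Ncycle C Z (k t h) w).
set z := zeta _ _ _ _; set v1 := V t (y w) _ _; set v2 := V t (y w) _ _.
set A1 := (_ - _) / _; set A2 := (_ - _) / _; set A3 := (_ - _) / _ => h1 h2 h3.
have -> : (c1 + c2 * ell + c3 * a) * z + c2 * v1 + c3 * v2 - (c1 * A1 + c2 * A2 + c3 * A3) =
  c1 * (z - A1) + c2 * (v1 + ell * z - A2) + c3 * (v2 + a * z - A3) by ring.
apply: (@le_trans _ _ (`|c1| * (dl / D) + `|c2| * (dl / D) + `|c3| * (dl / D))).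
  apply: le_trans (ler_normD _ _) _; apply: lerD; last by rewrite normrM ler_wpM2l.
  by apply: le_trans (ler_normD _ _) _; rewrite !normrM lerD ?ler_wpM2l.
rewrite -!mulrDl -[leRHS](divfK (lt0r_neq0 D0)) mulrC.
by apply: ler_wpM2l; [exact: ltW|rewrite lerDl].
Qed.

End SplitChainCycles.

Theorem theorem5p7 (R : realType) (d : nat) (d_ge1 : (1 <= d)%N)
  (dX : measure_display) (X : measurableType dX) (X_sb : standard_borel R X)
  (q : d.-tuple nat -> R.-ker X ~> X) (q_strict : strict_semi_markov q)
  (pi : probability X R) (P_harris : positive_harris (kerP q) pi)
  (mu_pos_fin : forall r, (0 < mean_incr q pi r < +oo)%E)
  (C : set X) (C_meas : measurable C) (C_pos : (0 < pi C)%E)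
  (eps : R) (eps_01 : 0 < eps <= 1)
  (theta : probability (X * d.-tuple nat)%type R)
  (Q_minor : minorized q C eps theta)
  (dO : measure_display) (Om : measurableType dO) (Pa : probability Om R)
  (Z : nat -> Om -> X * bool * d.-tuple nat)
  (Z_split : markov_chain Pa Z (atom_init C pi) (split_kernel q C eps theta))
  (lam : 'rV[R]_d) (lam_simplex : simplex lam)
  (H : set 'rV[R]_d) (H_compact : compact H)
  (k : R -> 'rV[R]_d -> d.-tuple nat)
  (k_borel : forall t, 0 < t -> borel_on H (k t))
  (k_approx : uniform_approx H lam k)
  (g : option X -> X -> d.-tuple nat -> R) (g_meas : measurable_reward g)
  (moments : (\int[Pa]_w (((L_ C Z 1 w)%:R ^+ 2 + (vnorm1 (Y_ C Z 1 w))%:R ^+ 2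
                           + (Rcycle_abs C Z g 1 w) ^+ 2)%:E) < +oo)%E)
  (dO' : measure_display) (Om' : measurableType dO') (P' : probability Om' R)
  (W : R -> Om' -> 'rV[R]_(d + 2))
  (W_brownian : brownian_motion P' W (cov_mx Pa (cycle_vector C Z g))) :
  let m := mean_Y C Z Pa in
  let ell := mean_L C Z Pa in
  let a_g := mean_R C Z g Pa in
  let gbar := a_g / ell in
  let kappa0 := kappa m lam in
  let W_Y w r := W kappa0 w ord0 (lshift 2 r) in
  let W_L w := W kappa0 w ord0 (rshift d ord0) in
  let W_R w := W kappa0 w ord0 (rshift d ord_max) in
  let zeta0 w h := zeta m lam (W_Y w) h in
  [/\ weak_cvg_linfty H
        Pa (fun t w h => ((Ncycle C Z (k t h) w)%:R - t * kappa0) / Num.sqrt t)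
        P' (fun w h => zeta0 w h),
      weak_cvg_linfty H
        Pa (fun t w h => ((Ncount Z (k t h) w)%:R - t * ell * kappa0) / Num.sqrt t)
        P' (fun w h => W_L w + ell * zeta0 w h),
      weak_cvg_linfty H
        Pa (fun t w h => (Rtotal Z g (k t h) w - t * a_g * kappa0) / Num.sqrt t)
        P' (fun w h => W_R w + a_g * zeta0 w h)
    & weak_cvg_linfty H
        Pa (fun t w h => (Rtotal Z g (k t h) w - gbar * (Ncount Z (k t h) w)%:R)
                          / Num.sqrt t)
        P' (fun w h => W_R w - gbar * W_L w)].
Proof.
(* A point of [C] serves as representative of the atom. *)
have [x0 Cx0] : exists x, C x.
  apply: contrapT => /forallNP nC; move: C_pos.
  by rewrite (_ : C = set0) ?measure0 ?ltxx// -subset0 => x /nC.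
have mu_pos r : (0 < mean_incr q pi r)%E by have /andP[] := mu_pos_fin r.
pose cvg := process_cvg q_strict P_harris mu_pos C_meas C_pos eps_01 Q_minor Z_split g_meas moments
  x0 lam_simplex H_compact k_approx d_ge1 W_brownian.
have ell0 : 0 < mean_L C Z Pa.
  exact: (mean_L_gt0 q_strict P_harris C_meas C_pos eps_01 Q_minor Z_split g_meas moments x0).
move=> m ell a_g gbar kappa0 W_Y W_L W_R zeta0; split.
- rewrite (_ : (fun w h => zeta0 w h) = fun w => limit_functional m lam
    (1 + 0 * ell + 0 * a_g) 0 0 (W kappa0 w)); last first.
    by apply/funext => w; apply/funext => h; rewrite /limit_functional !mul0r !addr0 mul1r.
  rewrite (_ : (fun t w h => _) = fun t w h =>
    1 * (((Ncycle C Z (k t h) w)%:R - t * kappa0) / Num.sqrt t) +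
    0 * (((Ncount Z (k t h) w)%:R - t * ell * kappa0) / Num.sqrt t) +
    0 * ((Rtotal Z g (k t h) w - t * a_g * kappa0) / Num.sqrt t)); first exact: cvg.
  by apply/funext => t; apply/funext => w; apply/funext => h; rewrite !mul0r !addr0 mul1r.
- rewrite (_ : (fun w h => _) = fun w => limit_functional m lam
    (0 + 1 * ell + 0 * a_g) 1 0 (W kappa0 w)); last first.
    apply/funext => w; apply/funext => h.
    by rewrite /limit_functional !mul0r !addr0 !mul1r add0r addrC.
  rewrite (_ : (fun t w h => _) = fun t w h =>
    0 * (((Ncycle C Z (k t h) w)%:R - t * kappa0) / Num.sqrt t) +
    1 * (((Ncount Z (k t h) w)%:R - t * ell * kappa0) / Num.sqrt t) +
    0 * ((Rtotal Z g (k t h) w - t * a_g * kappa0) / Num.sqrt t)); first exact: cvg.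
  by apply/funext => t; apply/funext => w; apply/funext => h; rewrite !mul0r addr0 add0r mul1r.
- rewrite (_ : (fun w h => _) = fun w => limit_functional m lam
    (0 + 0 * ell + 1 * a_g) 0 1 (W kappa0 w)); last first.
    apply/funext => w; apply/funext => h.
    by rewrite /limit_functional !mul0r !addr0 !mul1r !add0r addrC.
  rewrite (_ : (fun t w h => _) = fun t w h =>
    0 * (((Ncycle C Z (k t h) w)%:R - t * kappa0) / Num.sqrt t) +
    0 * (((Ncount Z (k t h) w)%:R - t * ell * kappa0) / Num.sqrt t) +
    1 * ((Rtotal Z g (k t h) w - t * a_g * kappa0) / Num.sqrt t)); first exact: cvg.
  by apply/funext => t; apply/funext => w; apply/funext => h; rewrite !mul0r !add0r mul1r.
(* With weights [0], [- gbar], [1] the coefficient of [zeta0] is [- gbar * ell + a_g = 0], and the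
   centerings cancel for the same reason. *)
have gE : gbar * ell = a_g by rewrite divfK// gt_eqF.
rewrite (_ : (fun w h => _) = fun w => limit_functional m lam
  (0 + - gbar * ell + 1 * a_g) (- gbar) 1 (W kappa0 w)); last first.
  apply/funext => w; apply/funext => h; rewrite /limit_functional mulNr gE.
  by rewrite add0r mul1r addNr mul0r add0r mul1r mulNr addrC.
rewrite (_ : (fun t w h => _) = fun t w h =>
  0 * (((Ncycle C Z (k t h) w)%:R - t * kappa0) / Num.sqrt t) +
  - gbar * (((Ncount Z (k t h) w)%:R - t * ell * kappa0) / Num.sqrt t) +
  1 * ((Rtotal Z g (k t h) w - t * a_g * kappa0) / Num.sqrt t)); first exact: cvg.
by apply/funext => t; apply/funext => w; apply/funext => h; rewrite -gE; ring.
Qed.
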